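(* Let $(G,\mathbf p)_W$ be a real partially marked family of maps, with a choice for each $j=1,\dots,\nu-1$ of $\mu(j)$ or $l_j$, and let $L$, $R_1,\dots,R_{\nu-1}$, $V_w$ and $L_*$ be as defined in the context. For each $w\in L_*$, define $E_w\in T_w\mathbb C^\nu$ to be the unique unit vector in $\mathbb R^\nu$ orthogonal to the range of the matrix $V_w$ such that $$\det\left[\frac{1}{DG_w^{q_1-1}(w_1)}\nabla R_1(w),\dots,\frac{1}{DG_w^{q_{\nu-1}-1}(w_{\nu-1})}\nabla R_{\nu-1}(w),\,E_w\right]>0.$$ Then: - $E_w$ is a tangent vector to $L_*$ at $w$ and $L_*\ni w\mapsto E_w$ is real analytic. In particular, $E_w$ defines an orientation on the entire curve $L_*$ (called ''positive''). - If for some $\mathbf c_1\in L_*$ the corresponding map $g=G_{\mathbf c_1}$ is a marked map with an additional critical relation (as defined in the context) and the positively oriented transversality property holds for the local holomorphic deformation $(g,G,\mathbf p)_{W_{\mathbf c_1}}$, then $$\frac{1}{Dg^{q_\nu-1}(c_{1,\nu})}\,\nabla_E R_\nu(\mathbf c_1)>0,$$ where $Dg^{q_\nu-1}(c_{1,\nu})$ is the spatial derivative and $\nabla_ER_\nu(\mathbf c_1)$ is the derivative of $R_\nu$ at $\mathbf c_1$ in the direction of the tangent vector $E=E_{\mathbf c_1}$ of $L_*$.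
   Context: **Partially marked family.** $(G,\mathbf p)_W$ is a partially marked family of maps if: (1) $W\subset\mathbb C^\nu$ is open connected and $U\subset\mathbb C$ is open; (2) $\mathbf p=(p_1,\dots,p_\nu):W\to\mathbb C^\nu$ is holomorphic and all coordinates of $\mathbf p(w)$ are distinct; put $P_{0,w}=\{p_1(w),\dots,p_\nu(w)\}$; (3) $G:(w,z)\in W\times U\mapsto G_w(z)\in\mathbb C$ is holomorphic and $DG_w(z)\neq0$ for $w\in W,z\in U$; (4) to each $j=1,\dots,\nu-1$ is associated a positive integer $q_j$ such that $G_w^k(w_j)\in U$ for $k=0,\dots,q_j-2$ and $w=(w_1,\dots,w_\nu)\in W$. It is real if $W$ and $U$ are invariant under complex conjugation, $G_{\overline w}(\overline z)=\overline{G_w(z)}$ and $p_j(\overline w)=\overline{p_j(w)}$. **The set $L$.** For each $j=1,\dots,\nu-1$ choose either $\mu(j)\in\{1,\dots,\nu\}$ or $1\le l_j<q_j$. $L$ is the set of $w\in W$ such that: if $\mu(j)$ is defined then $G_w^{q_j-1}(w_j)=p_{\mu(j)}(w)$ and $G_w^k(w_j)\notin P_{0,w}$ for $0\le k<q_j-1$; if $l_j$ is defined then $G_w^{q_j-1}(w_j)=G_w^{l_j-1}(w_j)$ and $G_w^k(w_j)\notin P_{0,w}$ for all $0\le k\le q_j-1$. Label so that the first alternative holds for $1\le j\le r$ and the second for $r<j\le\nu-1$. For $w\in W$ put $R_j(w)=G_w^{q_j-1}(w_j)-p_{\mu(j)}(w)$ for $1\le j\le r$ and $R_j(w)=G_w^{q_j-1}(w_j)-G_w^{l_j-1}(w_j)$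 for $r<j\le\nu-1$ (so $R_j=0$ on $L$). **The curve $L_*$.** $L_*$ is a maximal connected subset of $L\cap\mathbb R^\nu$ such that for each $w\in L_*$ the $\nu\times(\nu-1)$ matrix $$V_w=\left[\frac{1}{DG_w^{q_1-1}(w_1)}\nabla R_1(w),\dots,\frac{1}{DG_w^{q_{\nu-1}-1}(w_{\nu-1})}\nabla R_{\nu-1}(w)\right]$$ has rank $\nu-1$ ($\nabla R_i$ is the gradient in $w$, written as a column). By the implicit function theorem $L_*$ is a real analytic curve. **Additional critical relation at $\mathbf c_1=(c_{1,1},\dots,c_{1,\nu})\in L_*$.** The map $g=G_{\mathbf c_1}$, with $g(p_j(\mathbf c_1))=c_{1,j}$, has an additional critical relation starting with $p_\nu$, i.e. $g$ is a marked map: with $P_0=P_{0,\mathbf c_1}$, $g$ is defined on $P_0\cup U_{\mathbf c_1}$ and there is a finite set $P\supset P_0$ with $g(P)\subset P$, $P\setminus P_0\subset U_{\mathbf c_1}$, $g|_{U_{\mathbf c_1}}$ holomorphic and $g'\ne0$ on $P\setminus P_0$. Moreover $G$ extends to a local holomorphic deformation of $g$: there are a neighbourhood $W_{\mathbf c_1}\subset W$ of $\mathbf c_1$ and an open set $U_{\mathbf c_1}\supset U$ such that $G$ extends holomorphically to $W_{\mathbf c_1}\times U_{\mathbf c_1}$ with $DG_w|_{U_{\mathbf c_1}}\neq0$ for $w\in W_{\mathbf c_1}$. There exist $q_\nu\ge1$ and either $\mu(\nu)\in\{1,\dots,\nu\}$ with $g^{q_\nu}(p_\nu(\mathbf c_1))=p_{\mu(\nu)}(\mathbf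 c_1)$ and $g^k(c_{1,\nu})\notin P_{0,\mathbf c_1}$ for $0\le k<q_\nu-1$, in which case $R_\nu(w)=G_w^{q_\nu-1}(w_\nu)-p_{\mu(\nu)}(w)$; or $1\le l_\nu<q_\nu$ with $g^{q_\nu}(p_\nu(\mathbf c_1))=g^{l_\nu}(p_\nu(\mathbf c_1))$ and $g^k(c_{1,\nu})\notin P_{0,\mathbf c_1}$ for all $0\le k\le q_\nu-1$, in which case $R_\nu(w)=G_w^{q_\nu-1}(w_\nu)-G_w^{l_\nu-1}(w_\nu)$. $R_\nu$ is defined near $\mathbf c_1$. **Positively oriented transversality** for $(g,G,\mathbf p)_{W_{\mathbf c_1}}$: with $\mathcal R=(R_1,\dots,R_\nu)$, $\det(D\mathcal R(\mathbf c_1))/\prod_{j=1}^\nu Dg^{q_j-1}(c_{1,j})>0$. *)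

(* Defs.v *)
From HB Require Import structures.
From mathcomp Require Import all_boot all_order all_algebra.
From mathcomp Require Import all_classical all_reals all_analysis.
From mathcomp Require Import complex.
Set Implicit Arguments.
Unset Strict Implicit.
Unset Printing Implicit Defensive.
Import Order.TTheory GRing.Theory Num.Theory.
Import numFieldNormedType.Exports.
Local Open Scope classical_set_scope.
Local Open Scope ring_scope.

(* Declaring the complex numbers at type numClosedFieldType gives access to
   the norm topology that MathComp-Analysis puts on every such field. *)
Definition Cx (R : realType) : numClosedFieldType := (R[i])%C.

Definition toCx (R : realType) (x : R) : Cx R := (x%:C)%C.

Definition vecCx (R : realType) (n : nat) (x : 'rV[R]_n) : 'rV[Cx R]_n :=
  map_mx (@toCx R) x.

(* Over Cx R, [differentiable] is complex Frechet differentiability. *)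
Definition holomorphic_on (R : realType) (X Y : normedModType (Cx R))
    (f : X -> Y) (A : set X) : Prop :=
  forall x, A x -> differentiable f x.

(* The dimension nu >= 1 is written n.+1.  The index set {1, .., nu} is
   'I_n.+1, the index nu is ord_max, and {1, .., nu - 1} is 'I_n, which
   embeds in 'I_n.+1 with the same values through [lift ord_max]. *)
Definition low (n : nat) (j : 'I_n) : 'I_n.+1 := lift ord_max j.

Definition ext_last (T : Type) (n : nat) (f : 'I_n -> T) (x : T) (i : 'I_n.+1)
  : T := oapp f x (unlift ord_max i).

Definition marked_points (R : realType) (n : nat)
    (p : 'rV[Cx R]_n.+1 -> 'rV[Cx R]_n.+1) (w : 'rV[Cx R]_n.+1) : set (Cx R) :=
  [set p w 0 j | j in [set: 'I_n.+1]].

(* [pm_G] and [pm_p] are total functions, constrained only on W x U and W. *)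
Record partially_marked_family (R : realType) (n : nat) := PartiallyMarked {
  pm_W : set 'rV[Cx R]_n.+1;
  pm_U : set (Cx R);
  pm_G : 'rV[Cx R]_n.+1 -> Cx R -> Cx R;
  pm_p : 'rV[Cx R]_n.+1 -> 'rV[Cx R]_n.+1;
  pm_q : 'I_n -> nat;
  pm_W_open : open pm_W;
  pm_W_connected : connected pm_W;
  pm_U_open : open pm_U;
  pm_p_holo : holomorphic_on pm_p pm_W;
  pm_p_distinct : forall w, pm_W w -> injective (pm_p w 0);
  pm_G_holo : holomorphic_on
    (fun x : 'rV[Cx R]_n.+1 * Cx R => pm_G x.1 x.2) (pm_W `*` pm_U);
  pm_DG_neq0 : forall w z, pm_W w -> pm_U z -> derive1 (pm_G w) z != 0;
  pm_q_gt0 : forall j, (0 < pm_q j)%N;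
  pm_orbit : forall w j k, pm_W w -> (k.+1 < pm_q j)%N ->
    pm_U (iter k (pm_G w) (w 0 (low j)))
}.

Definition real_family (R : realType) (n : nat)
    (M : partially_marked_family R n) : Prop :=
  [/\ forall w, pm_W M w -> pm_W M (map_mx Num.conj w),
      forall z, pm_U M z -> pm_U M z^*,
      forall w z, pm_W M w -> pm_U M z ->
        pm_G M (map_mx Num.conj w) z^* = (pm_G M w z)^* &
      forall w j, pm_W M w -> pm_p M (map_mx Num.conj w) 0 j = (pm_p M w 0 j)^*].

(* The choice of either mu(j) or l_j. *)
Inductive target (n : nat) : Type :=
  | Mu of 'I_n.+1
  | El of nat.

Definition valid_target (n : nat) (q : nat) (t : target n) : Prop :=
  match t with Mu _ => True | El l => (0 < l < q)%N end.

Definition critical_relation (R : realType) (n : nat)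
    (G : 'rV[Cx R]_n.+1 -> Cx R -> Cx R)
    (p : 'rV[Cx R]_n.+1 -> 'rV[Cx R]_n.+1)
    (i : 'I_n.+1) (q : nat) (t : target n) (w : 'rV[Cx R]_n.+1) : Cx R :=
  iter q.-1 (G w) (w 0 i) -
  match t with Mu m => p w 0 m | El l => iter l.-1 (G w) (w 0 i) end.

Definition Rj (R : realType) (n : nat) (M : partially_marked_family R n)
    (t : 'I_n -> target n) (j : 'I_n) : 'rV[Cx R]_n.+1 -> Cx R :=
  critical_relation (pm_G M) (pm_p M) (low j) (pm_q M j) (t j).

Definition Lset (R : realType) (n : nat) (M : partially_marked_family R n)
    (t : 'I_n -> target n) : set 'rV[Cx R]_n.+1 :=
  [set w | pm_W M w /\ forall j : 'I_n,
    let orb k := iter k (pm_G M w) (w 0 (low j)) in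
    let P0 := marked_points (pm_p M) w in
    let q := pm_q M j in
    match t j with
    | Mu m => orb q.-1 = pm_p M w 0 m /\
              forall k, (k < q.-1)%N -> ~ P0 (orb k)
    | El l => orb q.-1 = orb l.-1 /\
              forall k, (k <= q.-1)%N -> ~ P0 (orb k)
    end].

Definition Vmx (R : realType) (n : nat) (M : partially_marked_family R n)
    (t : 'I_n -> target n) (w : 'rV[Cx R]_n.+1) : 'M[Cx R]_(n.+1, n) :=
  \matrix_(i < n.+1, j < n)
    ((derive1 (iter (pm_q M j).-1 (pm_G M w)) (w 0 (low j)))^-1 *
     'D_(delta_mx 0 i) (Rj M t j) w).

Definition regular_points (R : realType) (n : nat)
    (M : partially_marked_family R n) (t : 'I_n -> target n) :
    set 'rV[R]_n.+1 :=
  [set x | Lset M t (vecCx x) /\ \rank (Vmx M t (vecCx x)) = n].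

Definition maximal_connected (T : topologicalType) (S A : set T) : Prop :=
  [/\ A `<=` S, connected A &
      forall B, A `<=` B -> B `<=` S -> connected B -> B = A].

(* The order of Cx R is partial: 0 < z means that z is real and positive. *)
Definition positive_unit_normal (R : realType) (n : nat)
    (M : partially_marked_family R n) (t : 'I_n -> target n)
    (w e : 'rV[R]_n.+1) : Prop :=
  let V := Vmx M t (vecCx w) in
  [/\ \sum_i e 0 i ^+ 2 = 1,
      forall x : 'cV[Cx R]_n, \sum_i (V *m x) i 0 * vecCx e 0 i = 0 &
      0 < \det (\matrix_(i < n.+1, j < n.+1)
                  ext_last (V i) (vecCx e 0 i) j)].

Definition real_analytic_at (R : realType) (m : nat) (f : R -> 'rV[R]_m.+1)
    (s : R) : Prop :=
  exists (a : nat -> 'rV[R]_m.+1) (e : R), 0 < e /\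
    forall u, `|u - s| < e ->
      series (fun k => (u - s) ^+ k *: a k) @ \oo --> f u.

(* A local real analytic parametrization of the set A: a regular real analytic
   path on ]a, b[ that is a homeomorphism onto a relatively open subset of A
   (with J = ]a, b[ the last clause says that the image is open in A). *)
Definition analytic_param (R : realType) (m : nat) (A : set 'rV[R]_m.+1)
    (a b : R) (c : R -> 'rV[R]_m.+1) : Prop :=
  let I := [set s | a < s < b] in
  [/\ forall s, I s -> A (c s),
      forall s, I s -> real_analytic_at c s /\ derive1 c s != 0,
      forall s s', I s -> I s' -> c s = c s' -> s = s' &
      forall J : set R, open J -> J `<=` I ->
        exists2 N : set 'rV[R]_m.+1, open N & c @` J = A `&` N].

Definition real_analytic_curve (R : realType) (m : nat)
    (A : set 'rV[R]_m.+1) : Prop :=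
  forall x, A x -> exists (a b : R) (c : R -> 'rV[R]_m.+1),
    analytic_param A a b c /\ exists2 s, a < s < b & c s = x.

Definition real_analytic_on_curve (R : realType) (m k : nat)
    (A : set 'rV[R]_m.+1) (f : 'rV[R]_m.+1 -> 'rV[R]_k.+1) : Prop :=
  forall (a b : R) (c : R -> 'rV[R]_m.+1), analytic_param A a b c ->
    forall s, a < s < b -> real_analytic_at (f \o c) s.

Definition tangent_vector (R : realType) (m : nat) (A : set 'rV[R]_m.+1)
    (x v : 'rV[R]_m.+1) : Prop :=
  exists c : R -> 'rV[R]_m.+1,
    [/\ c 0 = x, \forall s \near (0 : R), A (c s) & is_derive (0 : R) 1 c v].

(* The parametrizations of A whose velocity is everywhere a positive multiple
   of the field E cover A, i.e. form an oriented atlas of A. *)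
Definition defines_orientation (R : realType) (m : nat) (A : set 'rV[R]_m.+1)
    (E : 'rV[R]_m.+1 -> 'rV[R]_m.+1) : Prop :=
  forall x, A x -> exists (a b : R) (c : R -> 'rV[R]_m.+1),
    [/\ analytic_param A a b c,
        exists2 s, a < s < b & c s = x &
        forall s, a < s < b -> exists2 r, 0 < r & derive1 c s = r *: E (c s)].

(* A marked map on P0 `|` U; the total function g is unconstrained elsewhere. *)
Definition marked_map (R : realType) (P0 U : set (Cx R)) (g : Cx R -> Cx R)
  : Prop :=
  open U /\ exists P : set (Cx R),
    [/\ finite_set P, P0 `<=` P & g @` P `<=` P] /\
    [/\ P `\` P0 `<=` U, holomorphic_on g U &
        forall z, (P `\` P0) z -> derive1 g z != 0].

(* G' is the holomorphic extension of the family to W1 x U1, and g the map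
   G'_{c1} on U1 together with its prescribed values at the points p_j(c1). *)
Definition local_deformation (R : realType) (n : nat)
    (M : partially_marked_family R n) (c1 : 'rV[Cx R]_n.+1)
    (g : Cx R -> Cx R) (W1 : set 'rV[Cx R]_n.+1) (U1 : set (Cx R))
    (G' : 'rV[Cx R]_n.+1 -> Cx R -> Cx R) : Prop :=
  [/\ open W1, W1 c1, W1 `<=` pm_W M, open U1 & pm_U M `<=` U1] /\
  [/\ forall w z, W1 w -> pm_U M z -> G' w z = pm_G M w z,
      holomorphic_on (fun x : 'rV[Cx R]_n.+1 * Cx R => G' x.1 x.2)
        (W1 `*` U1),
      forall w z, W1 w -> U1 z -> derive1 (G' w) z != 0,
      forall z, U1 z -> g z = G' c1 z &
      forall j, g (pm_p M c1 0 j) = c1 0 j].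

Definition additional_relation (R : realType) (n : nat)
    (M : partially_marked_family R n) (c1 : 'rV[Cx R]_n.+1)
    (g : Cx R -> Cx R) (qn : nat) (tn : target n) : Prop :=
  let P0 := marked_points (pm_p M) c1 in
  let pn := pm_p M c1 0 ord_max in
  let cn := c1 0 ord_max in
  [/\ (0 < qn)%N, valid_target qn tn &
    match tn with
    | Mu m => iter qn g pn = pm_p M c1 0 m /\
              forall k, (k < qn.-1)%N -> ~ P0 (iter k g cn)
    | El l => iter qn g pn = iter l g pn /\
              forall k, (k <= qn.-1)%N -> ~ P0 (iter k g cn)
    end].

(* The relation map (R_1, .., R_nu), with R_nu computed from the extension. *)
Definition relation_map (R : realType) (n : nat)
    (M : partially_marked_family R n) (t : 'I_n -> target n)
    (G' : 'rV[Cx R]_n.+1 -> Cx R -> Cx R) (qn : nat) (tn : target n)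
    (w : 'rV[Cx R]_n.+1) : 'rV[Cx R]_n.+1 :=
  \row_(i < n.+1) ext_last (fun j => Rj M t j w)
    (critical_relation G' (pm_p M) ord_max qn tn w) i.

(* 'J is the transpose of the usual Jacobian matrix, with the same \det. *)
Definition positively_oriented_transversality (R : realType) (n : nat)
    (M : partially_marked_family R n) (t : 'I_n -> target n)
    (c1 : 'rV[Cx R]_n.+1) (g : Cx R -> Cx R)
    (G' : 'rV[Cx R]_n.+1 -> Cx R -> Cx R) (qn : nat) (tn : target n) : Prop :=
  0 < \det ('J (relation_map M t G' qn tn) c1) /
      \prod_(j < n.+1)
        derive1 (iter (ext_last (pm_q M) qn j).-1 g) (c1 0 j).

(* Main.v *)
Require Import Defs.
From HB Require Import structures.
From mathcomp Require Import all_boot all_order all_algebra.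
From mathcomp Require Import all_classical all_reals all_analysis.
From mathcomp Require Import complex ring lra.
Set Implicit Arguments.
Unset Strict Implicit.
Unset Printing Implicit Defensive.
Import Order.TTheory GRing.Theory Num.Theory.
Import numFieldNormedType.Exports.
Local Open Scope classical_set_scope.
Local Open Scope ring_scope.

(* The vector N of signed maximal minors of V_w satisfies
   det [V_w, u] = <u, N> for every u, so the positive unit normal exists, is
   unique, and equals N / |N|; it depends analytically on w.  The relations
   R_j are holomorphic, so the implicit function theorem, applied to
   (R_1, .., R_(nu-1), <w - x, E_x>), shows that near x in L_* the common
   zeros form an analytic arc parametrized by <w - x, E_x>; maximality puts
   the whole arc in L_*, and its velocity, being orthogonal to V_w, is a
   positive multiple of E_w.  Finally, with u the gradient of R_nu divided by
   Dg^(q_nu - 1), the transversality quotient is det [V_w, u] = |N| <u, E_w>,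
   whence the sign of the derivative of R_nu along E.

   Complex differentiability at each point is turned into analyticity without
   contour integrals: a maximum principle for functions with second order
   expansions yields power series, and such an expansion holds for an
   antiderivative, obtained from Goursat's bisection with real antiderivatives
   along horizontal and vertical segments. *)

(** Holomorphy is given only as differentiability at each point, without continuity of the
    derivative, whereas the implicit function theorem needs strict differentiability. The averaging
    argument for the maximum principle needs a second order term, which plain differentiability does
    not provide. The way back from a primitive F to f is a closure property: second order expansions
    survive bounded uniform limits, and f is such a limit of difference quotients of F. Each
    difference quotient costs a factor 8/r, so the series on a disc of radius r is controlled only
    for |h| < r/8; every later use is local.

    The real curve is built in complex space: the implicit function theorem is a contraction whose
    iterates depend holomorphically on a complex parameter and are real when the parameter is real.
    Real analyticity of the arc and of E then means that they extend holomorphically in the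
    parameter. For E this calls for the sum of the squares of the minors, without conjugates, and
    for a holomorphic square root. *)

(** * Complex numbers *)

(* Cx R unfolds to a concrete structure, on which unification with the
   topological lemmas diverges; working in an abstract copy prevents this. *)
Record complex_model (R : realType) := ComplexModel {
  cm_sort :> numClosedFieldType;
  reC : cm_sort -> R;
  imC : cm_sort -> R;
  mkC : R -> R -> cm_sort;
  re_mk : forall x y, reC (mkC x y) = x;
  im_mk : forall x y, imC (mkC x y) = y;
  mkC_K : forall z, mkC (reC z) (imC z) = z;
  mk_add : forall x y x' y', mkC x y + mkC x' y' = mkC (x + x') (y + y');
  mk_mul : forall x y x' y',
    mkC x y * mkC x' y' = mkC (x * x' - y * y') (x * y' + y * x');
  mk_conj : forall x y, (mkC x y)^* = mkC x (- y);
  mk_le : forall x y x' y',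
    (mkC x y <= mkC x' y') = (y' == y) && (x <= x');
  mk_norm : forall x y, `|mkC x y| = mkC (Num.sqrt (x ^+ 2 + y ^+ 2)) 0
}.

Lemma Complex_norm (R : realType) (x y : R) :
  `|Complex x y : Cx R| = Complex (Num.sqrt (x ^+ 2 + y ^+ 2)) 0.
Proof. by rewrite normc_def. Qed.

Definition Cx_model (R : realType) : complex_model R :=
  @ComplexModel R (Cx R) (@complex.Re R) (@complex.Im R) (@Complex R)
    (fun _ _ => erefl) (fun _ _ => erefl) (fun z => let: Complex x y := z in erefl)
    (fun _ _ _ _ => erefl) (fun _ _ _ _ => erefl) (fun _ _ => erefl)
    (fun _ _ _ _ => erefl) (@Complex_norm R).

Section Modulus.
Variables (R : realType) (C : complex_model R).
Implicit Types (z w : C) (x y e : R).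

Definition toC x : C := mkC C x 0.

Lemma C_ext z w : reC z = reC w -> imC z = imC w -> z = w.
Proof. by move=> h k; rewrite -(mkC_K z) h k mkC_K. Qed.

Lemma reD z w : reC (z + w) = reC z + reC w.
Proof. by rewrite -(mkC_K z) -(mkC_K w) mk_add !re_mk. Qed.
Lemma imD z w : imC (z + w) = imC z + imC w.
Proof. by rewrite -(mkC_K z) -(mkC_K w) mk_add !im_mk. Qed.
Lemma reM z w : reC (z * w) = reC z * reC w - imC z * imC w.
Proof. by rewrite -(mkC_K z) -(mkC_K w) mk_mul !re_mk !im_mk. Qed.
Lemma imM z w : imC (z * w) = reC z * imC w + imC z * reC w.
Proof. by rewrite -(mkC_K z) -(mkC_K w) mk_mul !re_mk !im_mk. Qed.
Lemma re_conj z : reC z^* = reC z.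
Proof. by rewrite -(mkC_K z) mk_conj !re_mk. Qed.
Lemma im_conj z : imC z^* = - imC z.
Proof. by rewrite -(mkC_K z) mk_conj !im_mk. Qed.
Lemma re0 : reC (0 : C) = 0.
Proof. by apply: (addrI (reC (0 : C))); rewrite -reD !addr0. Qed.
Lemma im0 : imC (0 : C) = 0.
Proof. by apply: (addrI (imC (0 : C))); rewrite -imD !addr0. Qed.
Lemma reN z : reC (- z) = - reC z.
Proof. by apply: (addrI (reC z)); rewrite -reD !subrr re0. Qed.
Lemma imN z : imC (- z) = - imC z.
Proof. by apply: (addrI (imC z)); rewrite -imD !subrr im0. Qed.
Lemma reB z w : reC (z - w) = reC z - reC w.
Proof. by rewrite reD reN. Qed.
Lemma imB z w : imC (z - w) = imC z - imC w.
Proof. by rewrite imD imN. Qed.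

Lemma re_toC x : reC (toC x) = x. Proof. exact: re_mk. Qed.
Lemma im_toC x : imC (toC x) = 0. Proof. exact: im_mk. Qed.

Lemma toC_le x y : (toC x <= toC y) = (x <= y).
Proof. by rewrite mk_le eqxx. Qed.
Lemma toC_inj : injective toC.
Proof. by move=> x y /(congr1 (@reC R C)); rewrite !re_toC. Qed.
Lemma toC_lt x y : (toC x < toC y) = (x < y).
Proof. by rewrite !lt_neqAle toC_le (inj_eq toC_inj). Qed.

Lemma toC0 : toC 0 = 0.
Proof. by apply: C_ext; rewrite ?re_toC ?im_toC ?re0 ?im0. Qed.
Lemma toCD x y : toC (x + y) = toC x + toC y.
Proof. by rewrite mk_add addr0. Qed.
Lemma toCN x : toC (- x) = - toC x.
Proof. by apply: C_ext; rewrite ?reN ?imN ?re_toC ?im_toC ?oppr0. Qed.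
Lemma toCB x y : toC (x - y) = toC x - toC y.
Proof. by rewrite toCD toCN. Qed.
Lemma toCM x y : toC (x * y) = toC x * toC y.
Proof. by rewrite mk_mul !mulr0 !mul0r subr0 addr0. Qed.
Lemma toC1 : toC 1 = 1.
Proof.
have n0 : toC 1 != 0 by rewrite -toC0 (inj_eq toC_inj) oner_eq0.
by apply: (mulfI n0); rewrite -toCM !mulr1.
Qed.
Lemma toC_nmod : nmod_morphism toC.
Proof. by split; [exact: toC0|exact: toCD]. Qed.
Lemma toC_monoid : monoid_morphism toC.
Proof. by split; [exact: toC1|exact: toCM]. Qed.
HB.instance Definition _ := GRing.isNmodMorphism.Build R C toC toC_nmod.
HB.instance Definition _ := GRing.isMonoidMorphism.Build R C toC toC_monoid.

Lemma re1 : reC (1 : C) = 1. Proof. by rewrite -toC1 re_toC. Qed.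
Lemma im1 : imC (1 : C) = 0. Proof. by rewrite -toC1 im_toC. Qed.

Lemma reM_toC x z : reC (toC x * z) = x * reC z.
Proof. by rewrite reM re_toC im_toC mul0r subr0. Qed.
Lemma imM_toC x z : imC (toC x * z) = x * imC z.
Proof. by rewrite imM re_toC im_toC mul0r addr0. Qed.

(** The order of [C] is partial and its positive elements are real, so every epsilon of the topology
    of [C] comes from a real one. *)
Lemma toC_gt0 z : 0 < z -> exists2 r : R, 0 < r & z = toC r.
Proof.
rewrite lt_neqAle => /andP[z0]; rewrite -{1}(mkC_K z) -{1}toC0 mk_le => /andP[/eqP iz rz].
have zE : z = toC (reC z) by apply: C_ext; rewrite ?re_toC ?im_toC.
exists (reC z) => //; rewrite lt_neqAle rz andbT; apply: contra z0 => /eqP h.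
by rewrite zE -h toC0.
Qed.

Lemma conj_id_toC z : z^* = z -> z = toC (reC z).
Proof.
move=> h; have := congr1 (@imC R C) h; rewrite im_conj => hi.
by apply: C_ext; rewrite ?re_toC ?im_toC//; lra.
Qed.

(** Norms over [C] take values in [C]; passing to the real part moves all estimates to the ordered
    field [R], where linear arithmetic applies. *)
Definition nm (V : normedModType C) (v : V) : R := reC `|v|.

Lemma normE (V : normedModType C) (v : V) : `|v| = toC (nm v).
Proof. by rewrite /nm; apply: conj_id_toC; apply: conj_Creal; exact: normr_real. Qed.

Section Vec.
Variable V : normedModType C.
Implicit Types u v : V.

Lemma nm_ge0 v : 0 <= nm v.
Proof. by rewrite -toC_le -normE toC0. Qed.

Lemma nmD u v : nm (u + v) <= nm u + nm v.
Proof. by rewrite -toC_le toCD -!normE ler_normD. Qed.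

Lemma nmN v : nm (- v) = nm v.
Proof. by rewrite /nm normrN. Qed.

Lemma nmBC u v : nm (u - v) = nm (v - u).
Proof. by rewrite /nm distrC. Qed.

Lemma nmB u v : nm (u - v) <= nm u + nm v.
Proof. by rewrite -(nmN v) nmD. Qed.

Lemma nmB_tri u v t : nm (u - t) <= nm (u - v) + nm (v - t).
Proof. by rewrite -toC_le toCD -!normE ler_distD. Qed.

Lemma nm0 : nm (0 : V) = 0.
Proof. by rewrite /nm normr0 re0. Qed.

Lemma nm_eq0 v : (nm v == 0) = (v == 0).
Proof. by rewrite -[RHS]normr_eq0 normE -toC0 (inj_eq toC_inj). Qed.

Lemma nm_gt0 v : (0 < nm v) = (v != 0).
Proof. by rewrite lt_neqAle eq_sym nm_eq0 nm_ge0 andbT. Qed.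

Lemma nmZ z v : nm (z *: v) = nm z * nm v.
Proof. by apply: toC_inj; rewrite toCM -!normE normrZ. Qed.

Lemma nm_sum (I : Type) (r : seq I) (P : pred I) (F : I -> V) :
  nm (\sum_(i <- r | P i) F i) <= \sum_(i <- r | P i) nm (F i).
Proof.
elim/big_rec2: _ => [|i x v _ h]; first by rewrite nm0.
by rewrite (le_trans (nmD _ _))// lerD2l.
Qed.

End Vec.

Lemma nmM z w : nm (z * w) = nm z * nm w.
Proof. by apply: toC_inj; rewrite toCM -!normE normrM. Qed.

Lemma nm1 : nm (1 : C) = 1.
Proof. by rewrite /nm normr1 re1. Qed.

Lemma nmX z n : nm (z ^+ n) = nm z ^+ n.
Proof. by apply: toC_inj; rewrite rmorphXn /= -!normE normrX. Qed.

Lemma nmV z : nm z^-1 = (nm z)^-1.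
Proof. by apply: toC_inj; rewrite fmorphV /= -!normE normfV. Qed.

Lemma nm_sqrt z : nm z = Num.sqrt (reC z ^+ 2 + imC z ^+ 2).
Proof. by rewrite /nm -{1}(mkC_K z) mk_norm re_mk. Qed.

Lemma nm_toC x : nm (toC x) = `|x|.
Proof. by rewrite nm_sqrt re_toC im_toC expr0n addr0 sqrtr_sqr. Qed.

Lemma nmE z : nm z ^+ 2 = reC z ^+ 2 + imC z ^+ 2.
Proof. by rewrite nm_sqrt sqr_sqrtr // addr_ge0 // sqr_ge0. Qed.

Lemma Re_le z : `|reC z| <= nm z.
Proof.
by rewrite -(ler_pXn2r (n := 2)) ?nnegrE ?nm_ge0 // real_normK ?num_real // nmE lerDl sqr_ge0.
Qed.

Lemma Im_le z : `|imC z| <= nm z.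
Proof.
by rewrite -(ler_pXn2r (n := 2)) ?nnegrE ?nm_ge0 // real_normK ?num_real // nmE lerDr sqr_ge0.
Qed.

Lemma nm_le_ReIm z : nm z <= `|reC z| + `|imC z|.
Proof.
rewrite -(ler_pXn2r (n := 2)) ?nnegrE ?nm_ge0 ?addr_ge0 //.
rewrite nmE -(real_normK (num_real (reC z))) -(real_normK (num_real (imC z))).
by rewrite sqrrD addrAC lerDl mulrn_wge0 // mulr_ge0.
Qed.

Lemma nm_cvgP (V : normedModType C) (T : Type) (F : set_system T)
    (FF : Filter F) (f : T -> V) (l : V) :
  (f @ F --> l) <-> (forall e : R, 0 < e -> \forall x \near F, nm (f x - l) < e).
Proof.
split.
- move/cvgrPdist_lt => h e e0.
  have := h (toC e); rewrite -toC0 toC_lt => /(_ e0).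
  by apply: filterS => x; rewrite normE toC_lt nmBC.
- move=> h; apply/cvgrPdist_lt => e /toC_gt0[r r0 ->].
  by apply: filterS (h r r0) => x; rewrite normE toC_lt nmBC.
Qed.

Lemma nm_nbhsP (V : normedModType C) (x : V) (P : set V) :
  nbhs x P <-> exists2 d : R, 0 < d & forall y : V, nm (y - x) < d -> P y.
Proof.
split.
- move=> /nbhs_normP[e /= /toC_gt0[r r0 ->]] h; exists r => // y yx; apply: h.
  by rewrite /= normE toC_lt nmBC.
- case=> d d0 h; apply/nbhs_normP; exists (toC d); first by rewrite /= -toC0 toC_lt.
  by move=> y; rewrite /= normE toC_lt nmBC; exact: h.
Qed.

Lemma nm_contP (V V' : normedModType C) (f : V -> V') (x : V) :
  {for x, continuous f} <-> forall e : R, 0 < e ->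
    exists2 d : R, 0 < d & forall y : V, nm (y - x) < d -> nm (f y - f x) < e.
Proof.
split.
- by move=> /(nm_cvgP (nbhs_filter x)) h e e0; apply/nm_nbhsP; exact: h.
- move=> h; apply/(nm_cvgP (nbhs_filter x)) => e e0.
  exact/nm_nbhsP/h.
Qed.

Lemma toC_continuous : continuous toC.
Proof.
move=> x; apply/nm_cvgP => e e0; near=> y.
rewrite -toCB nm_toC distrC; near: y.
by apply/nbhs_normP; exists e.
Unshelve. all: by end_near. Qed.

Lemma reC_continuous : continuous (@reC R C).
Proof.
move=> x; apply/(cvgrPdist_lt (FF := nbhs_filter x)) => e e0.
apply/nm_nbhsP; exists e => // y yx.
by rewrite -reB (le_lt_trans (Re_le _))// nmBC.
Qed.

Lemma imC_continuous : continuous (@imC R C).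
Proof.
move=> x; apply/(cvgrPdist_lt (FF := nbhs_filter x)) => e e0.
apply/nm_nbhsP; exists e => // y yx.
by rewrite -imB (le_lt_trans (Im_le _))// nmBC.
Qed.

Lemma nm_continuous (V : normedModType C) : continuous (@nm V).
Proof.
move=> x; apply: continuous_comp; last exact: reC_continuous.
exact: norm_continuous.
Qed.

(** Completeness is inherited from [R]: the two coordinates are 1-Lipschitz and so send [u] to
    Cauchy sequences. *)
Lemma C_complete (u : nat -> C) :
  (forall e : R, 0 < e -> exists N : nat, forall m n : nat, (N <= m)%N -> (N <= n)%N ->
    nm (u m - u n) <= e) ->
  exists l : C, u @ \oo --> l.
Proof.
move=> hu.
have aux (p : C -> R) : (forall z w, `|p z - p w| <= nm (z - w)) -> cvgn (p \o u).
  move=> hp; apply/cauchy_cvgP; apply: cauchy_exP => e e0.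
  have e20 : 0 < e / 2 by lra.
  have [N hN] := hu _ e20; exists (p (u N)).
  exists N => // n /= Nn; rewrite /ball /=.
  by rewrite (le_lt_trans (hp _ _))// (le_lt_trans (hN _ _ _ Nn))//; lra.
have hr : cvgn (@reC R C \o u) by apply: aux => z w; rewrite -reB Re_le.
have hi : cvgn (@imC R C \o u) by apply: aux => z w; rewrite -imB Im_le.
set a := limn _ in hr; set b := limn _ in hi.
exists (mkC C a b); apply/nm_cvgP => e e0.
have e20 : 0 < e / 2 by lra.
move/cvgrPdist_lt/(_ _ e20) : hr; move/cvgrPdist_lt/(_ _ e20) : hi.
apply: filterS2 => n /= hb ha; rewrite (le_lt_trans (nm_le_ReIm _))//.
rewrite reB imB re_mk im_mk distrC [X in _ + X]distrC; lra.
Qed.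

End Modulus.
Arguments toC {R C}.

(** * Maximum principle *)

Section SecondOrder.
Variables (R : realType) (C : complex_model R).
Implicit Types (f g : C -> C) (z w : C).

(* A Peano expansion of order two at z, the remainder being absorbed in psi. *)
Definition T2 f z := exists (a : C) (psi : C -> C), {for 0, continuous psi} /\
  \forall h \near (0 : C), f (z + h) = f z + a * h + h ^+ 2 * psi h.

Lemma T2_const (c : C) z : T2 (fun=> c) z.
Proof.
exists 0, (fun=> 0); split; first exact: cst_continuous.
by apply/nm_nbhsP; exists 1 => // h _; ring.
Qed.

Lemma T2_id z : T2 id z.
Proof.
exists 1, (fun=> 0); split; first exact: cst_continuous.
by apply/nm_nbhsP; exists 1 => // h _; ring.
Qed.

Lemma T2_add f g z : T2 f z -> T2 g z -> T2 (fun x => f x + g x) z.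
Proof.
move=> [a [p [cp fE]]] [b [q [cq gE]]].
exists (a + b), (fun h => p h + q h); split; first exact: continuousD.
by apply: filterS2 fE gE => h -> ->; ring.
Qed.

Lemma T2_mul f g z : T2 f z -> T2 g z -> T2 (fun x => f x * g x) z.
Proof.
move=> [a [p [cp fE]]] [b [q [cq gE]]].
exists (a * g z + f z * b), (fun h => a * b + f z * q h + g z * p h +
  h * (a * q h + b * p h) + h ^+ 2 * p h * q h); split.
  have cc (x : C) : {for 0, continuous (fun _ : C => x)} by exact: cst_continuous.
  have ci : {for 0, continuous (fun h : C => h)} by exact: cvg_id.
  have cM (u v : C -> C) : {for 0, continuous u} -> {for 0, continuous v} ->
      {for 0, continuous (fun h => u h * v h)} by move=> cu cv; exact: continuousM cu cv.
  have cD (u v : C -> C) : {for 0, continuous u} -> {for 0, continuous v} ->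
      {for 0, continuous (fun h => u h + v h)} by move=> cu cv; exact: continuousD cu cv.
  apply: (cD _ _ (cD _ _ (cD _ _ (cD _ _ (cc _) (cM _ _ (cc _) cq)) (cM _ _ (cc _) cp)) _)).
    exact: (cM _ _ ci (cD _ _ (cM _ _ (cc _) cq) (cM _ _ (cc _) cp))).
  exact: (cM _ _ (cM _ _ (cM _ _ ci ci) cp) cq).
by apply: filterS2 fE gE => h -> ->; ring.
Qed.

Lemma T2_exp f n z : T2 f z -> T2 (fun x => f x ^+ n) z.
Proof.
move=> hf; elim: n => [|n ih]; first exact: T2_const.
under [X in T2 X]funext do rewrite exprS.
exact: T2_mul.
Qed.

Lemma T2_sub f g z : T2 f z -> T2 g z -> T2 (fun x => f x - g x) z.
Proof.
move=> hf hg; apply: T2_add => //.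
have -> : (fun x => - g x) = (fun x => (-1) * g x) by apply/funext => x; ring.
by apply: T2_mul => //; exact: T2_const.
Qed.

(** With u = z - w, the remainder is explicit in 1/(u+h) = 1/u - h/u^2 + h^2/(u^2 (u+h)). *)
Lemma T2_inv_sub w z : z != w -> T2 (fun x => (x - w)^-1) z.
Proof.
rewrite -subr_eq0 => zw0.
exists (- (z - w) ^- 2), (fun h => ((z - w) ^+ 2 * (z - w + h))^-1); split.
  apply: continuousV; first by rewrite addr0 mulf_neq0// expf_neq0.
  apply: continuousM; first exact: cst_continuous.
  apply: continuousD => //; exact: cst_continuous.
have : 0 < nm (z - w) by rewrite nm_gt0.
move=> d0; apply/nm_nbhsP; exists (nm (z - w)) => // h; rewrite subr0 => hd.
have zwh : z - w + h != 0.
  apply/eqP => e0; move: hd; rewrite (_ : h = - (z - w)) ?nmN ?ltxx //.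
  by apply/eqP; rewrite -addr_eq0 addrC e0.
have -> : z + h - w = (z - w) + h by ring.
by move: (z - w) zw0 zwh => u u0 uh; field; rewrite u0 uh.
Qed.

Lemma T2_near f g z : (\forall x \near z, f x = g x) -> T2 f z -> T2 g z.
Proof.
move=> fg [a [p [cp fE]]]; exists a, p; split => //.
have fgz := nbhs_singleton fg.
have : \forall h \near (0 : C), f (z + h) = g (z + h).
  move/nm_nbhsP : fg => [d d0 hd]; apply/nm_nbhsP; exists d => // h.
  by rewrite subr0 => hh; apply: hd; rewrite addrC addKr.
by apply: filterS2 fE => h -> <-; rewrite -fgz.
Qed.

Lemma T2_expansion f z : T2 f z -> exists a b : C, forall e : R, 0 < e ->
  exists2 d : R, 0 < d & forall h : C, nm h < d ->
    nm (f (z + h) - f z - a * h - b * h ^+ 2) <= e * nm h ^+ 2.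
Proof.
move=> [a [p [cp /nm_nbhsP[d d0 fE]]]]; exists a, (p 0) => e e0.
have [d' d'0 hp] := (nm_contP _ _).1 cp _ e0.
exists (Num.min d d'); first by rewrite lt_min d0 d'0.
move=> h; rewrite lt_min => /andP[hd hd'].
have := fE h; have := hp h; rewrite subr0 => /(_ hd') php /(_ hd) ->.
rewrite (_ : _ - _ = h ^+ 2 * (p h - p 0)); last by ring.
by rewrite nmM nmX mulrC ler_wpM2r ?exprn_ge0 ?nm_ge0 // ltW.
Qed.

Lemma expansion_T2 f z (a b : C) : (forall e : R, 0 < e ->
  exists2 d : R, 0 < d & forall h : C, nm h < d ->
    nm (f (z + h) - f z - a * h - b * h ^+ 2) <= e * nm h ^+ 2) -> T2 f z.
Proof.
(* The quotient has no meaning at h = 0; the value b is its limit there, which makes the remainder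
   continuous. *)
move=> hf; exists a, (fun h => if h == 0 then b else (f (z + h) - f z - a * h) / h ^+ 2).
split; last first.
  apply/nm_nbhsP; exists 1 => // h _; case: eqP => [->|/eqP h0]; first by rewrite addr0; ring.
  by field.
apply/nm_contP => e e0; rewrite eqxx.
have e20 : 0 < e / 2 by lra.
have [d d0 hd] := hf _ e20.
exists d => // h; rewrite subr0 => hh.
case: eqP => [_|/eqP h0]; first by rewrite subrr nm0.
rewrite (_ : _ - b = (f (z + h) - f z - a * h - b * h ^+ 2) / h ^+ 2); last by field.
have h0' : 0 < nm h by rewrite nm_gt0.
rewrite nmM nmV nmX ltr_pdivrMr ?exprn_gt0 // (le_lt_trans (hd _ hh))//.
by rewrite ltr_pM2r ?exprn_gt0//; lra.
Qed.

Lemma T2_lip f z : T2 f z -> exists2 d : R, 0 < d & exists2 K : R, 0 <= K &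
  forall h : C, nm h < d -> nm (f (z + h) - f z) <= K * nm h.
Proof.
move=> /T2_expansion[a [b /(_ 1 ltr01)[d d0 fE]]].
exists (Num.min 1 d); first by rewrite lt_min ltr01 d0.
exists (nm a + (nm b + 1)); first by rewrite !addr_ge0 ?nm_ge0.
move=> h; rewrite lt_min => /andP[h1 hd].
rewrite (_ : _ - _ = (f (z + h) - f z - a * h - b * h ^+ 2) + b * h ^+ 2 + a * h); last by ring.
have := fE _ hd; set X := nm (_ - b * _) => hX.
apply: (le_trans (nmD _ _)); apply: (le_trans (lerD (nmD _ _) (lexx _))); rewrite -/X !nmM.
have h2 : nm h * nm h <= nm h by rewrite ler_piMl ?nm_ge0// ltW.
have := ler_wpM2l (nm_ge0 b) h2; rewrite expr2 in hX; lra.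
Qed.

Lemma T2_continuous f z : T2 f z -> {for z, continuous f}.
Proof.
move=> /T2_lip[d d0 [K K0 hK]]; apply/nm_contP => e e0.
exists (Num.min d (e / (K + 1))).
  by rewrite lt_min d0 divr_gt0 // ltr_wpDl.
move=> y; rewrite lt_min => /andP[yd ye].
have := hK _ yd; rewrite (_ : z + (y - z) = y); last by rewrite addrC subrK.
move=> h; rewrite (le_lt_trans h)//.
move: ye; rewrite ltr_pdivlMr ?ltr_wpDl// => ye.
have := nm_ge0 (y - z); nra.
Qed.

Lemma disc_compact (r : R) : compact [set z : C | nm z <= r].
Proof.
pose sq := (fun p : R * R => mkC C p.1 p.2) @` (`[- r, r] `*` `[- r, r]).
apply: (@subclosed_compact _ _ sq).
- have -> : [set z : C | nm z <= r] = (@nm R C C) @^-1` [set x | x <= r] by [].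
  by apply: preimage_closed; [move=> x _; exact: nm_continuous|exact: closed_le].
- apply: continuous_compact; last by apply: compact_setX; exact: segment_compact.
  apply: continuous_subspaceT => -[x y]; apply/nm_cvgP => e e0.
  have e20 : 0 < e / 2 by lra.
  apply: (filterS (P := [set p : R * R | ball x (e / 2) p.1 /\ ball y (e / 2) p.2])).
    move=> [x' y'] /= [hx hy]; rewrite (le_lt_trans (nm_le_ReIm _))// reB imB !re_mk !im_mk.
    by move: hx hy; rewrite /ball/= (distrC x) (distrC y); lra.
  exists (ball x (e / 2), ball y (e / 2)) => //=.
  by split; exact: nbhsx_ballx.
- move=> z /= zr; exists (reC z, imC z); last exact: mkC_K.
  by split; rewrite /= in_itv /= -ler_norml (le_trans _ zr) ?Re_le ?Im_le.
Qed.

(** Expand the sum of the (X_i - p)^2, which is nonnegative; s measures how far the four values are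
    from having mean p. *)
Lemma sum4_sqr_ge (p s X1 X2 X3 X4 : R) : X1 + X2 + X3 + X4 = 4 * p + s ->
  4 * p ^+ 2 + 2 * p * s <= X1 ^+ 2 + X2 ^+ 2 + X3 ^+ 2 + X4 ^+ 2.
Proof.
move=> sX; have -> : s = X1 + X2 + X3 + X4 - 4 * p by rewrite sX; ring.
rewrite -subr_ge0.
have -> : X1 ^+ 2 + X2 ^+ 2 + X3 ^+ 2 + X4 ^+ 2 -
    (4 * p ^+ 2 + 2 * p * (X1 + X2 + X3 + X4 - 4 * p)) =
    (X1 - p) ^+ 2 + (X2 - p) ^+ 2 + (X3 - p) ^+ 2 + (X4 - p) ^+ 2 by ring.
by rewrite !addr_ge0 ?sqr_ge0.
Qed.

Lemma sum4_mul_ge (p e A1 A2 A3 A4 : R) : - e <= A1 <= e -> - e <= A2 <= e ->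
  - e <= A3 <= e -> - e <= A4 <= e -> - (8 * `|p| * e) <= 2 * p * (A1 + A2 + A3 + A4).
Proof.
move=> /andP[a1 b1] /andP[a2 b2] /andP[a3 b3] /andP[a4 b4].
have : `|p * (A1 + A2 + A3 + A4)| <= `|p| * (4 * e).
  by rewrite normrM ler_wpM2l// ler_norml; apply/andP; split; lra.
by rewrite ler_norml => /andP[h _]; lra.
Qed.

(* At an interior maximum of |H|^2 + eps |z|^2, averaging over z + h for
   h = t, -t, it, -it kills the linear and quadratic terms of H. *)
Lemma maximum_principle (H : C -> C) (r m : R) : 0 <= m ->
  (forall z : C, nm z <= r -> {for z, continuous H}) ->
  (forall z : C, nm z < r -> H z = 0 \/ T2 H z) ->
  (forall z : C, nm z = r -> nm (H z) <= m) ->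
  forall z : C, nm z <= r -> nm (H z) <= m.
Proof.
move=> m0 Hc HT Hm z zr.
suff hphi (eps : R) : 0 < eps -> nm (H z) ^+ 2 <= m ^+ 2 + eps * r ^+ 2.
  rewrite -(ler_pXn2r (n := 2)) ?nnegrE ?nm_ge0 //; apply/ler_addgt0Pr => e e0.
  have [r0|r0] := eqVneq r 0; first by have := hphi _ ltr01; rewrite r0; nra.
  have r20 : 0 < r ^+ 2 by rewrite exprn_even_gt0.
  by rewrite (le_trans (hphi (e / r ^+ 2) _)) ?divr_gt0// divfK// gt_eqF.
move=> eps0.
pose phi x := nm (H x) ^+ 2 + eps * nm x ^+ 2.
have [z0 z0r zmax] : exists2 z0, z0 \in [set z : C | nm z <= r] &
    forall t, t \in [set z : C | nm z <= r] -> phi t <= phi z0.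
  apply: compact_EVT_max; [by exists z|exact: disc_compact|].
  apply: continuous_in_subspaceT => x; rewrite inE /= => xr.
  have cH : {for x, continuous (fun y => nm (H y))}.
    by apply: continuous_comp; [exact: Hc|exact: nm_continuous].
  have cn : {for x, continuous (fun y : C => nm y)} by exact: nm_continuous.
  have cH2 : {for x, continuous (fun y => nm (H y) ^+ 2)}.
    exact: (continuousM cH cH).
  have cn2 : {for x, continuous (fun y : C => eps * nm y ^+ 2)}.
    by apply: continuousM; [exact: cst_continuous|exact: (continuousM cn cn)].
  exact: (continuousD cH2 cn2).
have {}zmax x : nm x <= r -> phi x <= phi z0 by move=> xr; apply: zmax; rewrite inE.
move: z0r; rewrite inE /= => z0r.
have r0 : 0 <= r by rewrite (le_trans (nm_ge0 _) zr).
suff : phi z0 <= m ^+ 2 + eps * r ^+ 2.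
  apply: le_trans; rewrite (le_trans _ (zmax _ zr))// /phi lerDl.
  by rewrite mulr_ge0 ?exprn_ge0 ?nm_ge0// ltW.
have z0r2 : nm z0 ^+ 2 <= r ^+ 2 by rewrite ler_pXn2r ?nnegrE ?nm_ge0.
have [z0r'|z0r'] := eqVneq (nm z0) r.
  rewrite /phi lerD // ?ler_pM2l//.
  by rewrite ler_pXn2r ?nnegrE ?nm_ge0 ?Hm.
have {z0r'} z0lt : nm z0 < r by rewrite lt_neqAle z0r' z0r.
(* At a zero of H the value of [phi] is at most eps r^2 without any expansion. This is how H may be
   singular at points where it vanishes, as in the removable singularities below. *)
have [Hz0|/T2_expansion[a [b hab]]] := HT _ z0lt.
  rewrite /phi Hz0 nm0 expr0n add0r; apply: ler_wpDl; first by rewrite exprn_ge0.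
  by rewrite ler_pM2l.
exfalso.
set p := reC (H z0); set q := imC (H z0).
(* With this e the four remainders lower the sum of the |H|^2 by at most 8 (|p| + |q|) e t^2 < 4 eps
   t^2, while the term eps |z|^2 raises the sum of the four values of [phi] by exactly 4 eps t^2. So
   [phi] exceeds its maximum at one of the four points. *)
have e0 : 0 < eps / (4 * (`|p| + `|q| + 1)).
  by rewrite divr_gt0// mulr_gt0// ltr_wpDl ?addr_ge0.
have [d d0 hd] := hab _ e0.
set e := eps / _ in e0 hd.
have [t t0 /andP[td tr]] : exists2 t : R, 0 < t & (t < d) && (nm z0 + t <= r).
  exists (Num.min (d / 2) (r - nm z0)); first by rewrite lt_min subr_gt0 z0lt divr_gt0.
  rewrite gt_min ltr_pdivrMr// mulr_natr mulr2n ltrDl d0 /=.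
  by rewrite addrC -lerBrDr ge_min lexx orbT.
pose Z (u : C) := H (z0 + toC t * u).
pose E (u : C) := Z u - H z0 - a * (toC t * u) - b * (toC t * u) ^+ 2.
have hE (u : C) : nm u = 1 -> nm (E u) <= e * t ^+ 2.
  move=> u1; have tu : nm (toC t * u) = t by rewrite nmM u1 mulr1 nm_toC gtr0_norm.
  by have := hd (toC t * u); rewrite tu; exact.
have hZ (u : C) : nm u = 1 ->
    nm (Z u) ^+ 2 + eps * nm (z0 + toC t * u) ^+ 2 <= nm (H z0) ^+ 2 + eps * nm z0 ^+ 2.
  move=> u1; have tu : nm (toC t * u) = t by rewrite nmM u1 mulr1 nm_toC gtr0_norm.
  by apply: (zmax (z0 + toC t * u)); rewrite (le_trans (nmD _ _))// tu.
pose I : C := mkC C 0 1.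
have I2 : I ^+ 2 = -1.
  by apply: C_ext; rewrite expr2 mk_mul ?re_mk ?im_mk ?reN ?imN ?re1 ?im1; ring.
have nI : nm I = 1 by rewrite nm_sqrt re_mk im_mk expr0n expr1n add0r sqrtr1.
have nN (x : C) : nm x = 1 -> nm (- x) = 1 by rewrite nmN.
have n1 := @nm1 R C.
have sumE : Z 1 + Z (-1) + Z I + Z (- I) = toC 4 * H z0 + (E 1 + E (-1) + E I + E (- I)).
  have -> : toC 4 = 4 :> C by rewrite rmorph_nat.
  rewrite /E !exprMn sqrrN expr1n [(- I) ^+ 2]sqrrN I2; ring.
clearbody E; clearbody Z.
have h1 := hZ _ n1; have h2 := hZ _ (nN _ n1); have h3 := hZ _ nI; have h4 := hZ _ (nN _ nI).
have k1 := hE _ n1; have k2 := hE _ (nN _ n1); have k3 := hE _ nI; have k4 := hE _ (nN _ nI).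
have sRe := congr1 (@reC R C) sumE; have sIm := congr1 (@imC R C) sumE.
move: sRe sIm; rewrite !reD !imD reM_toC imM_toC -/p -/q.
have bRe (x : C) (y : R) : nm x <= y -> - y <= reC x <= y.
  by move=> xy; rewrite -ler_norml (le_trans (Re_le x)).
have bIm (x : C) (y : R) : nm x <= y -> - y <= imC x <= y.
  by move=> xy; rewrite -ler_norml (le_trans (Im_le x)).
move: (bRe _ _ k1) (bRe _ _ k2) (bRe _ _ k3) (bRe _ _ k4).
move: (bIm _ _ k1) (bIm _ _ k2) (bIm _ _ k3) (bIm _ _ k4).
move: h1 h2 h3 h4; rewrite !nmE !reD !imD !reM_toC !imM_toC !reN !imN -/p -/q.
rewrite !re_mk !im_mk !re1 !im1.
move: (reC (Z 1)) (reC (Z (-1))) (reC (Z I)) (reC (Z (- I))) => X1 X2 X3 X4.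
move: (imC (Z 1)) (imC (Z (-1))) (imC (Z I)) (imC (Z (- I))) => Y1 Y2 Y3 Y4.
move: (reC (E _)) (reC (E _)) (reC (E _)) (reC (E _)) => A1 A2 A3 A4.
move: (imC (E _)) (imC (E _)) (imC (E _)) (imC (E _)) => B1 B2 B3 B4.
move: (reC z0) (imC z0) => x0 y0.
move=> h1 h2 h3 h4 b1 b2 b3 b4 a1 a2 a3 a4 sX sY.
pose sA := A1 + A2 + A3 + A4; pose sB := B1 + B2 + B3 + B4.
have sX2 : 4 * p ^+ 2 + 2 * p * sA <= X1 ^+ 2 + X2 ^+ 2 + X3 ^+ 2 + X4 ^+ 2.
  by apply: sum4_sqr_ge; rewrite sX /sA; ring.
have sY2 : 4 * q ^+ 2 + 2 * q * sB <= Y1 ^+ 2 + Y2 ^+ 2 + Y3 ^+ 2 + Y4 ^+ 2.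
  by apply: sum4_sqr_ge; rewrite sY /sB; ring.
have key : 2 * p * sA + 2 * q * sB <= - (4 * (eps * t ^+ 2)).
  clear -h1 h2 h3 h4 sX2 sY2; clearbody p q sA sB.
  by move: h1 h2 h3 h4; rewrite !sqrrD; lra.
have ple : - (8 * `|p| * (e * t ^+ 2)) <= 2 * p * sA  by apply: sum4_mul_ge.
have qle : - (8 * `|q| * (e * t ^+ 2)) <= 2 * q * sB  by apply: sum4_mul_ge.
have eE : eps * t ^+ 2 = 4 * ((`|p| + `|q|) * (e * t ^+ 2)) + 4 * (e * t ^+ 2).
  have -> : eps = e * (4 * (`|p| + `|q| + 1)).
    by rewrite /e divfK// gt_eqF// mulr_gt0// ltr_wpDl ?addr_ge0.
  ring.
have e4 : 0 < e * t ^+ 2 by rewrite mulr_gt0 ?exprn_gt0.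
have w0 : 0 <= (`|p| + `|q|) * (e * t ^+ 2) by rewrite mulr_ge0 ?addr_ge0// ltW.
rewrite eE in key; clear -key ple qle e4 w0; lra.
Qed.

End SecondOrder.

(** * Power series *)

Section PowerSeries.
Variables (R : realType) (C : complex_model R).
Implicit Types (f q : C -> C) (z w : C) (r M : R).

(** If m < x, then (m/x)^N drops below D/K for large N. This is the passage to N-th roots. *)
Lemma le_of_geometric (D K x m : R) : 0 < D -> 0 <= m -> 0 <= x ->
  (forall N, D * x ^+ N <= K * m ^+ N) -> x <= m.
Proof.
move=> D0 m0 x0 h; rewrite leNgt; apply/negP => mx.
have x1 : 0 < x by rewrite (le_lt_trans m0).
have mx1 : `|m / x| < 1 by rewrite ger0_norm ?divr_ge0// ltr_pdivrMr// mul1r.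
have K0 : 0 < K.
  by have := h 0%N; rewrite !expr0 !mulr1; apply: lt_le_trans.
have /cvgrPdist_lt/(_ (D / K)) := cvg_expr mx1.
rewrite divr_gt0// => /(_ isT)[N _ /(_ N (leqnn _))] /=.
rewrite sub0r normrN ger0_norm ?exprn_ge0 ?divr_ge0// ltr_pdivlMr//.
rewrite expr_div_n mulrAC ltr_pdivrMr ?exprn_gt0// mulrC ltNge.
by rewrite h.
Qed.

Lemma le_of_linear (x K d : R) : 0 < d -> 0 <= K ->
  (forall t, 0 < t -> t < d -> x <= K * t) -> x <= 0.
Proof.
move=> d0 K0 h; rewrite leNgt; apply/negP => x0.
pose t := Num.min (d / 2) (x / (2 * (K + 1))).
have K1 : 0 < K + 1 by rewrite ltr_wpDl.
have t0 : 0 < t by rewrite lt_min !divr_gt0 ?mulr_gt0.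
have td : t < d by rewrite gt_min ltr_pdivrMr// mulr_natr mulr2n ltrDl d0.
have := h _ t0 td; rewrite leNgt => /negP; apply.
have tx : t * (2 * (K + 1)) <= x.
  by rewrite -ler_pdivlMr ?mulr_gt0// ge_min lexx orbT.
nra.
Qed.

(* Removable singularities: (z - a)(z - b) q(z)^N vanishes at a and b, and the
   two linear factors disappear on taking N-th roots. *)
Lemma maximum_principle_off2 (a b : C) q r r' M m :
  r < r' -> nm a < r -> nm b < r -> 0 <= M -> 0 <= m ->
  (forall z : C, nm z < r' -> z != a -> z != b -> T2 q z /\ nm (q z) <= M) ->
  (forall z : C, nm z = r -> nm (q z) <= m) ->
  forall z : C, nm z <= r -> z != a -> z != b -> nm (q z) <= m.
Proof.
move=> rr' ar br M0 m0 hq hm z zr za zb.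
have r0 : 0 < r by rewrite (le_lt_trans (nm_ge0 a)).
apply: (@le_of_geometric (nm ((z - a) * (z - b))) (4 * r ^+ 2)) => //.
- by rewrite nm_gt0 mulf_neq0// subr_eq0.
- exact: nm_ge0.
case=> [|N].
  rewrite !expr0 !mulr1 nmM.
  have h1 : nm (z - a) <= 2 * r by rewrite (le_trans (nmB _ _))//; lra.
  have h2 : nm (z - b) <= 2 * r by rewrite (le_trans (nmB _ _))//; lra.
  rewrite (le_trans (ler_pM (nm_ge0 _) (nm_ge0 _) h1 h2))//.
  by rewrite expr2; lra.
pose H x := (x - a) * (x - b) * q x ^+ N.+1.
rewrite -nmX -nmM -/(H z).
have HM x : nm x < r' -> nm (H x) <= nm (x - a) * nm (x - b) * M ^+ N.+1.
  move=> xr; rewrite /H; have [->|xa] := eqVneq x a.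
    by rewrite subrr !mul0r nm0 !mul0r.
  have [->|xb] := eqVneq x b.
    by rewrite subrr mulr0 !mul0r nm0 mulr0 mul0r.
  have [_ qM] := hq x xr xa xb.
  by rewrite nmM nmM nmX ler_wpM2l ?mulr_ge0 ?nm_ge0// lerXn2r ?nnegrE ?nm_ge0.
have HT x : nm x < r' -> x != a -> x != b -> T2 H x.
  move=> xr xa xb; have [Tq _] := hq x xr xa xb.
  apply: T2_mul; last exact: T2_exp.
  by apply: T2_mul; apply: T2_sub; [exact: T2_id|exact: T2_const|exact: T2_id|exact: T2_const].
(* Boundedness of q on the larger disc of radius r' gives |H y| <= const |y - c| for c = a and c =
   b, hence continuity at these two points. *)
have Hsing x c : nm c < r -> H c = 0 -> x = c ->
    (forall y, nm y < r' -> nm (H y) <= nm (y - c) * (2 * r' * M ^+ N.+1)) ->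
    {for x, continuous H}.
  move=> cr Hc -> hy; apply/nm_contP => e e0.
  set K := 2 * r' * M ^+ N.+1 in hy.
  have K0 : 0 <= K by rewrite !mulr_ge0 ?exprn_ge0// ltW// (lt_trans r0).
  exists (Num.min (r' - nm c) (e / (K + 1))).
    by rewrite lt_min subr_gt0 (lt_trans cr)//= divr_gt0// ltr_wpDl.
  move=> y; rewrite lt_min => /andP[yr].
  rewrite ltr_pdivlMr ?ltr_wpDl// => ye.
  rewrite Hc subr0 (le_lt_trans (hy _ _))//.
    have := nmD (y - c) c; rewrite subrK; lra.
  have := nm_ge0 (y - c); lra.
have cH x : nm x <= r -> {for x, continuous H}.
  move=> xr; have xr' := le_lt_trans xr rr'.
  have [xa|xa] := eqVneq x a.
    apply: (@Hsing _ a) => //; first by rewrite /H subrr !mul0r.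
    move=> y yr; rewrite (le_trans (HM _ yr))// -!mulrA ler_wpM2l ?nm_ge0//.
    rewrite mulrA ler_wpM2r ?exprn_ge0// (le_trans (nmB _ _))//; lra.
  have [xb|xb] := eqVneq x b.
    apply: (@Hsing _ b) => //; first by rewrite /H subrr mulr0 !mul0r.
    move=> y yr; rewrite (le_trans (HM _ yr))// [nm (y - a) * _]mulrC -!mulrA ler_wpM2l ?nm_ge0//.
    rewrite mulrA ler_wpM2r ?exprn_ge0// (le_trans (nmB _ _))//; lra.
  exact/T2_continuous/HT.
apply: (@maximum_principle _ _ H r) => //.
- by rewrite mulr_ge0 ?exprn_ge0// mulr_ge0// exprn_ge0// ltW.
- move=> x xr; have [->|xa] := eqVneq x a; first by left; rewrite /H subrr !mul0r.
  have [->|xb] := eqVneq x b; first by left; rewrite /H subrr mulr0 !mul0r.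
  by right; apply: HT => //; exact: lt_trans rr'.
- move=> x xr; rewrite /H nmM nmM nmX ler_pM ?mulr_ge0 ?exprn_ge0 ?nm_ge0//.
    have h1 : nm (x - a) <= 2 * r by rewrite (le_trans (nmB _ _))//; lra.
    have h2 : nm (x - b) <= 2 * r by rewrite (le_trans (nmB _ _))//; lra.
    by rewrite (le_trans (ler_pM (nm_ge0 _) (nm_ge0 _) h1 h2))// expr2; lra.
  by rewrite lerXn2r ?nnegrE ?nm_ge0// hm.
Qed.

Definition punctured_bound r M q := forall z : C, 0 < nm z -> nm z < r ->
  T2 q z /\ nm (q z) <= M.

(** The quotient (q x - q w)/(x - w) is singular only at 0 and w. On the circle |x| = r/2 its
    numerator is at most 2M and its denominator at least r/4, whence the constant 8M/r. *)
Lemma punctured_lip r M q : 0 < r -> 0 <= M -> punctured_bound r M q ->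
  forall z w : C, 0 < nm z -> nm z < r / 4 -> 0 < nm w -> nm w < r / 4 ->
  nm (q z - q w) <= 8 * M / r * nm (z - w).
Proof.
move=> r0 M0 hq z w z0 zr w0 wr.
have [->|zw] := eqVneq z w; first by rewrite !subrr !nm0 mulr0.
pose k x := (q x - q w) * (x - w)^-1.
suff hk : nm (k z) <= 8 * M / r.
  have -> : q z - q w = k z * (z - w) by rewrite /k divfK// subr_eq0.
  by rewrite nmM ler_wpM2r ?nm_ge0.
have w0' : w != 0 by rewrite -nm_gt0.
have z0' : z != 0 by rewrite -nm_gt0.
have wr' : nm w < r by lra.
have [Tw qw] := hq w w0 wr'.
have [d d0 [K K0 hK]] := T2_lip Tw.
(* A crude bound off the two singular points: the local Lipschitz constant K near w, and 2M/d at
   distance at least d from w. It only has to be finite. *)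
apply: (@maximum_principle_off2 0 w k (r / 2) r (K + 2 * M / d)) => //.
- lra.
- by rewrite nm0; lra.
- lra.
- by rewrite addr_ge0// divr_ge0 ?mulr_ge0// ltW.
- by rewrite divr_ge0 ?mulr_ge0// ltW.
- move=> x xr; rewrite -nm_gt0 => x0 xw; have [Tx qx] := hq x x0 xr; split.
    by apply: T2_mul; [apply: T2_sub => //; exact: T2_const|exact: T2_inv_sub].
  have xw0 : 0 < nm (x - w) by rewrite nm_gt0 subr_eq0.
  rewrite /k nmM nmV ler_pdivrMr//.
  have [xd|dx] := ltP (nm (x - w)) d.
    have := hK _ xd; rewrite (_ : w + (x - w) = x); last by rewrite addrC subrK.
    move=> h; rewrite (le_trans h)// ler_wpM2r ?nm_ge0// lerDl.
    by rewrite divr_ge0 ?mulr_ge0// ltW.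
  rewrite (le_trans (nmB _ _))//.
  have : 2 * M <= 2 * M / d * nm (x - w).
    by rewrite mulrAC ler_pdivlMr// ler_wpM2l// mulr_ge0.
  have := mulr_ge0 K0 (nm_ge0 (x - w)); lra.
- move=> x xr; have x0 : 0 < nm x by rewrite xr divr_gt0.
  have [_ qx] : T2 q x /\ nm (q x) <= M by apply: hq => //; rewrite xr; lra.
  have h : r / 4 <= nm (x - w).
    have := nmD (x - w) w; rewrite subrK xr; lra.
  have xw0 : 0 < nm (x - w) by lra.
  rewrite /k nmM nmV ler_pdivrMr// (le_trans (nmB _ _))//.
  have : 2 * M <= 8 * M / r * nm (x - w).
    rewrite (_ : 8 * M / r * _ = 2 * M * (4 * nm (x - w) / r)); last by ring.
    by rewrite ler_peMr ?mulr_ge0// ler_pdivlMr// mul1r; lra.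
  lra.
- lra.
Qed.

(** Removal of the singularity at 0: the Lipschitz estimate makes q Cauchy along v_n = r/(8(n+1)),
    with limit a. The quotient (q - a)/z is bounded on the same punctured disc, so the construction
    can be repeated without shrinking r. *)
Lemma punctured_limit r M q : 0 < r -> 0 <= M -> punctured_bound r M q ->
  exists a : C, [/\ nm a <= M,
    forall z : C, 0 < nm z -> nm z < r / 4 -> nm (q z - a) <= 8 * M / r * nm z &
    punctured_bound r (8 * M / r) (fun z => (q z - a) / z)].
Proof.
move=> r0 M0 hq.
pose v n : C := toC (r / 8 / n.+1%:R).
have vE n : nm (v n) = r / 8 / n.+1%:R by rewrite nm_toC ger0_norm// !divr_ge0// ltW.
have v0 n : 0 < nm (v n) by rewrite vE !divr_gt0.
have n1 n : n.+1%:R^-1 <= 1 :> R by rewrite invf_le1 ?ltr0n// ler1n.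
have vr n : nm (v n) < r / 4.
  rewrite vE (@le_lt_trans _ _ (r / 8))//; last by lra.
  by rewrite ler_piMr ?divr_ge0// ltW.
have lip := punctured_lip r0 M0 hq.
have scale n : 8 * M / r * (r / 8 / n.+1%:R) = M / n.+1%:R.
  by move: n.+1%:R (ltr0Sn R n) => x x0; field; rewrite !gt_eqF.
have small (e : R) : 0 < e -> exists N : nat, forall n, (N <= n)%N ->
    M / n.+1%:R <= e.
  move=> e0; have [N hN] : exists N : nat, M / e < N%:R.
    by exists (Num.bound (M / e)); rewrite archi_boundP// divr_ge0// ltW.
  exists N => n Nn; rewrite ler_pdivrMr ?ltr0n// mulrC -ler_pdivrMr//.
  by rewrite (le_trans (ltW hN))// ler_nat (leq_trans Nn).
have [a ha] : exists a : C, (fun n => q (v n)) @ \oo --> a.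
  apply: C_complete => e e0.
  have e20 : 0 < e / 2 by lra.
  have [N hN] := small _ e20; exists N => m n Nm Nn /=.
  rewrite (le_trans (lip _ _ _ _ _ _))//.
  have hB := nmB (v m) (v n); rewrite !vE in hB.
  have K0 : 0 <= 8 * M / r by rewrite divr_ge0 ?mulr_ge0// ltW.
  apply: (le_trans (ler_wpM2l K0 hB)).
  by rewrite mulrDr !scale [e]splitr lerD// hN.
have near_a (e : R) : 0 < e -> exists n, nm (q (v n) - a) < e /\ M / n.+1%:R < e.
  move=> e0; move/nm_cvgP/(_ _ e0) : ha => -[N1 _ h1].
  have e20 : 0 < e / 2 by lra.
  have [N2 h2] := small _ e20; exists (maxn N1 N2); split.
    by apply: h1; rewrite /= leq_maxl.
  by rewrite (le_lt_trans (h2 _ (leq_maxr _ _)))//; lra.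
have aM : nm a <= M.
  apply/ler_addgt0Pr => e e0; have [n [h _]] := near_a e e0.
  have r4 : r / 4 < r by lra.
  have [_ h'] := hq (v n) (v0 n) (lt_trans (vr n) r4).
  have := nmB_tri a (q (v n)) 0; rewrite !subr0 (nmBC a); lra.
have qa z : 0 < nm z -> nm z < r / 4 -> nm (q z - a) <= 8 * M / r * nm z.
  move=> z0 zr; apply/ler_addgt0Pr => e e0.
  have e20 : 0 < e / 2 by lra.
  have [n [h1 h2]] := near_a _ e20.
  have h3 := lip _ _ z0 zr (v0 n) (vr n).
  have K0 : 0 <= 8 * M / r by rewrite divr_ge0 ?mulr_ge0// ltW.
  have h4 := ler_wpM2l K0 (nmB z (v n)).
  have h5 : 8 * M / r * nm (v n) = M / n.+1%:R by rewrite vE scale.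
  have := nmB_tri (q z) (q (v n)) a; rewrite mulrDr in h4; rewrite -h5 in h2.
  move: (8 * M / r) h2 h3 h4 {K0 h5} => K; lra.
exists a; split=> // z z0 zr; have [Tz qz] := hq z z0 zr; split.
  apply: T2_mul; first by apply: T2_sub => //; exact: T2_const.
  have : T2 (fun x : C => (x - 0)^-1) z by apply: T2_inv_sub; rewrite -nm_gt0.
  by apply: T2_near; apply/nm_nbhsP; exists 1 => // y _; rewrite subr0.
rewrite nmM nmV ler_pdivrMr//.
(* Away from 0 the same constant comes from |q - a| <= 2M and |z| >= r/4. *)
have [h|h] := ltP (nm z) (r / 4); first exact: qa.
have := nmB (q z) a; rewrite mulrAC ler_pdivlMr// => h1.
have h2 : r * (2 * M) <= 4 * nm z * (2 * M) by rewrite ler_wpM2r ?mulr_ge0//; lra.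
have h3 : nm (q z - a) * r <= 2 * M * r by rewrite ler_wpM2r ?(ltW r0)//; lra.
lra.
Qed.

(** Taylor coefficients by repeated division: each one is the limit at 0 of the current quotient,
    which is then replaced with (q - a)/z. Every division multiplies the bound by 8/r and keeps the
    disc, so the K-th remainder is z^K times a function bounded by M (8/r)^K. *)
Lemma power_series0 f r M : 0 < r ->
  (forall z : C, nm z < r -> T2 f z /\ nm (f z) <= M) ->
  exists a : nat -> C, [/\ a 0%N = f 0, forall k, nm (a k) <= M * (8 / r) ^+ k &
    forall z : C, nm z < r -> forall K,
      nm (f z - \sum_(k < K) a k * z ^+ k) <= M * (8 / r * nm z) ^+ K].
Proof.
move=> r0 hf.
have [T0 fM] : T2 f 0 /\ nm (f 0) <= M by apply: hf; rewrite nm0.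
have M0 := le_trans (nm_ge0 _) fM.
(* The state pairs a quotient with its bound. The property is conditional so that [choice] yields a
   total function on all such pairs. *)
pose P (s : (C -> C) * R) (a : C) := 0 <= s.2 -> punctured_bound r s.2 s.1 ->
  [/\ nm a <= s.2,
    forall z : C, 0 < nm z -> nm z < r / 4 -> nm (s.1 z - a) <= 8 * s.2 / r * nm z &
    punctured_bound r (8 * s.2 / r) (fun z => (s.1 z - a) / z)].
have /choice[A hA] : forall s, exists a, P s a.
  move=> [q m]; have [m0|m0] := leP 0 m; last first.
    by exists 0; rewrite /P /= => m0'; have := le_lt_trans m0' m0; rewrite ltxx.
  have [hq|hq] := pselect (punctured_bound r m q); last by exists 0.
  by have [a ha] := punctured_limit r0 m0 hq; exists a.
pose st (s : (C -> C) * R) := (fun z => (s.1 z - A s) / z, 8 * s.2 / r).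
pose s k := iter k st (f, M).
have s2 k : (s k).2 = M * (8 / r) ^+ k.
  elim: k => [|k ih]; first by rewrite mulr1.
  by rewrite /s iterS /= -/(s k) ih exprSr; field; rewrite gt_eqF.
have c0 : 0 <= 8 / r by rewrite divr_ge0// ltW.
have s20 k : 0 <= (s k).2 by rewrite s2 mulr_ge0 ?exprn_ge0.
have sb k : punctured_bound r (s k).2 (s k).1.
  elim: k => [|k ih]; first by move=> z _ zr; exact: hf.
  by rewrite /s iterS -/(s k); have [] := hA _ (s20 k) ih.
exists (fun k => A (s k)).
(* The estimates above see only the punctured disc; the Lipschitz bound for f at 0 identifies the
   limit with the value there. *)
have a0 : A (s 0%N) = f 0.
  have [_ h _] := hA _ (s20 0%N) (sb 0%N).
  apply/eqP; rewrite eq_sym -subr_eq0 -nm_eq0 eq_le nm_ge0 andbT.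
  have [d d0 [K K0 hK]] := T2_lip T0.
  apply: (@le_of_linear _ (K + 8 * M / r) (Num.min d (r / 4))).
  - by rewrite lt_min d0 divr_gt0.
  - by rewrite addr_ge0// divr_ge0 ?mulr_ge0// ltW.
  - move=> t t0; rewrite lt_min => /andP[td tr].
    have tE : nm (toC t : C) = t by rewrite nm_toC gtr0_norm.
    have := h (toC t); rewrite tE => /(_ t0 tr) /=.
    have := hK (toC t); rewrite tE => /(_ td); rewrite add0r.
    have := nmB_tri (f 0) (f (toC t)) (A (s 0%N)).
    rewrite (nmBC (f 0) (f (toC t))); lra.
split=> // [k|z zr K].
  by rewrite -s2; have [] := hA _ (s20 k) (sb k).
have [->|z0] := eqVneq z 0.
  rewrite nm0 mulr0; case: K => [|K]; first by rewrite big_ord0 subr0 expr0 mulr1.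
  rewrite big_ord_recl expr0 mulr1 a0 big1 ?addr0 ?subrr ?nm0 ?expr0n ?mulr0//.
  by move=> i _; rewrite expr0n mulr0.
have -> : f z - \sum_(k < K) A (s k) * z ^+ k = z ^+ K * (s K).1 z.
  elim: K => [|K ih]; first by rewrite big_ord0 subr0 expr0 mul1r.
  have -> : (s K.+1).1 z = ((s K).1 z - A (s K)) / z by [].
  by rewrite big_ord_recr opprD addrA ih exprSr; field.
rewrite nmM nmX exprMn mulrA [_ * (nm z) ^+ K]mulrC ler_wpM2l ?exprn_ge0 ?nm_ge0//.
by rewrite -s2; apply: (sb K z _ zr).2; rewrite nm_gt0.
Qed.

Lemma T2_shift f w z : T2 f (w + z) <-> T2 (fun x => f (w + x)) z.
Proof. by split; move=> [a [p [cp h]]]; exists a, p; split=> //; apply: filterS h => x; rewrite addrA. Qed.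

Lemma power_series f w r M : 0 < r ->
  (forall z, nm (z - w) < r -> T2 f z /\ nm (f z) <= M) ->
  exists a : nat -> C, [/\ a 0%N = f w, forall k, nm (a k) <= M * (8 / r) ^+ k &
    forall h : C, nm h < r -> forall K,
      nm (f (w + h) - \sum_(k < K) a k * h ^+ k) <= M * (8 / r * nm h) ^+ K].
Proof.
move=> r0 hf; rewrite -[w in f w]addr0; apply: power_series0 => // z zr.
have [h1 h2] : T2 f (w + z) /\ nm (f (w + z)) <= M by apply: hf; rewrite addrC addKr.
by split=> //; exact/T2_shift.
Qed.

Lemma quadratic_eq0 (a b : C) (K r : R) : 0 < r -> 0 <= K ->
  (forall h : C, nm h < r -> nm (a * h + b * h ^+ 2) <= K * nm h ^+ 3) -> a = 0 /\ b = 0.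
Proof.
move=> r0 K0 hab.
have hab' t : 0 < t -> t < r -> nm (a + b * toC t) <= K * t ^+ 2.
  move=> t0 tr; have tE : nm (toC t : C) = t by rewrite nm_toC gtr0_norm.
  have := hab (toC t); rewrite tE => /(_ tr).
  rewrite (_ : a * _ + _ = toC t * (a + b * toC t)); last by ring.
  by rewrite nmM tE (_ : K * t ^+ 3 = t * (K * t ^+ 2)) ?ler_pM2l//; ring.
have a0 : a = 0.
  apply/eqP; rewrite -nm_eq0 eq_le nm_ge0 andbT.
  apply: (@le_of_linear _ (K + nm b) (Num.min r 1)).
  - by rewrite lt_min r0 ltr01.
  - by rewrite addr_ge0 ?nm_ge0.
  - move=> t t0; rewrite lt_min => /andP[tr t1].
    have := nmB_tri a (- (b * toC t)) 0; rewrite !subr0 opprK nmN nmM nm_toC gtr0_norm//.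
    have := hab' _ t0 tr.
    have : K * t ^+ 2 <= K * t by rewrite ler_wpM2l// expr2 ler_piMr// ltW.
    lra.
split=> //; apply/eqP; rewrite -nm_eq0 eq_le nm_ge0 andbT.
apply: (@le_of_linear _ K r) => // t t0 tr.
have := hab' _ t0 tr; rewrite a0 add0r nmM nm_toC gtr0_norm// expr2 mulrA.
by rewrite ler_pM2r.
Qed.

(** If |F_n - F_m| <= e on the disc, the coefficients of orders one and two differ by at most e c
    and e c^2, with c = 8/r, so they converge. The cubic remainder M c^3 |h|^3 is uniform in n and
    passes to the limit. *)
Lemma T2_uniform_limit (F : nat -> C -> C) f w r M : 0 < r ->
  (forall n z, nm (z - w) < r -> T2 (F n) z /\ nm (F n z) <= M) ->
  (forall e : R, 0 < e -> exists N : nat, forall n z, (N <= n)%N -> nm (z - w) < r ->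
    nm (F n z - f z) <= e) ->
  T2 f w.
Proof.
move=> r0 hF hlim.
have M0 : 0 <= M.
  by apply: le_trans (nm_ge0 (F 0%N w)) (hF 0%N w _).2; rewrite subrr nm0.
have /choice[A hA] n := power_series r0 (hF n).
have c0 : 0 < 8 / r by rewrite divr_gt0.
set c := 8 / r in hA c0.
have sum3 (a : nat -> C) (h : C) : \sum_(k < 3) a k * h ^+ k = a 0%N + a 1%N * h + a 2%N * h ^+ 2.
  by rewrite !big_ord_recl big_ord0 /= /bump /= expr0 expr1 mulr1 addr0 addrA.
(* The coefficients come from [choice] and are not additive by construction. Those of F_n - F_m are
   identified with the differences by comparing expansions up to order three. *)
have diff n m (e : R) : (forall z, nm (z - w) < r -> nm (F n z - F m z) <= e) ->
    nm (A n 1%N - A m 1%N) <= e * c /\ nm (A n 2%N - A m 2%N) <= e * c ^+ 2.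
  move=> he.
  have hD z : nm (z - w) < r -> T2 (fun x => F n x - F m x) z /\ nm (F n z - F m z) <= e.
    by move=> zr; split; [apply: T2_sub; apply (hF _ _ zr).1|exact: he].
  have e0 : 0 <= e by apply: le_trans (nm_ge0 _) (he w _); rewrite subrr nm0.
  have [a [a0 ak ah]] := power_series r0 hD.
  have [an0 _ anh] := hA n; have [am0 _ amh] := hA m.
  have [E1 E2] : A n 1%N - A m 1%N - a 1%N = 0 /\ A n 2%N - A m 2%N - a 2%N = 0.
    apply: (@quadratic_eq0 _ _ ((M + M + e) * c ^+ 3) r) => //.
      by rewrite mulr_ge0 ?exprn_ge0// ?addr_ge0// ltW.
    move=> h hr; have := ah h hr 3%N; have := anh h hr 3%N; have := amh h hr 3%N.
    rewrite !sum3 a0 an0 am0 -/c !(exprMn _ c).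
    set X := F m _ - _; set Y := F n _ - _; set Z := F n _ - _ - _ => hX hY hZ.
    rewrite (_ : _ * h + _ * h ^+ 2 = Z + X - Y); last by rewrite /X /Y /Z; ring.
    have := nmB (Z + X) Y; have := nmD Z X; lra.
  move/subr0_eq : E1 => ->; move/subr0_eq : E2 => ->.
  by split; [have := ak 1%N; rewrite expr1|exact: ak].
have cauchyF (e : R) : 0 < e -> exists N : nat, forall n m, (N <= n)%N -> (N <= m)%N ->
    forall z, nm (z - w) < r -> nm (F n z - F m z) <= e.
  move=> e0; have e20 : 0 < e / 2 by lra.
  have [N hN] := hlim _ e20; exists N => n m Nn Nm z zr.
  have := hN _ _ Nn zr; have := hN _ _ Nm zr; have := nmB_tri (F n z) (f z) (F m z).
  rewrite (nmBC (f z)); lra.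
have cauchyA i : (i == 1%N) || (i == 2%N) -> exists l : C, (fun n => A n i) @ \oo --> l.
  move=> hi; apply: C_complete => e e0.
  have ci : 0 < c ^+ i by rewrite exprn_gt0.
  have [N hN] := cauchyF _ (divr_gt0 e0 ci); exists N => n m Nn Nm.
  have := diff n m _ (hN n m Nn Nm) => -[d1 d2].
  have -> : e = e / c ^+ i * c ^+ i by rewrite divfK// gt_eqF.
  by case/orP : hi d1 d2 => /eqP->.
have [b hb] := cauchyA 1%N isT; have [d hd] := cauchyA 2%N isT.
apply: (@expansion_T2 _ _ f w b d) => e e0.
pose K := M * c ^+ 3.
have K0 : 0 <= K by rewrite mulr_ge0 ?exprn_ge0// ltW.
have K1 : 0 < K + 1 by rewrite ltr_wpDl.
exists (Num.min r (e / (K + 1))); first by rewrite lt_min r0 divr_gt0.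
move=> h; rewrite lt_min => /andP[hr]; rewrite ltr_pdivlMr// => he.
suff hK : nm (f (w + h) - f w - b * h - d * h ^+ 2) <= K * nm h ^+ 3.
  rewrite (le_trans hK)// exprSr mulrCA [e * _]mulrC ler_wpM2l ?exprn_ge0 ?nm_ge0//.
  have := nm_ge0 h; lra.
apply/ler_addgt0Pr => t t0.
(* Four errors are bounded with this u: the values at w + h and at w, and the two coefficients
   multiplied by h and h^2. Each is at most u (|h| + 1)^2. *)
have t50 : 0 < t / (4 * (nm h + 1) ^+ 2).
  by rewrite divr_gt0// mulr_gt0// exprn_gt0// ltr_wpDl// nm_ge0.
set u := t / _ in t50.
move/nm_cvgP/(_ _ t50) : hb => -[N1 _ h1]; move/nm_cvgP/(_ _ t50) : hd => -[N2 _ h2].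
have [N3 h3] := hlim _ t50.
pose n := maxn N1 (maxn N2 N3).
have {}h1 : nm (A n 1%N - b) < u by apply: h1; rewrite /= leq_maxl.
have {}h2 : nm (A n 2%N - d) < u by apply: h2; rewrite /= /n maxnCA leq_maxl.
have N3n : (N3 <= n)%N by rewrite /n !leq_max leqnn !orbT.
have h4 : nm (F n (w + h) - f (w + h)) <= u by apply: h3 => //; rewrite addrC addKr.
have h5 : nm (F n w - f w) <= u by apply: h3 => //; rewrite subrr nm0.
have [a0 _ /(_ h hr 3%N)] := hA n; rewrite sum3 a0 (exprMn _ c) [M * (_ * _)]mulrA -/K => h6.
rewrite (_ : _ - _ * _ ^+ 2 = (F n (w + h) - (F n w + A n 1%N * h + A n 2%N * h ^+ 2))
  - (F n (w + h) - f (w + h)) + (F n w - f w) + (A n 1%N - b) * h + (A n 2%N - d) * h ^+ 2);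
  last by ring.
move: h6 h4 h5; set X := F n _ - (_ + _); set Y := F n _ - _; set Z := F n _ - _ => hX hY hZ.
have u4 : u * (4 * (nm h + 1) ^+ 2) = t.
  by rewrite /u divfK// gt_eqF// mulr_gt0// exprn_gt0// ltr_wpDl// nm_ge0.
apply: le_trans (nmD _ _) _; apply: le_trans (lerD (nmD _ _) (lexx _)) _.
apply: le_trans (lerD (lerD (nmD _ _) (lexx _)) (lexx _)) _.
apply: le_trans (lerD (lerD (lerD (nmB _ _) (lexx _)) (lexx _)) (lexx _)) _.
rewrite [nm (_ * h)]nmM [nm (_ * h ^+ 2)]nmM nmX.
have e1 : nm (A n 1%N - b) * nm h <= u * nm h by rewrite ler_wpM2r ?nm_ge0// ltW.
have e2 : nm (A n 2%N - d) * nm h ^+ 2 <= u * nm h ^+ 2 by rewrite ler_wpM2r ?exprn_ge0 ?nm_ge0// ltW.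
have h0 := nm_ge0 h.
have uh : 0 <= u * nm h by rewrite mulr_ge0// ltW.
have uh2 : 0 <= u * nm h ^+ 2 by rewrite mulr_ge0 ?exprn_ge0// ltW.
rewrite sqrrD1 in u4; lra.
Qed.

End PowerSeries.

(** * Goursat's lemma and antiderivatives *)

Section Antiderivative.
Variable R : realType.

Lemma antiderivative (g : R -> R) (l : R) : continuous g ->
  exists G : R -> R, forall x, - l < x -> x < l -> is_derive x 1 G (g x).
Proof.
move=> cg; exists (fun x => \int[lebesgue_measure]_(t in [set` `[- l, x]]) g t)%R => x lx xl.
have gi : lebesgue_measure.-integrable `[- l, l] (EFin \o g).
  apply: continuous_compact_integrable; first exact: segment_compact.
  exact: continuous_subspaceT.
have [dG GE] := continuous_FTC1_closed xl gi lx (cg x).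
exact: (DeriveDef dG (etrans (esym (derive1E _ _)) GE)).
Qed.

(** The mean value theorem for G minus a primitive of c1 + c2 t. The end points are unordered
    because increments of either sign occur in [primitive]. *)
Lemma affine_mean_value (G g : R -> R) (a b c1 c2 e : R) :
  (forall t, Num.min a b <= t -> t <= Num.max a b -> is_derive t 1 G (g t)) ->
  (forall t, Num.min a b <= t -> t <= Num.max a b -> `|g t - (c1 + c2 * t)| <= e) ->
  `|G b - G a - (c1 * (b - a) + c2 * (b ^+ 2 - a ^+ 2) / 2)| <= e * `|b - a|.
Proof.
wlog ab : a b / a <= b => [hw hG hg|].
  have [/hw|/ltW ba] := leP a b; first exact.
  have := hw b a ba; rewrite minC maxC => /(_ hG hg).
  rewrite (distrC a b) (_ : G b - G a - _ =
    - (G a - G b - (c1 * (a - b) + c2 * (a ^+ 2 - b ^+ 2) / 2))); last by ring.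
  by rewrite normrN.
rewrite min_l// max_r// => hG hg.
pose H t := G t - (c1 * t + c2 / 2 * t ^+ 2).
have dH t : a <= t -> t <= b -> is_derive t 1 H (g t - (c1 + c2 * t)).
  move=> at_ tb; have hGt := hG t at_ tb.
  rewrite /H; apply: is_derive_eq.
  by rewrite /GRing.scale /=; field.
have [t /[!in_itv] /= /andP[at_ tb] E] : exists2 t, t \in `[a, b]%R &
    H b - H a = (g t - (c1 + c2 * t)) * (b - a).
  apply: MVT_segment => //.
    by move=> t /[!in_itv] /= /andP[at_ tb]; apply: dH; exact: ltW.
  apply: derivable_within_continuous => t /[!in_itv] /= /andP[at_ tb].
  exact: (@ex_derive _ _ _ _ _ _ _ (dH t at_ tb)).
rewrite (_ : _ - _ = H b - H a); last by rewrite /H; field.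
by rewrite E normrM ler_wpM2r// hg.
Qed.

End Antiderivative.

Section Goursat.
Variables (R : realType) (C : complex_model R).
Implicit Types (f g : C -> C) (z w : C) (r : R).

Definition cdiff f z := exists a : C, forall e : R, 0 < e ->
  exists2 d : R, 0 < d & forall h : C, nm h < d ->
    nm (f (z + h) - f z - a * h) <= e * nm h.

Lemma cdiff_continuous f z : cdiff f z -> {for z, continuous f}.
Proof.
move=> [a /(_ 1 ltr01)[d d0 h]]; apply/nm_contP => e e0.
have K1 : 0 < nm a + 1 by rewrite ltr_wpDl ?nm_ge0.
exists (Num.min d (e / (nm a + 1))); first by rewrite lt_min d0 divr_gt0.
move=> y; rewrite lt_min => /andP[yd]; rewrite ltr_pdivlMr// => ye.
have := h _ yd; rewrite (_ : z + (y - z) = y); last by rewrite addrC subrK.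
have := nmD (f y - f z - a * (y - z)) (a * (y - z)).
rewrite subrK nmM; lra.
Qed.

(** [C] is normed over itself and not over [R], so the derivative in a real parameter is taken
    coordinatewise. *)
Definition path_derivative (A : R -> C) (t : R) (v : C) :=
  is_derive t 1 (fun s => reC (A s)) (reC v) /\ is_derive t 1 (fun s => imC (A s)) (imC v).

Lemma path_antiderivative (g : R -> C) (l : R) :
  continuous (fun t => reC (g t)) -> continuous (fun t => imC (g t)) ->
  exists A : R -> C, forall x, - l < x -> x < l -> path_derivative A x (g x).
Proof.
move=> cr ci; have [G1 h1] := antiderivative l cr; have [G2 h2] := antiderivative l ci.
exists (fun t => mkC C (G1 t) (G2 t)) => x lx xl; split.
  by under eq_fun do rewrite re_mk; exact: h1.
by under eq_fun do rewrite im_mk; exact: h2.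
Qed.

(** The mean value theorem fails for complex values, so the two coordinates are treated separately,
    at the price of a factor 2. *)
Lemma path_mean_value (A : R -> C) (g : R -> C) (a b : R) (c1 c2 : C) (e : R) :
  (forall t, Num.min a b <= t -> t <= Num.max a b -> path_derivative A t (g t)) ->
  (forall t, Num.min a b <= t -> t <= Num.max a b -> nm (g t - (c1 + c2 * toC t)) <= e) ->
  nm (A b - A a - (c1 * toC (b - a) + c2 * toC ((b ^+ 2 - a ^+ 2) / 2))) <= 2 * e * `|b - a|.
Proof.
move=> hA hg.
have rT (z : C) x : reC (z * toC x) = reC z * x by rewrite mulrC reM_toC mulrC.
have iT (z : C) x : imC (z * toC x) = imC z * x by rewrite mulrC imM_toC mulrC.
have h1 := @affine_mean_value _ (fun t => reC (A t)) (fun t => reC (g t)) a b (reC c1) (reC c2) e.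
have h2 := @affine_mean_value _ (fun t => imC (A t)) (fun t => imC (g t)) a b (imC c1) (imC c2) e.
apply: (le_trans (nm_le_ReIm _)).
rewrite -mulrA mulr_natl mulr2n lerD//.
  rewrite !(reB, reD, rT) !mulrA; apply: h1 => t at_ tb; first by case: (hA t at_ tb).
  by rewrite -rT -reD -reB (le_trans (Re_le _))// hg.
rewrite !(imB, imD, iT) !mulrA; apply: h2 => t at_ tb; first by case: (hA t at_ tb).
by rewrite -iT -imD -imB (le_trans (Im_le _))// hg.
Qed.

Definition iC : C := mkC C 0 1.

Lemma iC2 : iC * iC = -1.
Proof. by apply: C_ext; rewrite mk_mul ?re_mk ?im_mk ?reN ?imN ?re1 ?im1; ring. Qed.

Lemma nm_iC : nm iC = 1.
Proof. by rewrite nm_sqrt re_mk im_mk expr0n expr1n add0r sqrtr1. Qed.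

Lemma mkC_E (x y : R) : mkC C x y = toC x + iC * toC y.
Proof.
apply: C_ext; rewrite ?reD ?imD ?reM ?imM ?re_toC ?im_toC !re_mk !im_mk; ring.
Qed.

(* A y and B x play the role of antiderivatives of f along horizontal and
   vertical lines, so rectangle_integral is the contour integral of f. *)
Definition rectangle_integral (A B : R -> R -> C) (x1 x2 y1 y2 : R) : C :=
  A y1 x2 - A y1 x1 + iC * (B x2 y2 - B x2 y1)
  - (A y2 x2 - A y2 x1) - iC * (B x1 y2 - B x1 y1).

(** Since i^2 = -1, the contributions of a + b z on the four sides cancel. What remains is the error
    e on each side, doubled by [path_mean_value]. *)
Lemma rectangle_integral_affine f (A B : R -> R -> C) (x1 x2 y1 y2 : R) (a b : C) (e : R) :
  x1 <= x2 -> y1 <= y2 ->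
  (forall x y, x1 <= x <= x2 -> y1 <= y <= y2 ->
    [/\ path_derivative (A y) x (f (mkC C x y)),
        path_derivative (B x) y (f (mkC C x y)) &
        nm (f (mkC C x y) - (a + b * mkC C x y)) <= e]) ->
  nm (rectangle_integral A B x1 x2 y1 y2) <= 4 * e * (x2 - x1 + (y2 - y1)).
Proof.
move=> x12 y12 h.
have hor y : y1 <= y <= y2 ->
    nm (A y x2 - A y x1 - ((a + b * (iC * toC y)) * toC (x2 - x1)
      + b * toC ((x2 ^+ 2 - x1 ^+ 2) / 2))) <= 2 * e * (x2 - x1).
  move=> hy; have ab : `|x2 - x1| = x2 - x1 by rewrite ger0_norm// subr_ge0.
  rewrite -[X in _ <= _ * X]ab.
  apply: (@path_mean_value _ (fun x => f (mkC C x y))) => t.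
    by rewrite min_l// max_r// => h1 h2; have [] := h t y _ hy; rewrite // h1 h2.
  rewrite min_l// max_r// => h1 h2; have [|_ _] := h t y _ hy; first by rewrite h1 h2.
  by rewrite mkC_E mulrDr [b * _ + _]addrC addrA.
have ver x : x1 <= x <= x2 ->
    nm (B x y2 - B x y1 - ((a + b * toC x) * toC (y2 - y1)
      + (b * iC) * toC ((y2 ^+ 2 - y1 ^+ 2) / 2))) <= 2 * e * (y2 - y1).
  move=> hx; have ab : `|y2 - y1| = y2 - y1 by rewrite ger0_norm// subr_ge0.
  rewrite -[X in _ <= _ * X]ab.
  apply: (@path_mean_value _ (fun y => f (mkC C x y))) => t.
    by rewrite min_l// max_r// => h1 h2; have [] := h x t hx; rewrite // h1 h2.
  rewrite min_l// max_r// => h1 h2; have [|_ _] := h x t hx; first by rewrite h1 h2.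
  by rewrite mkC_E mulrDr mulrA addrA.
have h1 := hor y1 _; have h2 := hor y2 _; have h3 := ver x1 _; have h4 := ver x2 _.
rewrite !lexx !andbT ?andTb in h1 h2 h3 h4.
have {}h1 := h1 y12; have {}h2 := h2 y12; have {}h3 := h3 x12; have {}h4 := h4 x12.
rewrite /rectangle_integral.
move: h1 h2 h3 h4.
set X1 := _ - (_ + _) => h1; set X2 := A y2 _ - _ - (_ + _) => h2.
set X3 := B x1 _ - _ - (_ + _) => h3; set X4 := B x2 _ - _ - (_ + _) => h4.
rewrite (_ : _ - iC * _ = X1 + iC * X4 - X2 - iC * X3); last first.
  rewrite /X1 /X2 /X3 /X4 !(toCB, toCM, toCD, rmorphXn) /=.
  have -> : b * iC = iC * b by rewrite mulrC.
  have := iC2; move: iC (toC x1) (toC x2) (toC y1) (toC y2) => i u1 u2 v1 v2 i2.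
  transitivity (A y1 x2 - A y1 x1 + i * (B x2 y2 - B x2 y1) - (A y2 x2 - A y2 x1) - i * (B x1 y2 - B x1 y1)); first by [].
  ring.
have := nmB (X1 + iC * X4 - X2) (iC * X3); have := nmB (X1 + iC * X4) X2.
have := nmD X1 (iC * X4); rewrite !nmM nm_iC !mul1r; lra.
Qed.

Lemma nested_rectangles (x l : nat -> R) :
  (forall n, 0 <= l n) ->
  (forall n, x n <= x n.+1) -> (forall n, x n.+1 + l n.+1 <= x n + l n) ->
  exists c, forall n, x n <= c <= x n + l n.
Proof.
move=> l0 xS xlS.
have x_homo m k : x m <= x (m + k)%N.
  by elim: k => [|k ih]; rewrite ?addn0// addnS (le_trans ih).
have xl_homo m k : x (m + k)%N + l (m + k)%N <= x m + l m.
  by elim: k => [|k ih]; rewrite ?addn0// addnS (le_trans (xlS _)).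
have xle m n : x m <= x n + l n.
  have h1 := x_homo m n; have h2 := xl_homo n m; have := l0 (m + n)%N.
  rewrite addnC in h2; lra.
have hs : has_sup (range x).
  split; first by exists (x 0%N), 0%N.
  by exists (x 0%N + l 0%N) => _ [m _ <-].
exists (sup (range x)) => n; apply/andP; split.
  by apply: ub_le_sup; [exact: hs.2|exists n].
by apply: ge_sup; [exact: hs.1|move=> _ [m _ <-]].
Qed.

Lemma segment_dist (a l x y : R) : a <= x <= a + l -> a <= y <= a + l -> `|x - y| <= l.
Proof. by move=> /andP[h1 h2] /andP[h3 h4]; rewrite ler_norml; apply/andP; split; lra. Qed.

(** Some quarter of a rectangle carries at least a quarter of the integral. The chosen rectangles
    shrink to a point near which f is affine up to e L/2^n, with L the sum of the two sides, so the
    n-th integral is at most 4 e (L/2^n)^2. The factor 4^n cancels and 4 e L^2 is left for every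
    e. *)
Lemma goursat f (A B : R -> R -> C) (x1 x2 y1 y2 : R) :
  x1 <= x2 -> y1 <= y2 ->
  (forall x y, x1 <= x <= x2 -> y1 <= y <= y2 ->
    [/\ path_derivative (A y) x (f (mkC C x y)),
        path_derivative (B x) y (f (mkC C x y)) & cdiff f (mkC C x y)]) ->
  rectangle_integral A B x1 x2 y1 y2 = 0.
Proof.
move=> x12 y12 hf.
(* A rectangle is coded as ((x, width), (y, height)), with (x, y) its lower left corner. *)
pose J (s : (R * R) * (R * R)) :=
  rectangle_integral A B s.1.1 (s.1.1 + s.1.2) s.2.1 (s.2.1 + s.2.2).
pose child (s : (R * R) * (R * R)) (b b' : bool) :=
  ((s.1.1 + (if b then s.1.2 / 2 else 0), s.1.2 / 2),
   (s.2.1 + (if b' then s.2.2 / 2 else 0), s.2.2 / 2)).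
have /choice[ch hch] (s : (R * R) * (R * R)) : exists p : bool * bool,
    nm (J s) <= 4 * nm (J (child s p.1 p.2)).
  apply/not_existsP => hn.
  have n1 := hn (false, false); have n2 := hn (false, true).
  have n3 := hn (true, false); have n4 := hn (true, true).
  move: n1 n2 n3 n4; rewrite /= => /negP + /negP + /negP + /negP.
  rewrite -!ltNge.
  have -> : J s = J (child s false false) + J (child s false true) +
      J (child s true false) + J (child s true true).
    case: s {hn} => -[x l] [y m]; rewrite /J /child /rectangle_integral /= !addr0.
    have -> : x + l / 2 + l / 2 = x + l by field.
    have -> : y + m / 2 + m / 2 = y + m by field.
    by ring.
  set a := J _; set b := J _; set c := J _; set d := J _.
  have := nmD (a + b + c) d; have := nmD (a + b) c; have := nmD a b; lra.
pose st s := child s (ch s).1 (ch s).2.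
pose s n := iter n st ((x1, x2 - x1), (y1, y2 - y1)).
have sS n : s n.+1 = st (s n) by rewrite /s iterS.
have lE n : (s n).1.2 = (x2 - x1) / 2 ^+ n.
  elim: n => [|n ih]; first by rewrite divr1.
  by rewrite sS /st /child /= ih exprS; field; rewrite expf_neq0.
have mE n : (s n).2.2 = (y2 - y1) / 2 ^+ n.
  elim: n => [|n ih]; first by rewrite divr1.
  by rewrite sS /st /child /= ih exprS; field; rewrite expf_neq0.
have l0 n : 0 <= (s n).1.2 by rewrite lE divr_ge0 ?subr_ge0.
have m0 n : 0 <= (s n).2.2 by rewrite mE divr_ge0 ?subr_ge0.
have [c hc] : exists c, forall n, (s n).1.1 <= c <= (s n).1.1 + (s n).1.2.
  apply: (@nested_rectangles (fun n => (s n).1.1) (fun n => (s n).1.2)) => // n;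
    by rewrite sS /st /child /=; have := l0 n; case: ifP => _; lra.
have [d hd] : exists d, forall n, (s n).2.1 <= d <= (s n).2.1 + (s n).2.2.
  apply: (@nested_rectangles (fun n => (s n).2.1) (fun n => (s n).2.2)) => // n;
    by rewrite sS /st /child /=; have := m0 n; case: ifP => _; lra.
have inx n : x1 <= (s n).1.1 /\ (s n).1.1 + (s n).1.2 <= x2.
  elim: n => [|n [ih1 ih2]]; first by rewrite /s /=; lra.
  by rewrite sS /st /child /=; have := l0 n; case: ifP => _; lra.
have iny n : y1 <= (s n).2.1 /\ (s n).2.1 + (s n).2.2 <= y2.
  elim: n => [|n [ih1 ih2]]; first by rewrite /s /=; lra.
  by rewrite sS /st /child /=; have := m0 n; case: ifP => _; lra.
have J4 n : nm (J (s 0%N)) <= 4 ^+ n * nm (J (s n)).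
  elim: n => [|n ih]; first by rewrite mul1r.
  have h := hch (s n); rewrite -/(st (s n)) -sS in h.
  by rewrite (le_trans ih)// exprSr -mulrA ler_wpM2l ?exprn_ge0.
have J0 : J (s 0%N) = rectangle_integral A B x1 x2 y1 y2.
  by rewrite /J /s /= ![_ + (_ - _)]addrC !subrK.
rewrite -J0; apply/eqP; rewrite -nm_eq0 eq_le nm_ge0 andbT.
pose L := x2 - x1 + (y2 - y1).
have L0 : 0 <= L by rewrite addr_ge0 ?subr_ge0.
apply: (@le_of_linear _ _ (4 * L ^+ 2) 1) => //; first by rewrite mulr_ge0 ?exprn_ge0.
move=> e e0 _.
have [||_ _ [b hb]] := hf c d.
- by have := hc 0%N; rewrite /s /= addrC subrK.
- by have := hd 0%N; rewrite /s /= [y1 + _]addrC subrK.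
have [r r0 hr] := hb e e0.
have [n hn] : exists n : nat, L / 2 ^+ n < r.
  have [n hn] : exists n : nat, L / r < n%:R.
    by exists (Num.bound (L / r)); rewrite archi_boundP// divr_ge0// ltW.
  exists n; rewrite ltr_pdivrMr ?exprn_gt0// mulrC -ltr_pdivrMr// (lt_le_trans hn)//.
  by rewrite -natrX ler_nat ltnW// ltn_expl.
pose z0 := mkC C c d.
have Ln : (s n).1.2 + (s n).2.2 = L / 2 ^+ n by rewrite lE mE -mulrDl.
have := @rectangle_integral_affine f A B (s n).1.1 ((s n).1.1 + (s n).1.2)
  (s n).2.1 ((s n).2.1 + (s n).2.2) (f z0 - b * z0) b (e * (L / 2 ^+ n)).
rewrite -/(J (s n)) => /(_ _ _ _)/wrap[].
- by rewrite lerDl.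
- by rewrite lerDl.
- move=> x y /andP[hx1 hx2] /andP[hy1 hy2].
  have [i1 i2] := inx n; have [i3 i4] := iny n.
  have [|| pA pB _] := hf x y;
    [by rewrite (le_trans i1)// (le_trans hx2)|by rewrite (le_trans i3)// (le_trans hy2)|split=> //].
  have hz : nm (mkC C x y - z0) <= L / 2 ^+ n.
    rewrite (le_trans (nm_le_ReIm _))// reB imB !re_mk !im_mk -Ln lerD//.
      by apply: (segment_dist _ (hc n)); rewrite hx1.
    by apply: (segment_dist _ (hd n)); rewrite hy1.
  have := hr (mkC C x y - z0) (le_lt_trans hz hn).
  rewrite [z0 + _]addrC subrK (_ : _ - _ * (_ - _) = f (mkC C x y) - (f z0 - b * z0 + b * mkC C x y)); last by ring.
  by move=> h; rewrite (le_trans h)// ler_wpM2l// ltW.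
rewrite [X in _ <= 4 * _ * X](_ : _ = L / 2 ^+ n) => [hJ|]; last by rewrite -Ln; ring.
rewrite (le_trans (J4 n))//.
have : 4 ^+ n * nm (J (s n)) <= 4 ^+ n * (4 * (e * (L / 2 ^+ n)) * (L / 2 ^+ n)).
  by rewrite ler_wpM2l ?exprn_ge0.
move=> h; rewrite (le_trans h)//.
have -> : 4 ^+ n = 2 ^+ n * 2 ^+ n :> R by rewrite -exprMn; congr (_ ^+ _); ring.
rewrite le_eqVlt; apply/orP; left; apply/eqP; field.
by rewrite expf_neq0.
Qed.

End Goursat.

(** * Primitives of complex differentiable functions *)

Section Primitive.
Variables (R : realType) (C : complex_model R).
Implicit Types (f g : C -> C) (z w : C) (r : R).

Lemma clamp_id (r t : R) : - r <= t <= r -> Num.max (- r) (Num.min t r) = t.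
Proof. by move=> /andP[h1 h2]; rewrite min_l// max_r. Qed.

Lemma clamp_bound (r t : R) : 0 <= r -> - r <= Num.max (- r) (Num.min t r) <= r.
Proof.
move=> r0; rewrite le_max lexx /= ge_max ge_min lexx orbT andbT; lra.
Qed.

Lemma clamp_continuous (r : R) : continuous (fun t => Num.max (- r) (Num.min t r)).
Proof.
move=> t; apply: (@continuous_max _ _ (fun=> - r) (fun t => Num.min t r)).
  exact: cst_continuous.
apply: (@continuous_min _ _ id (fun=> r)); first exact: cvg_id.
exact: cst_continuous.
Qed.

Lemma between_le (u v t : R) :
  Num.min u (u + v) <= t -> t <= Num.max u (u + v) -> `|t - u| <= `|v|.
Proof.
have [v0|v0] := leP 0 v.
  by rewrite (ger0_norm v0) min_l ?max_r ?lerDl// => h1 h2; rewrite ler_norml; lra.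
by rewrite (ltr0_norm v0) min_r ?max_l ?gerDl ?(ltW v0)// => h1 h2; rewrite ler_norml; lra.
Qed.

Definition T2_with f z (a : C) := exists b : C, forall e : R, 0 < e ->
  exists2 d : R, 0 < d & forall h : C, nm h < d ->
    nm (f (z + h) - f z - a * h - b * h ^+ 2) <= e * nm h ^+ 2.

(** F integrates f from the corner (-r, -r), first horizontally and then vertically; by Goursat the
    other order gives the same value. So F(z+h) - F(z) is the integral along one vertical and one
    horizontal segment within |h| of z, where f is f(z) + b (x - z) up to o(|h|). This yields the
    coefficients f(z) and b/2. *)
Lemma primitive f (rho : R) : 0 < rho -> (forall z : C, nm z < rho -> cdiff f z) ->
  exists F : C -> C, exists2 r : R, 0 < r & forall z : C, nm z < r -> T2_with F z (f z).
Proof.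
move=> rho0 hf; pose r := rho / 3.
have r0 : 0 < r by rewrite divr_gt0.
have rr : 2 * r < rho by rewrite /r; lra.
(* [antiderivative] wants functions continuous on the whole line; clamping both coordinates extends
   f from the square continuously. *)
pose cl t := Num.max (- r) (Num.min t r).
have sq x y : - r <= x <= r -> - r <= y <= r -> cdiff f (mkC C x y).
  move=> hx hy; apply: hf; apply: le_lt_trans rr.
  rewrite (le_trans (nm_le_ReIm _))// re_mk im_mk (_ : 2 * r = r + r); last by ring.
  by rewrite lerD// ler_norml.
have clb t : - r <= cl t <= r by apply: clamp_bound; exact: ltW.
have cmk (u v : R -> R) t : {for t, continuous u} -> {for t, continuous v} ->
    {for t, continuous (fun s => mkC C (cl (u s)) (cl (v s)))}.
  move=> cu cv.
  have cu' : {for t, continuous (fun s => cl (u s))}.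
    by apply: (@continuous_comp _ _ _ u cl) => //; exact: clamp_continuous.
  have cv' : {for t, continuous (fun s => cl (v s))}.
    by apply: (@continuous_comp _ _ _ v cl) => //; exact: clamp_continuous.
  apply/(nm_cvgP (nbhs_filter t)) => e e0.
  have e20 : 0 < e / 2 by lra.
  move/cvgrPdist_lt/(_ _ e20) : cu'; move/cvgrPdist_lt/(_ _ e20) : cv'.
  apply: filterS2 => s h1 h2; rewrite (le_lt_trans (nm_le_ReIm _))//.
  by rewrite reB imB !re_mk !im_mk distrC [X in _ + X]distrC; lra.
have cg (u v : R -> R) : continuous u -> continuous v ->
    continuous (fun s => f (mkC C (cl (u s)) (cl (v s)))).
  move=> cu cv t; apply: (@continuous_comp _ _ _ (fun s => mkC C (cl (u s)) (cl (v s))) f).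
    by apply: cmk; [exact: cu|exact: cv].
  by apply: cdiff_continuous; exact: sq.
(* The interval is wider than [-r, r] so that the derivatives are two-sided at the ends of the
   square as well. *)
have anti (u v : R -> R) : continuous u -> continuous v -> exists A : R -> C,
    forall x, - (2 * r) < x -> x < 2 * r -> path_derivative A x (f (mkC C (cl (u x)) (cl (v x)))).
  move=> cu cv; apply: path_antiderivative => t.
    by apply: (@continuous_comp _ _ _ _ (@reC R C)); [exact: cg|exact: reC_continuous].
  by apply: (@continuous_comp _ _ _ _ (@imC R C)); [exact: cg|exact: imC_continuous].
have c_id : continuous (id : R -> R) by move=> t; exact: cvg_id.
have c_cst (y : R) : continuous ((fun=> y) : R -> R) by move=> t; exact: cst_continuous.
have /choice[A hA] y := anti id (fun=> y) c_id (c_cst y).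
have /choice[B hB] x := anti (fun=> x) id (c_cst x) c_id.
have {}hA x y : - r <= x <= r -> - r <= y <= r -> path_derivative (A y) x (f (mkC C x y)).
  move=> hx hy; have := hA y x; rewrite /cl !clamp_id// => h.
  by move/andP : hx => [h1 h2]; apply: h; lra.
have {}hB x y : - r <= x <= r -> - r <= y <= r -> path_derivative (B x) y (f (mkC C x y)).
  move=> hx hy; have := hB x y; rewrite /cl !clamp_id// => h.
  by move/andP : hy => [h1 h2]; apply: h; lra.
pose F z : C := A (- r) (reC z) - A (- r) (- r) + iC C * (B (reC z) (imC z) - B (reC z) (- r)).
have FE x y : - r <= x <= r -> - r <= y <= r ->
    F (mkC C x y) = iC C * (B (- r) y - B (- r) (- r)) + (A y x - A y (- r)).
  move=> hx hy; rewrite /F re_mk im_mk.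
  have h0 : rectangle_integral A B (- r) x (- r) y = 0.
    move/andP : (hx) => [x1 x2]; move/andP : (hy) => [y1 y2].
    apply: (@goursat _ _ f) => // x' y' /andP[a1 a2] /andP[b1 b2].
    have hx' : - r <= x' <= r by rewrite a1 (le_trans a2).
    have hy' : - r <= y' <= r by rewrite b1 (le_trans b2).
    by split; [exact: hA|exact: hB|exact: sq].
  move/eqP : h0; rewrite /rectangle_integral -addrA -opprD subr_eq0 => /eqP ->.
  by rewrite addrC.
exists F, r => // z zr.
have [b hb] : cdiff f z by apply: hf; apply: lt_trans zr _; lra.
exists (b / 2) => e e0.
(* Each of the two segments contributes at most 2 (e/4) |h|^2. *)
have e40 : 0 < e / 4 by lra.
have [d d0 hd] := hb _ e40.
exists (Num.min d (r - nm z)); first by rewrite lt_min d0 subr_gt0.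
move=> h; rewrite lt_min => /andP[hhd hhr].
set x := reC z; set y := imC z; set s := reC h; set t := imC h.
have zE : z = mkC C x y by rewrite mkC_K.
have hE : h = mkC C s t by rewrite mkC_K.
have inr (z' : C) : nm z' < r -> - r <= reC z' <= r /\ - r <= imC z' <= r.
  by move=> z'r; rewrite -!ler_norml !(ltW (le_lt_trans _ z'r))// ?Re_le ?Im_le.
have inr2 (z' : C) : `|reC z'| <= `|s| -> `|imC z'| <= `|t| -> nm z' <= nm h.
  move=> h1 h2; rewrite !nm_sqrt ler_wsqrtr// lerD//.
    by rewrite -[leLHS]real_normK ?num_real// -[leRHS]real_normK ?num_real// lerXn2r ?nnegrE.
  by rewrite -[leLHS]real_normK ?num_real// -[leRHS]real_normK ?num_real// lerXn2r ?nnegrE.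
have close (s' t' : R) : `|s'| <= `|s| -> `|t'| <= `|t| ->
   [/\ - r <= x + s' <= r, - r <= y + t' <= r &
    nm (f (mkC C (x + s') (y + t')) - (f z + b * mkC C s' t')) <= e / 4 * nm h].
  move=> hs ht; have h1 : nm (mkC C s' t') <= nm h by apply: inr2; rewrite ?re_mk ?im_mk.
  have h2 : mkC C (x + s') (y + t') = z + mkC C s' t' by rewrite zE mk_add.
  have h3 : nm (z + mkC C s' t') < r by rewrite (le_lt_trans (nmD _ _))//; lra.
  have [h4 h5] := inr _ h3; rewrite -h2 re_mk im_mk in h4 h5; split=> //.
  rewrite h2 opprD addrA; apply: le_trans (hd _ (le_lt_trans h1 hhd)) _.
  by rewrite ler_wpM2l// ltW.
pose a := f z - b * z.
have K0 : 0 <= 2 * (e / 4 * nm h) by rewrite !mulr_ge0 ?nm_ge0// ltW.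
have zh : z + h = mkC C (x + s) (y + t) by rewrite {1}zE {1}hE mk_add.
have e1 : nm (A (y + t) (x + s) - A (y + t) x - ((a + b * (iC C * toC (y + t))) * toC (x + s - x)
      + b * toC (((x + s) ^+ 2 - x ^+ 2) / 2))) <= 2 * (e / 4 * nm h) * `|s|.
  have -> : `|s| = `|x + s - x| by rewrite addrAC subrr add0r.
  apply: (@path_mean_value _ _ _ (fun x' => f (mkC C x' (y + t)))) => x' h1 h2.
    have [] := close (x' - x) t (between_le h1 h2) (lexx _).
    by rewrite [x + (_ - _)]addrC subrK => hx hy _; exact: hA.
  have [] := close (x' - x) t (between_le h1 h2) (lexx _).
  rewrite [x + (_ - _)]addrC subrK => _ _; apply: le_trans.
  rewrite [X in nm (_ - X) <= _](_ : _ = f z + b * mkC C (x' - x) t)//.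
  by rewrite /a zE !mkC_E toCB toCD; ring.
have e2 : nm (B x (y + t) - B x y - ((a + b * toC x) * toC (y + t - y)
      + (b * iC C) * toC (((y + t) ^+ 2 - y ^+ 2) / 2))) <= 2 * (e / 4 * nm h) * `|t|.
  have -> : `|t| = `|y + t - y| by rewrite addrAC subrr add0r.
  apply: (@path_mean_value _ _ _ (fun y' => f (mkC C x y'))) => y' h1 h2.
    have [|] := close 0 (y' - y) _ (between_le h1 h2); first by rewrite normr0.
    by rewrite addr0 [y + (_ - _)]addrC subrK => hx hy _; exact: hB.
  have [|] := close 0 (y' - y) _ (between_le h1 h2); first by rewrite normr0.
  rewrite addr0 [y + (_ - _)]addrC subrK => _ _; apply: le_trans.
  rewrite [X in nm (_ - X) <= _](_ : _ = f z + b * mkC C 0 (y' - y))//.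
  by rewrite /a zE !mkC_E toCB toC0; ring.
have [hxs hyt _] := close s t (lexx _) (lexx _).
have n0s : `|0 : R| <= `|s| by rewrite normr0.
have n0t : `|0 : R| <= `|t| by rewrite normr0.
have [hx hy _] := close 0 0 n0s n0t; rewrite !addr0 in hx hy.
have f1 := FE _ _ hxs hyt; have f2 := FE _ _ hx hyt; rewrite -zh in f1.
have f3 : F z = A (- r) x - A (- r) (- r) + iC C * (B x y - B x (- r)) by [].
have f4 : F (mkC C x (y + t)) =
    A (- r) x - A (- r) (- r) + iC C * (B x (y + t) - B x (- r)) by rewrite /F re_mk im_mk.
have Fdiff : F (z + h) - F z = (A (y + t) (x + s) - A (y + t) x) + iC C * (B x (y + t) - B x y).
  rewrite -[F (z + h)](subrK (F (mkC C x (y + t)))) {1}f2 f1 f4 f3; ring.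
move: e1 e2; set X1 := _ - (_ + _) => e1; set X2 := B x _ - _ - (_ + _) => e2.
rewrite (_ : _ - _ - f z * h - b / 2 * h ^+ 2 = X1 + iC C * X2); last first.
  rewrite Fdiff /X1 /X2 /a; move: (f z) => fz.
  have zT : z = toC x + iC C * toC y by rewrite zE mkC_E.
  have hT : h = toC s + iC C * toC t by rewrite hE mkC_E.
  rewrite zT hT !(toCM, toCB, toCD, fmorphV, rmorphXn, rmorph_nat) /=.
  by field.
apply: le_trans (nmD _ _) _; rewrite nmM nm_iC mul1r.
have h1 := Re_le h; have h2 := Im_le h.
have h3 := ler_wpM2l K0 h1; have h4 := ler_wpM2l K0 h2.
rewrite (_ : e * nm h ^+ 2 = 2 * (e / 4 * nm h) * nm h + 2 * (e / 4 * nm h) * nm h); last by field.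
rewrite -/s -/t in h3 h4; lra.
Qed.

End Primitive.

(** * Holomorphic functions *)

Section Derivable.
Variables (R : realType) (C : complex_model R).

Lemma is_derive_nmP (V W : normedModType C) (f : V -> W) (x v : V) (a : W) :
  is_derive x v f a <-> forall e : R, 0 < e -> exists2 d : R, 0 < d &
    forall h : C, nm h < d -> nm (f (x + h *: v) - f x - h *: a) <= e * nm h.
Proof.
have key (h : C) : h != 0 -> nm (f (x + h *: v) - f x - h *: a) =
    nm h * nm (h^-1 *: (f (h *: v + x) - f x) - a).
  move=> h0; rewrite -nmZ scalerBr scalerA divff// scale1r.
  by rewrite [h *: v + x]addrC.
split.
- move=> [fd fE] e e0.
  have /nm_cvgP/(_ _ e0)/nm_nbhsP[d d0 hd] :
      (fun h => h^-1 *: ((f \o shift x) (h *: v) - f x)) @ 0^' --> a.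
    by rewrite -fE; exact: fd.
  exists d => // h hh; have [->|h0] := eqVneq h 0.
    by rewrite !scale0r addr0 subrr subr0 !nm0 mulr0.
  rewrite key// mulrC ler_wpM2r ?nm_ge0// ltW//; apply: hd => //.
  by rewrite subr0.
- move=> hf.
  have fa : (fun h => h^-1 *: ((f \o shift x) (h *: v) - f x)) @ 0^' --> a.
    apply/nm_cvgP => e e0; have e20 : 0 < e / 2 by lra.
    have [d d0 hd] := hf _ e20.
    apply/nm_nbhsP; exists d => // h; rewrite subr0 => hh h0.
    have := hd _ hh; rewrite key// mulrC ler_pM2r ?nm_gt0// => hle.
    by rewrite (le_lt_trans hle)//; lra.
  by split; [apply/cvg_ex; exists a|exact: (cvg_lim (@norm_hausdorff _ _) fa)].
Qed.

Lemma derive_lineE (V W : normedModType C) (f : V -> W) (x v : V) (a : W) :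
  is_derive x v f a <-> is_derive (0 : C) 1 (fun h : C => f (x + h *: v)) a.
Proof.
split=> /is_derive_nmP h; apply/is_derive_nmP => e /h[d d0 hd];
  exists d => // k /hd; rewrite scale0r addr0 add0r.
  by rewrite [k *: 1]mulr1.
by rewrite [k *: 1]mulr1.
Qed.

Implicit Types (f g : C -> C) (z w : C) (r : R).

Lemma derivable_cdiff f z : derivable f z 1 <-> cdiff f z.
Proof.
split.
- move=> /derivableP/is_derive_nmP h; exists ('D_1 f z) => e /h[d d0 hd].
  by exists d => // k /hd; rewrite [k *: 1]mulr1 [k *: _]mulrC.
- move=> [a ha]; suff : is_derive z 1 f a by case.
  apply/is_derive_nmP => e /ha[d d0 hd]; exists d => // k /hd.
  by rewrite [k *: 1]mulr1 [k *: _]mulrC.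
Qed.

Lemma T2_with_cdiff f z a : T2_with f z a -> is_derive z 1 f a.
Proof.
move=> [b hb]; apply/is_derive_nmP => e e0.
have [d d0 hd] := hb 1 ltr01.
have K1 : 0 < nm b + 1 by rewrite ltr_wpDl ?nm_ge0.
exists (Num.min d (e / (nm b + 1))); first by rewrite lt_min d0 divr_gt0.
move=> h; rewrite lt_min => /andP[hhd]; rewrite ltr_pdivlMr// => he.
have := hd _ hhd; rewrite [h *: 1]mulr1 [h *: a]mulrC mul1r.
have := nmD (f (z + h) - f z - a * h - b * h ^+ 2) (b * h ^+ 2).
rewrite subrK nmM nmX.
have : (nm b + 1) * nm h ^+ 2 <= e * nm h.
  by rewrite expr2 mulrA ler_wpM2r ?nm_ge0// mulrC ltW.
lra.
Qed.

Lemma T2_withP f z : T2 f z <-> exists a, T2_with f z a.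
Proof.
split=> [/T2_expansion[a [b h]]|[a [b h]]]; first by exists a, b.
exact: expansion_T2 h.
Qed.

Lemma T2_derivable f z : T2 f z -> derivable f z 1.
Proof. by move=> /T2_withP[a] /T2_with_cdiff[]. Qed.

Lemma bounded_on_disc (F : C -> C) (r : R) : 0 <= r ->
  (forall z : C, nm z <= r -> {for z, continuous F}) ->
  exists2 M : R, 0 <= M & forall z : C, nm z <= r -> nm (F z) <= M.
Proof.
move=> r0 cF.
have [c _ hc] : exists2 c, c \in [set z : C | nm z <= r] &
    forall t, t \in [set z : C | nm z <= r] -> nm (F t) <= nm (F c).
  apply: (@compact_EVT_max _ _ (fun z => nm (F z))).
  - by exists 0; rewrite /= nm0.
  - exact: disc_compact.
  - apply: continuous_in_subspaceT => x; rewrite inE /= => xr.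
    by apply: (@continuous_comp _ _ _ F (@nm R C C)); [exact: cF|exact: nm_continuous].
by exists (nm (F c)); [exact: nm_ge0|move=> z zr; apply: hc; rewrite inE].
Qed.

Lemma expansion1_unique F z (a : C) (a' : C) (K r : R) : 0 < r -> 0 <= K ->
  is_derive z 1 F a' ->
  (forall h : C, nm h < r -> nm (F (z + h) - F z - a * h) <= K * nm h ^+ 2) -> a = a'.
Proof.
move=> r0 K0 hF ha.
have hF' : is_derive z 1 F a.
  apply/is_derive_nmP => e e0; have K1 : 0 < K + 1 by rewrite ltr_wpDl.
  exists (Num.min r (e / (K + 1))); first by rewrite lt_min r0 divr_gt0.
  move=> h; rewrite lt_min => /andP[hr]; rewrite ltr_pdivlMr// => he.
  rewrite [h *: 1]mulr1 [h *: a]mulrC (le_trans (ha _ hr))// expr2 mulrA ler_wpM2r ?nm_ge0//.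
  have := nm_ge0 h; lra.
by case: hF => _ <-; case: hF' => _ <-.
Qed.

(** A Cauchy estimate with 8/r in place of 1/r: the first coefficient of the series has to be the
    derivative. *)
Lemma T2_taylor1 F z r M : 0 < r ->
  (forall x : C, nm (x - z) < r -> T2 F x /\ nm (F x) <= M) ->
  nm ('D_1 F z) <= M * (8 / r) /\ forall h : C, nm h < r ->
    nm (F (z + h) - F z - 'D_1 F z * h) <= M * (8 / r) ^+ 2 * nm h ^+ 2.
Proof.
move=> r0 hF; have [a [a0 ak ah]] := power_series r0 hF.
have [Tz FM] : T2 F z /\ nm (F z) <= M by apply: hF; rewrite subrr nm0.
have M0 := le_trans (nm_ge0 _) FM.
have h1 (h : C) : nm h < r -> nm (F (z + h) - F z - a 1%N * h) <= M * (8 / r) ^+ 2 * nm h ^+ 2.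
  move=> hr; have := ah h hr 2%N.
  by rewrite !big_ord_recl big_ord0 /= /bump /= a0 expr0 mulr1 addr0 opprD addrA (exprMn _ (8 / r)) [M * (_ * _)]mulrA expr1.
have <- : a 1%N = 'D_1 F z.
  apply: (@expansion1_unique F z _ _ (M * (8 / r) ^+ 2) r) => //.
    by rewrite mulr_ge0 ?exprn_ge0// divr_ge0// ltW.
  exact/derivableP/T2_derivable.
by split=> //; have := ak 1%N; rewrite expr1.
Qed.

(** The difference quotients of F with steps eta_n have second order expansions, and by Taylor's
    estimate they converge uniformly to f with error M c^2 |eta_n|. Hence [T2_uniform_limit] applies
    to f. *)
Lemma derivative_T2 (F f : C -> C) r : 0 < r ->
  (forall z : C, nm z < r -> T2_with F z (f z)) -> T2 f 0.
Proof.
move=> r0 hF.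
have TF z : nm z < r -> T2 F z by move=> zr; apply/T2_withP; exists (f z); exact: hF.
have DF z : nm z < r -> 'D_1 F z = f z by move=> /hF/T2_with_cdiff[].
have [M M0 FM] : exists2 M : R, 0 <= M & forall z : C, nm z <= r / 2 -> nm (F z) <= M.
  apply: bounded_on_disc; first by lra.
  by move=> z zr; apply/T2_continuous/TF; lra.
(* Discs of radius r/4 about points with |z| < r/4 stay in |z| < r/2, where F is bounded by M. *)
set c := 8 / (r / 4).
have c0 : 0 <= c by rewrite divr_ge0// divr_ge0// ltW.
have r40 : 0 < r / 4 by lra.
have loc (z : C) : nm z < r / 4 -> nm (f z) <= M * c /\ forall h : C, nm h < r / 4 ->
    nm (F (z + h) - F z - f z * h) <= M * c ^+ 2 * nm h ^+ 2.
  move=> zr; have := @T2_taylor1 F z (r / 4) M r40; rewrite DF; last by lra.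
  apply=> x xz; have := nmD (x - z) z; rewrite subrK => xr.
  by split; [apply: TF; lra|apply: FM; lra].
pose eta n : C := toC (r / 8 / n.+1%:R).
have etaE n : nm (eta n) = r / 8 / n.+1%:R by rewrite nm_toC ger0_norm// !divr_ge0// ltW.
have eta0 n : 0 < nm (eta n) by rewrite etaE !divr_gt0.
have eta1 n : nm (eta n) <= r / 8.
  by rewrite etaE ler_piMr ?divr_ge0 ?invf_le1 ?ltr0n ?ler1n// ltW.
pose D n z := (F (eta n + z) - F z) * (eta n)^-1.
have err n (z : C) : nm z < r / 8 -> nm (D n z - f z) <= M * c ^+ 2 * nm (eta n).
  move=> zr; have [] := loc z _; first by lra.
  move=> _ /(_ (eta n) _); rewrite (le_lt_trans (eta1 n)); last by lra.
  have n0 : eta n != 0 by rewrite -nm_gt0.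
  move=> /(_ isT); have -> : D n z - f z = (F (z + eta n) - F z - f z * eta n) * (eta n)^-1.
    rewrite /D [eta n + z]addrC; move: (F (z + eta n)) => Fz.
    by move: (eta n) n0 => u u0; field.
  by move=> h; rewrite nmM nmV ler_pdivrMr//; apply: le_trans h _; rewrite -[leRHS]mulrA -expr2.
have r80 : 0 < r / 8 by lra.
have K0 : 0 <= M * c ^+ 2 by rewrite mulr_ge0 ?exprn_ge0.
apply: (@T2_uniform_limit _ _ D f 0 (r / 8) (M * c + M * c ^+ 2 * (r / 8))) => //.
- move=> n z; rewrite subr0 => zr; split.
    apply: T2_mul; last exact: T2_const.
    apply: T2_sub; last by apply: TF; lra.
    apply/T2_shift/TF; rewrite (le_lt_trans (nmD _ _))//.
    by have := eta1 n; lra.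
  have z4 : nm z < r / 4 by lra.
  have [h1 _] := loc z z4.
  have := nmD (D n z - f z) (f z); rewrite subrK.
  have := err n z zr; have := ler_wpM2l K0 (eta1 n); lra.
- move=> e e0.
  have [N hN] : exists N : nat, M * c ^+ 2 * (r / 8) / e < N%:R.
    exists (Num.bound (M * c ^+ 2 * (r / 8) / e)); rewrite archi_boundP//.
    by rewrite !(divr_ge0, mulr_ge0, exprn_ge0)// ltW.
  exists N => n z Nn; rewrite subr0 => zr; rewrite (le_trans (err n z zr))// etaE.
  rewrite mulrA ler_pdivrMr ?ltr0n// [e * _]mulrC -ler_pdivrMr// (le_trans (ltW hN))//.
  by rewrite ler_nat (leq_trans Nn).
Qed.

Lemma cdiff_shift f w z : cdiff (fun x => f (w + x)) z <-> cdiff f (w + z).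
Proof.
by split=> -[a ha]; exists a => e /ha[d d0 hd]; exists d => // h /hd; rewrite addrA.
Qed.

(** A primitive of f has second order expansions, and they are inherited by its derivative f. From
    here on differentiability on a disc gives all the estimates above. *)
Lemma derivable_T2 f w r : 0 < r -> (forall z : C, nm (z - w) < r -> derivable f z 1) -> T2 f w.
Proof.
move=> r0 hf; rewrite -[w]addr0; apply/T2_shift.
have [F [s s0 hF]] : exists F : C -> C, exists2 s : R, 0 < s &
    forall z : C, nm z < s -> T2_with F z (f (w + z)).
  apply: (primitive r0) => z zr; apply/cdiff_shift/derivable_cdiff/hf.
  by rewrite addrC addKr.
exact: derivative_T2 s0 hF.
Qed.

Lemma derivable_disc_T2 f w r : (forall z : C, nm (z - w) < r -> derivable f z 1) ->
  forall z : C, nm (z - w) < r -> T2 f z.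
Proof.
move=> hf z zr; apply: (@derivable_T2 _ _ (r - nm (z - w))); first by rewrite subr_gt0.
move=> x xz; apply: hf; have := nmB_tri x z w; lra.
Qed.

Lemma cauchy_taylor f w r M : 0 < r ->
  (forall z : C, nm (z - w) < r -> derivable f z 1) ->
  (forall z : C, nm (z - w) < r -> nm (f z) <= M) ->
  exists a : nat -> C, [/\ a 0%N = f w, forall k, nm (a k) <= M * (8 / r) ^+ k &
    forall h : C, nm h < r -> forall K,
      nm (f (w + h) - \sum_(k < K) a k * h ^+ k) <= M * (8 / r * nm h) ^+ K].
Proof.
move=> r0 hd hM; apply: power_series => // z zr; split; last exact: hM.
exact: (derivable_disc_T2 hd).
Qed.

Lemma cauchy_taylor1 f w r M : 0 < r ->
  (forall z : C, nm (z - w) < r -> derivable f z 1) ->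
  (forall z : C, nm (z - w) < r -> nm (f z) <= M) ->
  nm ('D_1 f w) <= M * (8 / r) /\ forall h : C, nm h < r ->
    nm (f (w + h) - f w - 'D_1 f w * h) <= M * (8 / r) ^+ 2 * nm h ^+ 2.
Proof.
move=> r0 hd hM; apply: T2_taylor1 => // z zr; split; last exact: hM.
exact: (derivable_disc_T2 hd).
Qed.

Lemma cauchy_lip f w r M : 0 < r ->
  (forall z : C, nm (z - w) < r -> derivable f z 1) ->
  (forall z : C, nm (z - w) < r -> nm (f z) <= M) ->
  forall h : C, nm h < r -> nm (f (w + h) - f w) <= M * (8 / r) * nm h.
Proof.
move=> r0 hd hM h hr; have [a [a0 _ /(_ h hr 1%N)]] := cauchy_taylor r0 hd hM.
by rewrite big_ord_recl big_ord0 addr0 a0 expr0 mulr1 expr1 mulrA.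
Qed.

Lemma derivable_uniform_limit (F : nat -> C -> C) f w r M : 0 < r ->
  (forall n (z : C), nm (z - w) < r -> derivable (F n) z 1) ->
  (forall n (z : C), nm (z - w) < r -> nm (F n z) <= M) ->
  (forall e : R, 0 < e -> exists N : nat, forall n (z : C), (N <= n)%N -> nm (z - w) < r ->
    nm (F n z - f z) <= e) ->
  derivable f w 1.
Proof.
move=> r0 hd hM hlim; apply: T2_derivable; apply: (T2_uniform_limit r0 _ hlim) => n z zr.
by split; [exact: (derivable_disc_T2 (hd n))|exact: hM].
Qed.

End Derivable.

(** * Functions of several complex variables *)

Section SeveralVariables.
Variables (R : realType) (C : complex_model R).

Lemma nm_coord (m n : nat) (x : 'M[C]_(m, n)) i j : nm (x i j) <= nm x.
Proof.
apply/ler_addgt0Pr => e e0.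
have : @ball _ 'M[C]_(m, n) 0 (toC (nm x + e)) x.
  by rewrite mx_norm_ball /ball_ /= sub0r normrN normE toC_lt ltrDl.
move=> [_ /(_ i j)]; rewrite -ball_normE /ball_ /= mxE sub0r normrN normE toC_lt.
exact: ltW.
Qed.

Lemma nm_mx_le (m n : nat) (x : 'M[C]_(m, n)) (e : R) : 0 <= e ->
  (forall i j, nm (x i j) <= e) -> nm x <= e.
Proof.
move=> e0 h; have [x0|x0] := eqVneq (mx_norm x) 0.
  by rewrite (mx_norm_eq0 x0) nm0.
have [[i j] /= E] := mx_norm_neq0 x0.
by rewrite -(toC_le C) -normE [`|x|]E normE toC_le.
Qed.

Lemma is_derive_mxP (V : normedModType C) (m n : nat) (f : V -> 'M[C]_(m, n)) (x v : V)
    (a : 'M[C]_(m, n)) :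
  is_derive x v f a <-> forall i j, is_derive x v (fun y => f y i j) (a i j).
Proof.
split=> [/is_derive_nmP h i j|h].
  apply/is_derive_nmP => e /h[d d0 hd]; exists d => // k /hd.
  by apply: le_trans; have := nm_coord (f (x + k *: v) - f x - k *: a) i j; rewrite !mxE.
apply/is_derive_nmP => e e0.
have /choice[d hd] (ij : 'I_m * 'I_n) : exists d : R, 0 < d /\
    forall k : C, nm k < d -> nm (f (x + k *: v) ij.1 ij.2 - f x ij.1 ij.2 - k *: a ij.1 ij.2) <= e * nm k.
  by have /is_derive_nmP/(_ e e0)[d d0 hd] := h ij.1 ij.2; exists d.
exists (\big[Num.min/1]_ij d ij).
  by apply: lt_bigmin => // ij _; have [] := hd ij.
move=> k hk; apply: nm_mx_le; first by rewrite mulr_ge0 ?nm_ge0// ltW.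
move=> i j; rewrite !mxE; apply: (hd (i, j)).2.
by apply: lt_le_trans hk _; exact: bigmin_le.
Qed.

Lemma derivable_mx_coord (V : normedModType C) (m n : nat) (f : V -> 'M[C]_(m, n)) (x v : V) :
  derivable f x v <-> forall i j, derivable (fun y => f y i j) x v.
Proof.
split=> [/derivableP/is_derive_mxP h i j|h]; first by have [] := h i j.
have : is_derive x v f (\matrix_(i, j) 'D_v (fun y => f y i j) x).
  by apply/is_derive_mxP => i j; rewrite mxE; exact/derivableP.
by case.
Qed.

Lemma differentiable_nm (V W : normedModType C) (f : V -> W) (x : V) :
  differentiable f x -> forall e : R, 0 < e -> exists2 d : R, 0 < d &
    forall h : V, nm h < d -> nm (f (x + h) - f x - 'd f x h) <= e * nm h.
Proof.
move=> /diff_locallyxC/eqaddoEx/funext/eqaddoP h e e0.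
have ep : 0 < toC e :> C by rewrite -(toC0 C) toC_lt.
have /nm_nbhsP[d d0 hd] := h _ ep.
exists d => // k kd; have := hd k; rewrite subr0 => /(_ kd).
by rewrite !normE -toCM toC_le /= opprD addrA.
Qed.

Lemma derivable_comp_diff (V W : normedModType C) (F : V -> W) (g : C -> V) (z : C) :
  derivable g z 1 -> differentiable F (g z) -> derivable (F \o g) z 1.
Proof.
move=> /derivable1_diffP dg dF; apply/derivable1_diffP.
exact: differentiable_comp.
Qed.

Lemma derivable_continuous (V : normedModType C) (g : C -> V) (z : C) :
  derivable g z 1 -> {for z, continuous g}.
Proof. by move=> /derivable1_diffP/differentiable_continuous. Qed.

Lemma locally_bounded (V : normedModType C) (F : V -> C) (x : V) :
  {for x, continuous F} -> exists2 d : R, 0 < d &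
    forall y : V, nm (y - x) < d -> nm (F y) <= nm (F x) + 1.
Proof.
move=> /nm_contP/(_ 1 ltr01)[d d0 hd]; exists d => // y /hd h.
by have := nmD (F y - F x) (F x); rewrite subrK; lra.
Qed.

(** The quotients (G z eta_n - G z 0)/eta_n are holomorphic in z, and the Cauchy estimate in h makes
    them converge to the partial derivative uniformly in z. *)
Lemma derivable_partial (G : C -> C -> C) (w : C) (rho s M : R) : 0 < rho -> 0 < s ->
  (forall z h : C, nm (z - w) < rho -> nm h < s ->
    [/\ derivable (G ^~ h) z 1, derivable (G z) h 1 & nm (G z h) <= M]) ->
  derivable (fun z => 'D_1 (G z) 0) w 1.
Proof.
move=> rho0 s0 hG.
have M0 : 0 <= M.
  by have [||_ _] := hG w 0 _ _; rewrite ?subrr ?nm0//; apply: le_trans; exact: nm_ge0.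
have loc (z : C) : nm (z - w) < rho -> nm ('D_1 (G z) 0) <= M * (8 / s) /\
    forall h : C, nm h < s -> nm (G z h - G z 0 - 'D_1 (G z) 0 * h) <= M * (8 / s) ^+ 2 * nm h ^+ 2.
  move=> zw; have h1 (h : C) : nm (h - 0) < s -> derivable (G z) h 1.
    by rewrite subr0 => hs; have [] := hG z h zw hs.
  have h2 (h : C) : nm (h - 0) < s -> nm (G z h) <= M.
    by rewrite subr0 => hs; have [] := hG z h zw hs.
  have [h3 h4] := cauchy_taylor1 s0 h1 h2; split=> // h hs.
  by have := h4 h hs; rewrite add0r.
have c0 : 0 <= 8 / s by rewrite divr_ge0// ltW.
set c := 8 / s in loc c0.
pose eta n : C := toC (s / 2 / n.+1%:R).
have etaE n : nm (eta n) = s / 2 / n.+1%:R by rewrite nm_toC ger0_norm// !divr_ge0// ltW.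
have eta0 n : 0 < nm (eta n) by rewrite etaE !divr_gt0.
have eta1 n : nm (eta n) <= s / 2.
  by rewrite etaE ler_piMr ?divr_ge0 ?invf_le1 ?ltr0n ?ler1n// ltW.
have etas n : nm (eta n) < s by have := eta1 n; lra.
pose D n z := (G z (eta n) - G z 0) * (eta n)^-1.
have K0 : 0 <= M * c ^+ 2 by rewrite mulr_ge0 ?exprn_ge0.
have err n (z : C) : nm (z - w) < rho -> nm (D n z - 'D_1 (G z) 0) <= M * c ^+ 2 * nm (eta n).
  move=> zr; have [_ /(_ _ (etas n))] := loc z zr.
  have n0 : eta n != 0 by rewrite -nm_gt0.
  have -> : D n z - 'D_1 (G z) 0 = (G z (eta n) - G z 0 - 'D_1 (G z) 0 * eta n) * (eta n)^-1.
    rewrite /D; move: (G z (eta n)) => Fz.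
    by move: (eta n) n0 => u u0; field.
  by move=> h; rewrite nmM nmV ler_pdivrMr//; apply: le_trans h _; rewrite -[leRHS]mulrA -expr2.
have s00 : nm (0 : C) < s by rewrite nm0.
apply: (@derivable_uniform_limit _ _ D _ w rho (M * c + M * c ^+ 2 * (s / 2))) => //.
- move=> n z zr.
  have [d1 _ _] := hG z _ zr (etas n); have [d2 _ _] := hG z _ zr s00.
  exact: (derivableM (derivableB d1 d2) (derivable_cst (eta n)^-1 z 1)).
- move=> n z zr; have [h1 _] := loc z zr.
  have := nmD (D n z - 'D_1 (G z) 0) ('D_1 (G z) 0); rewrite subrK.
  have := err n z zr; have := ler_wpM2l K0 (eta1 n); lra.
- move=> e e0.
  have [N hN] : exists N : nat, M * c ^+ 2 * (s / 2) / e < N%:R.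
    exists (Num.bound (M * c ^+ 2 * (s / 2) / e)); rewrite archi_boundP//.
    by rewrite !(divr_ge0, mulr_ge0, exprn_ge0)// ltW.
  exists N => n z Nn zr; rewrite (le_trans (err n z zr))// etaE.
  rewrite mulrA ler_pdivrMr ?ltr0n// [e * _]mulrC -ler_pdivrMr// (le_trans (ltW hN))//.
  by rewrite ler_nat (leq_trans Nn).
Qed.

(** Apply [derivable_partial] to (z, h) -> F(g z + h v). This makes the gradients of the relations,
    and so the matrix V_w, holomorphic along curves. *)
Lemma derivable_dderive (V : normedModType C) (F : V -> C) (A : set V) (g : C -> V)
    (w : C) (rho : R) (v : V) : open A -> (forall x, A x -> differentiable F x) ->
  0 < rho -> (forall z : C, nm (z - w) < rho -> derivable g z 1) -> A (g w) ->
  derivable (fun z => 'D_v F (g z)) w 1.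
Proof.
move=> oA dF rho0 dg Agw.
have [d1 d10 hd1] : exists2 d : R, 0 < d & forall y : V, nm (y - g w) < d -> A y.
  exact/nm_nbhsP/open_nbhs_nbhs.
have [d2 d20 hd2] := locally_bounded (differentiable_continuous (dF _ Agw)).
pose d := Num.min d1 d2; have d0 : 0 < d by rewrite lt_min d10.
have dw : derivable g w 1 by apply: dg; rewrite subrr nm0.
have d20' : 0 < d / 2 by lra.
have [r1 r10 hr1] := (nm_contP _ _).1 (derivable_continuous dw) _ d20'.
pose s := d / 2 / (nm v + 1).
have v1 : 0 < nm v + 1 by rewrite ltr_wpDl ?nm_ge0.
have s0 : 0 < s by rewrite divr_gt0.
have inb (z h : C) : nm (z - w) < r1 -> nm h < s -> nm (g z + h *: v - g w) < d.
  move=> zr hs; rewrite addrAC (le_lt_trans (nmD _ _))// nmZ.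
  have := hr1 z zr; move: hs; rewrite /s ltr_pdivlMr//.
  have := nm_ge0 h; have := nm_ge0 v; nra.
(* The two functions must agree at every z, even where F has no derivative: there both sides are
   limits of the same quotient. *)
have -> : (fun z => 'D_v F (g z)) = fun z => 'D_1 (fun h : C => F (g z + h *: v)) 0.
  apply/funext => z.
  have [hz|hz] := pselect (derivable F (g z) v).
    by have [_ ->] := (derive_lineE F (g z) v _).1 (derivableP hz).
  have hz' : ~ derivable (fun h : C => F (g z + h *: v)) 0 1.
    by move=> /derivableP h; have [] := (derive_lineE F (g z) v _).2 h.
  congr (lim (_ @ 0^')); apply/funext => h /=.
  by rewrite addr0 scale0r addr0 [h *: 1]mulr1 [g z + h *: v]addrC.
apply: (@derivable_partial _ w (Num.min rho r1) s (nm (F (g w)) + 1)) => //.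
  by rewrite lt_min rho0.
move=> z h; rewrite lt_min => /andP[zr zr1] hs.
have hb := inb z h zr1 hs.
have dFx : differentiable F (g z + h *: v).
  by apply/dF/hd1; rewrite (lt_le_trans hb)// ge_min lexx.
split; last by apply: hd2; rewrite (lt_le_trans hb)// ge_min lexx orbT.
- apply: (@derivable_comp_diff _ _ F (fun z => g z + h *: v)) => //.
  by apply: derivableD; [exact: dg|exact: derivable_cst].
- apply: (@derivable_comp_diff _ _ F (fun h => g z + h *: v)) => //.
  apply: derivableD; first exact: derivable_cst.
  apply/derivable1_diffP; exact: differentiableZl.
Qed.

(** Differentiability at x0 bounds phi, the first order remainder of F at x0, by (e/16) 4d on the
    ball of radius 4d. On the complex line through x and y that ball contains a disc of parameter
    radius s = 3d/|x - y|, and the one variable Lipschitz estimate turns the bound into one for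
    phi(x) - phi(y). *)
Lemma strict_differentiable (V : normedModType C) (F : V -> C) (x0 : V) (r : R) : 0 < r ->
  (forall x, nm (x - x0) < r -> differentiable F x) ->
  forall e : R, 0 < e -> exists2 d : R, 0 < d & forall x y, nm (x - x0) < d -> nm (y - x0) < d ->
    nm (F x - F y - 'd F x0 (x - y)) <= e * nm (x - y).
Proof.
move=> r0 dF e e0.
have dF0 : differentiable F x0 by apply: dF; rewrite subrr nm0.
(* The final constant is (e/16) (4d) (8/s) = (2/3) e |x - y|. *)
have e160 : 0 < e / 16 by lra.
have [d1 d10 hd1] := differentiable_nm dF0 e160.
pose d := Num.min r d1 / 4.
have d0 : 0 < d by rewrite divr_gt0// lt_min r0.
have dr : 4 * d <= r.
  have h : Num.min r d1 <= r by rewrite ge_min lexx.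
  by rewrite /d; lra.
have dd1 : 4 * d <= d1.
  have h : Num.min r d1 <= d1 by rewrite ge_min lexx orbT.
  by rewrite /d; lra.
exists d => // x y xd yd.
have [->|xy] := eqVneq x y; first by rewrite !subrr linear0 subr0 !nm0 mulr0.
pose u := x - y.
have u0 : 0 < nm u by rewrite nm_gt0 subr_eq0.
have u2 : nm u < 2 * d by have := nmB_tri x x0 y; rewrite (nmBC x0); lra.
pose phi z := F z - 'd F x0 (z - x0) - F x0.
have phiM (z : V) : nm (z - x0) < 4 * d -> nm (phi z) <= e / 16 * (4 * d).
  move=> zd; have := hd1 (z - x0) (lt_le_trans zd dd1).
  rewrite [x0 + _]addrC subrK addrAC => h; apply: le_trans h _.
  by rewrite ler_pM2l// ltW.
pose s := 3 * d / nm u.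
have s0 : 0 < s by rewrite divr_gt0// mulr_gt0.
have inb (t : C) : nm (t - 0) < s -> nm (y + t *: u - x0) < 4 * d.
  rewrite subr0 ltr_pdivlMr// => ts.
  by rewrite addrAC (le_lt_trans (nmD _ _))// nmZ; lra.
pose g (t : C) := phi (y + t *: u).
have dg (t : C) : nm (t - 0) < s -> derivable g t 1.
  move=> /inb hb.
  have dl : derivable (fun t : C => y + t *: u) t 1.
    apply: derivableD; first exact: derivable_cst.
    apply/derivable1_diffP; exact: differentiableZl.
  apply: (@derivable_comp_diff _ _ phi) => //.
  apply: differentiableB; last exact: differentiable_cst.
  apply: differentiableB; first by apply: dF; lra.
  apply: (@differentiable_comp _ _ _ _ (fun z => z - x0) ('d F x0)).
    by apply: differentiableB; [exact: ex_diff|exact: differentiable_cst].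
  by apply: linear_differentiable; exact: diff_continuous.
have gM (t : C) : nm (t - 0) < s -> nm (g t) <= e / 16 * (4 * d).
  by move=> /inb; exact: phiM.
have s1 : nm (1 : C) < s by rewrite nm1 /s ltr_pdivlMr// mul1r; lra.
have := cauchy_lip s0 dg gM s1.
rewrite add0r nm1 mulr1 /g scale1r scale0r addr0 [y + _]addrC subrK /phi.
rewrite (_ : _ - _ - F x0 - _ = F x - F y - 'd F x0 (x - y)); last first.
  have -> : x - y = (x - x0) - (y - x0) by rewrite opprB addrA subrK.
  by rewrite linearB; ring.
move=> h; apply: (le_trans h).
have E (D N : R) : 0 < D -> 0 < N -> e / 16 * (4 * D) * (8 / (3 * D / N)) = e * (2 / 3) * N.
  by move=> D0 N0; field; rewrite !gt_eqF.
rewrite /s E// -/u.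
by rewrite ler_wpM2r ?nm_ge0// ler_piMr ?ltW//; lra.
Qed.

End SeveralVariables.

(** * Implicit curves *)

Section Picard.
Variables (R : realType) (C : complex_model R) (m : nat).

(** The iterates of x -> Psi x + s u from x0 are holomorphic in s and converge uniformly, so their
    limit is holomorphic in s. For real s they remain real, and so does the limit. *)
Lemma picard (Psi : 'rV[C]_m -> 'rV[C]_m) (x0 u : 'rV[C]_m) (r : R) :
  0 < r -> (forall x, nm (x - x0) < r -> differentiable Psi x) ->
  (forall x y, nm (x - x0) < r -> nm (y - x0) < r ->
    nm (Psi x - Psi y) <= nm (x - y) / 2) ->
  Psi x0 = x0 ->
  (forall j, imC (x0 0 j) = 0) -> (forall j, imC (u 0 j) = 0) ->
  (forall x, nm (x - x0) < r -> (forall j, imC (x 0 j) = 0) ->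
    forall j, imC (Psi x 0 j) = 0) ->
  exists g : C -> 'rV[C]_m, exists2 d : R, 0 < d & forall s : C, nm s < d ->
    [/\ nm (g s - x0) < r, g s = Psi (g s) + s *: u, derivable g s 1 &
        imC s = 0 -> forall j, imC (g s 0 j) = 0].
Proof.
move=> r0 dPsi lip fix0 rx0 ru rPsi.
pose T (s : C) x := Psi x + s *: u.
pose it n s := iter n (T s) x0.
have itS n s : it n.+1 s = Psi (it n s) + s *: u by [].
(* For |s| < d the increments are at most |s| |u| / 2^n, so the iterates stay within 2 |s| |u| < r/2
   of x0, inside the ball where Psi contracts. *)
pose d := r / (4 * (nm u + 1)).
have u1 : 0 < nm u + 1 by rewrite ltr_wpDl ?nm_ge0.
have d0 : 0 < d by rewrite divr_gt0// mulr_gt0.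
pose B (s : C) := nm s * nm u.
have B0 s : 0 <= B s by rewrite mulr_ge0 ?nm_ge0.
have Br s : nm s < d -> 4 * B s < r.
  rewrite /d ltr_pdivlMr ?mulr_gt0// /B => h.
  have := nm_ge0 s; have := nm_ge0 u; lra.
have p2 n : 0 < 2 ^+ n :> R by rewrite exprn_gt0.
have pS n : (2 ^+ n.+1)^-1 = (2 ^+ n)^-1 / 2 :> R by rewrite exprSr invfM mulrC.
have near0 s n : nm s < d -> nm (it n s - x0) <= 2 * B s * (1 - (2 ^+ n)^-1) /\
    nm (it n.+1 s - it n s) <= B s * (2 ^+ n)^-1.
  move=> sd; have Bs := Br s sd; elim: n => [|n [ih1 ih2]].
    by rewrite subrr nm0 invr1 subrr mulr0 itS fix0 addrAC subrr add0r nmZ mulr1 /B.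
  have pn : 0 < (2 ^+ n)^-1 :> R by rewrite invr_gt0.
  have h1 : nm (it n.+1 s - x0) <= 2 * B s * (1 - (2 ^+ n.+1)^-1).
    have := nmB_tri (it n.+1 s) (it n s) x0; rewrite pS; lra.
  split=> //; rewrite itS [X in _ - X]itS opprD addrACA subrr addr0.
  have inb k : 2 * B s * (1 - (2 ^+ k)^-1) < r.
    have : 0 <= B s * (2 ^+ k)^-1 by rewrite mulr_ge0// ltW// invr_gt0.
    lra.
  have := lip _ _ (le_lt_trans h1 (inb _)) (le_lt_trans ih1 (inb _)).
  rewrite pS; lra.
have itr s n : nm s < d -> nm (it n s - x0) <= 2 * B s.
  move=> sd; have [h _] := near0 s n sd; apply: le_trans h _.
  have pn : 0 < (2 ^+ n)^-1 :> R by rewrite invr_gt0.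
  by have := mulr_ge0 (B0 s) (ltW pn); lra.
have itb s n : nm s < d -> nm (it n s - x0) < r.
  by move=> sd; have := itr s n sd; have := Br s sd; have := B0 s; lra.
have cau s n k : nm s < d -> nm (it (n + k)%N s - it n s) <= 2 * B s * ((2 ^+ n)^-1 - (2 ^+ (n + k))^-1).
  move=> sd; elim: k => [|k ih]; first by rewrite addn0 !subrr nm0 mulr0.
  have [_ h] := near0 s (n + k)%N sd.
  rewrite addnS pS; have := nmB_tri (it (n + k).+1 s) (it (n + k)%N s) (it n s); lra.
have {}cau s n k : nm s < d -> (n <= k)%N -> nm (it k s - it n s) <= 2 * B s * (2 ^+ n)^-1.
  move=> sd nk; have := cau s n (k - n)%N sd; rewrite subnKC// => h; apply: le_trans h _.
  have pn : 0 < (2 ^+ k)^-1 :> R by rewrite invr_gt0.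
  by have := mulr_ge0 (B0 s) (ltW pn); lra.
have small (e K : R) : 0 < e -> 0 <= K -> exists N, forall n, (N <= n)%N -> K * (2 ^+ n)^-1 <= e.
  move=> e0 K0; exists (Num.bound (K / e)) => n Nn.
  rewrite ler_pdivrMr// mulrC -ler_pdivrMr//.
  have := archi_boundP (divr_ge0 K0 (ltW e0)) => h; rewrite (le_trans (ltW h))//.
  by rewrite -natrX ler_nat (leq_trans Nn)// ltnW// ltn_expl.
have /choice[g hg] (s : C) : exists x : 'rV[C]_m, nm s < d ->
    forall n, nm (it n s - x) <= 2 * B s * (2 ^+ n)^-1.
  have [sd|sd] := ltP (nm s) d; last by exists 0.
  have /choice[l hl] j : exists l : C, (fun n => it n s 0 j) @ \oo --> l.
    apply: C_complete => e e0; have e20 : 0 < e / 2 by lra.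
    have [N hN] := small (e / 2) (2 * B s) e20 (mulr_ge0 (ler0n _ _) (B0 s)).
    exists N => a b Na Nb.
    have ha := cau s N a sd Na; have hb := cau s N b sd Nb; have hh := hN N (leqnn _).
    have := nm_coord (it a s - it b s) 0 j; rewrite !mxE => h; apply: le_trans h _.
    by have := nmB_tri (it a s) (it N s) (it b s); rewrite (nmBC (it N s)); lra.
  exists (\row_j l j) => _ n; apply: nm_mx_le.
    apply: mulr_ge0; first by rewrite mulr_ge0.
    by rewrite invr_ge0 ltW.
  move=> i j; rewrite !mxE (ord1 i); apply/ler_addgt0Pr => e e0.
  move/nm_cvgP/(_ _ e0) : (hl j) => -[N _ hN].
  have {}hN := hN (maxn N n) (leq_maxl _ _).
  have h2 := cau s n (maxn N n) sd (leq_maxr _ _).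
  have h3 := nm_coord (it (maxn N n) s - it n s) 0 j; rewrite !mxE in h3.
  have := nmB_tri (it n s 0 j) (it (maxn N n) s 0 j) (l j).
  rewrite (nmBC (it n s 0 j) (it _ _ _ _)).
  by rewrite /= in hN; lra.
have gr s : nm s < d -> nm (g s - x0) < r.
  move=> sd; have h1 := hg s sd 0%N; rewrite expr0 invr1 mulr1 /= nmBC in h1.
  by have := Br s sd; have := B0 s; lra.
exists g, d => // s sd; split.
- exact: gr.
- apply/eqP; rewrite -subr_eq0 -nm_eq0 eq_le nm_ge0 andbT; apply/ler_addgt0Pr => e e0.
  have e20 : 0 < e / 2 by lra.
  have [N hN] := small (e / 2) (2 * B s) e20 (mulr_ge0 (ler0n _ _) (B0 s)).
  have {}hN := hN N (leqnn _).
  have h1 := hg s sd N; have h2 := hg s sd N.+1.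
  have h3 := lip _ _ (gr s sd) (itb s N sd).
  rewrite itS in h2; rewrite (nmBC (g s)) (nmBC (Psi (g s))) in h3.
  have t := nmB_tri (g s) (Psi (it N s) + s *: u) (Psi (g s) + s *: u).
  have E : Psi (it N s) + s *: u - (Psi (g s) + s *: u) = Psi (it N s) - Psi (g s).
    by rewrite opprD addrACA subrr addr0.
  rewrite E (nmBC (g s) (Psi (it N s) + _)) in t; rewrite add0r.
  have : 2 * B s * (2 ^+ N.+1)^-1 <= 2 * B s * (2 ^+ N)^-1.
    have pn : 0 < (2 ^+ N)^-1 :> R by rewrite invr_gt0.
    by rewrite pS; have := mulr_ge0 (B0 s) (ltW pn); lra.
  have := nm_ge0 (it N s - g s); lra.
- have dit n (z : C) : nm z < d -> derivable (it n) z 1.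
    move=> zd; elim: n => [|n ih].
      have -> : it 0%N = cst x0 by [].
      exact: derivable_cst.
    have -> : it n.+1 = (Psi \o it n) + (fun s => s *: u) by [].
    apply: derivableD; last by apply/derivable1_diffP; exact: differentiableZl.
    by apply: derivable_comp_diff => //; apply: dPsi; exact: itb.
  apply/derivable_mx_coord => i j; rewrite (ord1 i).
  pose rho := d - nm s.
  have rho0 : 0 < rho by rewrite subr_gt0.
  have zd (z : C) : nm (z - s) < rho -> nm z < d.
    by rewrite /rho => h; have := nmD (z - s) s; rewrite subrK; lra.
  apply: (@derivable_uniform_limit _ _ (fun n z => it n z 0 j) _ s rho (nm x0 + r)) => //.
  + by move=> n z /zd/(dit n)/derivable_mx_coord.
  + move=> n z /zd zd'; rewrite (le_trans (nm_coord _ _ _))//.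
    have := nmD (it n z - x0) x0; rewrite subrK; have := itb z n zd'; lra.
  + move=> e e0; have [N hN] := small e (2 * r) e0 (mulr_ge0 (ler0n _ _) (ltW r0)).
    exists N => n z Nn /zd zd'; have h := hN n Nn.
    have := nm_coord (it n z - g z) 0 j; rewrite !mxE => h1; apply: le_trans h1 _.
    apply: le_trans (hg z zd' n) _; apply: le_trans h.
    have pn : 0 < (2 ^+ n)^-1 :> R by rewrite invr_gt0.
    by rewrite ler_pM2r//; have := Br z zd'; have := B0 z; lra.
- move=> rs j.
  have rit n : forall j, imC (it n s 0 j) = 0.
    elim: n => [//|n ih] k; rewrite itS !mxE imD imM rs ru !(mulr0, mul0r) !addr0.
    by apply: rPsi => //; exact: itb.
  apply/eqP; rewrite -normr_eq0 eq_le normr_ge0 andbT; apply/ler_addgt0Pr => e e0.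
  have [N hN] := small e (2 * B s) e0 (mulr_ge0 (ler0n _ _) (B0 s)).
  have := hg s sd N; have := hN N (leqnn _); have := nm_coord (it N s - g s) 0 j.
  rewrite !mxE; have := Im_le (it N s 0 j - g s 0 j); rewrite imB rit sub0r normrN; lra.
Qed.

End Picard.

(** * Real analytic maps and their holomorphic extensions *)

Section Analytic.
Variables (R : realType) (C : complex_model R).

Definition vecC (n : nat) (x : 'rV[R]_n) : 'rV[C]_n := map_mx toC x.
Definition vecR (n : nat) (x : 'rV[C]_n) : 'rV[R]_n := map_mx (@reC R C) x.

Lemma vecCK n : cancel (@vecC n) (@vecR n).
Proof. by move=> x; apply/rowP => j; rewrite !mxE re_toC. Qed.

Lemma vecRK n (x : 'rV[C]_n) : (forall j, imC (x 0 j) = 0) -> vecC (vecR x) = x.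
Proof.
by move=> h; apply/rowP => j; rewrite !mxE; apply: C_ext; rewrite ?re_toC ?im_toC ?h.
Qed.

Lemma vecC_real n (x : 'rV[R]_n) j : imC (vecC x 0 j) = 0.
Proof. by rewrite mxE im_toC. Qed.

Lemma vecCB n (x y : 'rV[R]_n) : vecC (x - y) = vecC x - vecC y.
Proof. by apply/rowP => j; rewrite !mxE toCB. Qed.

Lemma norm_coord (n : nat) (x : 'rV[R]_n) j : `|x 0 j| <= `|x|.
Proof.
apply/ler_addgt0Pr => e e0.
have : @ball _ 'rV[R]_n 0 (`|x| + e) x.
  by rewrite mx_norm_ball /ball_ /= sub0r normrN ltrDl.
move=> [_ /(_ 0 j)]; rewrite -ball_normE /ball_ /= mxE sub0r normrN.
exact: ltW.
Qed.

Lemma norm_rV_le (n : nat) (x : 'rV[R]_n) (e : R) : 0 <= e ->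
  (forall j, `|x 0 j| <= e) -> `|x| <= e.
Proof.
move=> e0 h; have [x0|x0] := eqVneq (mx_norm x) 0.
  by rewrite (mx_norm_eq0 x0) normr0.
have [[i j] /= E] := mx_norm_neq0 x0.
by rewrite [`|x|]E (ord1 i).
Qed.

Lemma nm_vecC n (x : 'rV[R]_n) : nm (vecC x) = `|x|.
Proof.
apply/eqP; rewrite eq_le; apply/andP; split.
  by apply: nm_mx_le => // i j; rewrite mxE (ord1 i) nm_toC norm_coord.
apply: norm_rV_le; first exact: nm_ge0.
by move=> j; have := nm_coord (vecC x) 0 j; rewrite mxE nm_toC.
Qed.

Lemma geometric_small (K q e : R) : 0 <= K -> 0 <= q -> q < 1 -> 0 < e ->
  exists N, forall n, (N <= n)%N -> K * q ^+ n < e.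
Proof.
move=> K0 q0 q1 e0; have q1' : `|q| < 1 by rewrite ger0_norm.
have K1 : 0 < K + 1 by rewrite ltr_wpDl.
have /cvgrPdist_lt/(_ _ (divr_gt0 e0 K1))[N _ hN] := cvg_expr q1'.
exists N => n Nn; have := hN n Nn; rewrite /= sub0r normrN ger0_norm ?exprn_ge0//.
rewrite ltr_pdivlMr//; have := exprn_ge0 n q0; nra.
Qed.

(** At a real base point and for real increments, the real parts of the complex Taylor coefficients
    are the coefficients of the real part. *)
Lemma analytic_of_derivable (m : nat) (f : C -> 'rV[C]_m.+1) (s : R) (r : R) : 0 < r ->
  (forall z : C, nm (z - toC s) < r -> derivable f z 1) ->
  real_analytic_at (fun u => vecR (f (toC u))) s.
Proof.
move=> r0 df.
have dfs : derivable f (toC s) 1 by apply: df; rewrite subrr nm0.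
have [d1 d10 hd1] := (nm_contP _ _).1 (derivable_continuous dfs) 1 ltr01.
pose d := Num.min r d1.
have d0 : 0 < d by rewrite lt_min r0.
pose M := nm (f (toC s)) + 1.
have M0 : 0 <= M by rewrite addr_ge0 ?nm_ge0.
have /choice[a ha] (j : 'I_m.+1) : exists a : nat -> C, forall h : C, nm h < d -> forall K,
    nm (f (toC s + h) 0 j - \sum_(k < K) a k * h ^+ k) <= M * (8 / d * nm h) ^+ K.
  have [||a [_ _ h]] := @cauchy_taylor _ _ (fun z => f z 0 j) (toC s) d M d0.
  - move=> z; rewrite lt_min => /andP[zr _].
    by have /derivable_mx_coord := df z zr; exact.
  - move=> z; rewrite lt_min => /andP[_ zr]; rewrite (le_trans (nm_coord _ _ _))//.
    by have := nmD (f z - f (toC s)) (f (toC s)); rewrite subrK /M; have := hd1 z zr; lra.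
  by exists a.
(* The Taylor estimate is useful only for |h| < d/8. *)
exists (fun k => \row_j reC (a j k)), (d / 16); split; first by rewrite divr_gt0.
move=> u us; apply/cvgrPdist_lt => e e0.
have hu : nm (toC u - toC s : C) = `|u - s| by rewrite -toCB nm_toC.
have ud : `|u - s| < d by lra.
have q1 : 8 / d * `|u - s| < 1.
  by rewrite mulrAC ltr_pdivrMr// mul1r; lra.
have q0 : 0 <= 8 / d * `|u - s| by rewrite mulr_ge0// divr_ge0// ltW.
have e20 : 0 < e / 2 by lra.
have [N hN] := geometric_small M0 q0 q1 e20.
exists N => // K NK; apply: (@le_lt_trans _ _ (e / 2)); last by lra.
apply: norm_rV_le; first by lra.
move=> j; rewrite !mxE summxE.
have := ha j (toC u - toC s); rewrite hu => /(_ ud K); rewrite [toC s + _]addrC subrK => h.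
apply: le_trans (ltW (hN K NK)); apply: le_trans h; apply: le_trans (Re_le _).
rewrite reB big_mkord le_eqVlt; apply/orP; left; apply/eqP; congr (`|_ - _|).
rewrite (big_morph (@reC R C) (@reD R C) (re0 C)); apply: eq_bigr => k _.
by rewrite !mxE -toCB -rmorphXn /= [_ * toC _]mulrC reM_toC.
Qed.

(** Convergence at s + e/2 bounds |a_k| (e/2)^k. On the complex disc of radius e/4 the terms are
    then dominated by M/2^k, and the polynomial partial sums converge uniformly. *)
Lemma power_series_derivable (a : nat -> R) (s e : R) (f : R -> R) : 0 < e ->
  (forall u, `|u - s| < e -> series (fun k => (u - s) ^+ k * a k) @ \oo --> f u) ->
  exists g : C -> C, forall z : C, nm (z - toC s) < e / 4 ->
    derivable g z 1 /\ (forall u, z = toC u -> g z = toC (f u)).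
Proof.
move=> e0 hf.
pose b := e / 2.
have b0 : 0 < b by rewrite divr_gt0.
have [M M0 hM] : exists2 M : R, 0 <= M & forall k, `|a k| * b ^+ k <= M.
  have hb : `|s + b - s| < e by rewrite addrAC subrr add0r gtr0_norm// /b; lra.
  have cv := hf _ hb.
  have c0 : (fun k => (s + b - s) ^+ k * a k) @ \oo --> 0.
    by apply: cvg_series_cvg_0; apply/cvg_ex; exists (f (s + b)).
  have [M [_ hM]] := cvg_seq_bounded (cvgP _ c0).
  exists (Num.max 0 (M + 1)); first by rewrite le_max lexx.
  have M1 : M < M + 1 by rewrite ltrDl.
  move=> k; have /(_ k) := hM (M + 1) M1.
  have -> : s + b - s = b by rewrite addrAC subrr add0r.
  by rewrite /= normrM normrX (gtr0_norm b0) mulrC le_max => ->//; rewrite orbT.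
pose P n (z : C) := \sum_(k < n) toC (a k) * (z - toC s) ^+ k.
have term k (z : C) : nm (z - toC s) < e / 4 -> nm (toC (a k) * (z - toC s) ^+ k) <= M * (1 / 2) ^+ k.
  move=> zs; rewrite nmM nmX nm_toC.
  have h1 : nm (z - toC s) ^+ k <= (b * (1 / 2)) ^+ k.
    by rewrite lerXn2r ?nnegrE ?nm_ge0 ?mulr_ge0 ?divr_ge0// ?ltW// /b; lra.
  rewrite (le_trans (ler_wpM2l (normr_ge0 _) h1))// exprMn mulrA ler_wpM2r ?exprn_ge0//.
have tail n k (z : C) : nm (z - toC s) < e / 4 -> nm (P (n + k)%N z - P n z) <=
    2 * M * ((1 / 2) ^+ n - (1 / 2) ^+ (n + k)).
  move=> zs; elim: k => [|k ih]; first by rewrite addn0 !subrr nm0 mulr0.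
  rewrite addnS; have -> : P (n + k).+1 z = P (n + k)%N z + toC (a (n + k)%N) * (z - toC s) ^+ (n + k).
    by rewrite /P big_ord_recr.
  rewrite addrAC (le_trans (nmD _ _))// exprS; have := term (n + k)%N z zs; lra.
have h12 n : 0 <= (1 / 2) ^+ n :> R by rewrite exprn_ge0.
have {}tail n k (z : C) : nm (z - toC s) < e / 4 -> (n <= k)%N ->
    nm (P k z - P n z) <= 2 * M * (1 / 2) ^+ n.
  move=> zs nk; have := tail n (k - n)%N z zs; rewrite subnKC//.
  have := mulr_ge0 M0 (h12 k); lra.
have M20 : 0 <= 2 * M by rewrite mulr_ge0.
have half1 : 1 / 2 < 1 :> R by lra.
have half0 : 0 <= 1 / 2 :> R by lra.
have /choice[g hg] (z : C) : exists l : C, nm (z - toC s) < e / 4 -> (fun n => P n z) @ \oo --> l.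
  have [zs|zs] := ltP (nm (z - toC s)) (e / 4); last by exists 0.
  suff [l hl] : exists l : C, (fun n => P n z) @ \oo --> l by exists l.
  apply: C_complete => t t0; have t20 : 0 < t / 2 by lra.
  have [N hN] := geometric_small M20 half0 half1 t20.
  exists N => p q Np Nq; have hh := hN N (leqnn _).
  have h1 := tail N p z zs Np; have h2 := tail N q z zs Nq.
  by have := nmB_tri (P p z) (P N z) (P q z); rewrite (nmBC (P N z)); lra.
have lim_est (z : C) n : nm (z - toC s) < e / 4 -> nm (P n z - g z) <= 2 * M * (1 / 2) ^+ n.
  move=> zs; apply/ler_addgt0Pr => t t0.
  have /nm_cvgP/(_ _ t0)[N _ hN] := hg z zs.
  have {}hN := hN (maxn N n) (leq_maxl _ _); rewrite /= in hN.
  have h := tail n (maxn N n) z zs (leq_maxr _ _).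
  by have := nmB_tri (P n z) (P (maxn N n) z) (g z); rewrite (nmBC (P n z) (P _ _)); lra.
exists g => z zs; split.
- pose rho := e / 4 - nm (z - toC s).
  have rho0 : 0 < rho by rewrite subr_gt0.
  have zr (x : C) : nm (x - z) < rho -> nm (x - toC s) < e / 4.
    by rewrite /rho; have := nmB_tri x z (toC s); lra.
  apply: (@derivable_uniform_limit _ _ P g z rho (2 * M)) => //.
  + move=> n x _; elim: n => [|n ih].
      have -> : P 0%N = cst 0 by apply/funext => y; rewrite /P big_ord0.
      exact: derivable_cst.
    have dX : derivable ((fun y : C => y - toC s) ^+ n) x 1.
      by apply: derivableX; apply: derivableB; [exact: derivable_id|exact: derivable_cst].
    have -> : P n.+1 = P n + cst (toC (a n)) * (fun y : C => y - toC s) ^+ n.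
      apply/funext => y; rewrite /P big_ord_recr /=; congr (_ + _ * _).
      by rewrite fctE.
    exact: (derivableD ih (derivableM (derivable_cst _ _ _) dX)).
  + move=> n x /zr xs; have := tail 0%N n x xs (leq0n _).
    by rewrite /P big_ord0 subr0 expr0 mulr1.
  + move=> t t0; have [N hN] := geometric_small M20 half0 half1 t0.
    exists N => n x Nn /zr xs; apply: le_trans (lim_est x n xs) _.
    exact/ltW/hN.
- move=> u zE; have us : `|u - s| < e.
    by move: zs; rewrite zE -toCB nm_toC; lra.
  have h1 := hf u us; have h2 := hg z zs.
  have h3 : (fun n => P n z) @ \oo --> (toC (f u) : C).
    have -> : (fun n => P n z) = toC \o series (fun k => (u - s) ^+ k * a k).
      apply/funext => n; rewrite /P zE /= /series /= big_mkord rmorph_sum /=.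
      by apply: eq_bigr => k _; rewrite toCM rmorphXn /= toCB mulrC.
    by apply: continuous_cvg h1; exact: toC_continuous.
  exact: (cvg_unique (@norm_hausdorff _ _) h2 h3).
Qed.

Lemma derivable_of_analytic (m : nat) (c : R -> 'rV[R]_m.+1) (s : R) :
  real_analytic_at c s -> exists (f : C -> 'rV[C]_m.+1) (r : R), [/\ 0 < r,
    forall z : C, nm (z - toC s) < r -> derivable f z 1 &
    forall u, `|u - s| < r -> f (toC u) = vecC (c u)].
Proof.
move=> [a [e [e0 hc]]].
have /choice[g hg] (j : 'I_m.+1) : exists g : C -> C, forall z : C, nm (z - toC s) < e / 4 ->
    derivable g z 1 /\ (forall u, z = toC u -> g z = toC (c u 0 j)).
  apply: (@power_series_derivable (fun k => a k 0 j) s e (fun u => c u 0 j)) => // u us.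
  have -> : series (fun k => (u - s) ^+ k * a k 0 j) =
      (fun M : 'rV[R]_m.+1 => M 0 j) \o series (fun k => (u - s) ^+ k *: a k).
    apply/funext => n; rewrite /series /= summxE; apply: eq_bigr => k _.
    by rewrite mxE.
  by apply: continuous_cvg (hc u us); exact: coord_continuous.
exists (fun z => \row_j g j z), (e / 4); split; first by rewrite divr_gt0.
- move=> z zs; apply/derivable_mx_coord => i j.
  have -> : (fun y => (\row_k g k y) i j) = g j by apply/funext => y; rewrite mxE.
  by have [] := hg j z zs.
- move=> u us; apply/rowP => j; rewrite !mxE; apply: (hg j _ _).2 => //.
  by rewrite -toCB nm_toC.
Qed.

(** This branch of the square root serves to extend the length of the vector of minors
    holomorphically. *)
Lemma csqrt_exists : exists S : C -> C, forall z, S z ^+ 2 = z /\ 0 <= reC (S z).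
Proof.
have /choice[S hS] (z : C) : exists y : C, y ^+ 2 = z /\ 0 <= reC y; last by exists S.
have [h|h] := leP 0 (reC (sqrtC z)); first by exists (sqrtC z); rewrite sqrtCK.
by exists (- sqrtC z); rewrite sqrrN sqrtCK reN oppr_ge0 ltW.
Qed.

(** For two roots w, w' with w'^2 - w^2 = h, the real part of w + w' is at least that of w, so |w' -
    w| is O(|h|). The error w' - w - h/(2w) equals -(w' - w)^2/(2w), which is quadratic in h. *)
Lemma csqrt_derivable (S : C -> C) (z : C) :
  (forall z, S z ^+ 2 = z /\ 0 <= reC (S z)) -> 0 < reC z -> derivable S z 1.
Proof.
move=> hS z0; have [w2 w0] := hS z; set w := S z in w2 w0.
have rw : 0 < reC w.
  rewrite lt_neqAle w0 andbT; apply/eqP => E.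
  by move: z0; rewrite -w2 expr2 reM -E mul0r sub0r oppr_gt0 -expr2 ltNge sqr_ge0.
have wn0 : w != 0 by apply/eqP => E; move: rw; rewrite E re0 ltxx.
suff : is_derive z 1 S (w * 2)^-1 by case.
apply/is_derive_nmP => e e0.
pose K := (reC w ^+ 2)^-1 * (nm (w * 2))^-1.
have K0 : 0 <= K by rewrite mulr_ge0 ?invr_ge0 ?nm_ge0 ?exprn_ge0// ltW.
have K1 : 0 < K + 1 by rewrite ltr_wpDl.
exists (e / (K + 1)); first by rewrite divr_gt0.
move=> h; rewrite ltr_pdivlMr// => he.
rewrite [h *: 1]mulr1 [h *: _]mulrC; have [w2' w0'] := hS (z + h); set w' := S (z + h) in w2' w0'.
have hE : h = w' ^+ 2 - w ^+ 2 by rewrite w2 w2' addrAC subrr add0r.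
have -> : w' - w - (w * 2)^-1 * h = - ((w' - w) ^+ 2 * (w * 2)^-1) by rewrite hE; field.
rewrite nmN nmM nmX nmV.
have lip : nm (w' - w) * reC w <= nm h.
  rewrite hE subr_sqr nmM ler_wpM2l ?nm_ge0// (le_trans _ (Re_le _))//.
  by rewrite (le_trans _ (ler_norm _))// reD lerDr.
have h1 : nm (w' - w) ^+ 2 <= nm h ^+ 2 * (reC w ^+ 2)^-1.
  rewrite ler_pdivlMr ?exprn_gt0// -exprMn lerXn2r ?nnegrE ?nm_ge0//.
  by rewrite mulr_ge0 ?nm_ge0// ltW.
have h2 : nm (w' - w) ^+ 2 / nm (w * 2) <= K * nm h ^+ 2.
  rewrite (le_trans (ler_wpM2r _ h1)) ?invr_ge0 ?nm_ge0// /K.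
  by rewrite le_eqVlt; apply/orP; left; apply/eqP; ring.
apply: le_trans h2 _; rewrite expr2 mulrA ler_wpM2r ?nm_ge0//.
have := nm_ge0 h; lra.
Qed.

Lemma derivable_bigsum (I : Type) (r : seq I) (F : I -> C -> C) (z : C) :
  (forall i, derivable (F i) z 1) -> derivable (fun x => \sum_(i <- r) F i x) z 1.
Proof.
move=> h; elim: r => [|i r ih].
  have -> : (fun x => \sum_(i <- [::]) F i x) = cst 0 by apply/funext => x; rewrite big_nil.
  exact: derivable_cst.
have -> : (fun x => \sum_(k <- i :: r) F k x) = F i + (fun x => \sum_(k <- r) F k x).
  by apply/funext => x; rewrite big_cons.
exact: (@derivableD C C C (F i) _ z 1 (h i) ih).
Qed.

Lemma derivable_bigprod (I : Type) (r : seq I) (F : I -> C -> C) (z : C) :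
  (forall i, derivable (F i) z 1) -> derivable (fun x => \prod_(i <- r) F i x) z 1.
Proof.
move=> h; elim: r => [|i r ih].
  have -> : (fun x => \prod_(i <- [::]) F i x) = cst 1 by apply/funext => x; rewrite big_nil.
  exact: derivable_cst.
have -> : (fun x => \prod_(k <- i :: r) F k x) = F i * (fun x => \prod_(k <- r) F k x).
  by apply/funext => x; rewrite big_cons.
exact: (@derivableM C C (F i) _ z 1 (h i) ih).
Qed.

Lemma derivable_det (n : nat) (A : C -> 'M[C]_n) (z : C) :
  (forall i j, derivable (fun x => A x i j) z 1) -> derivable (fun x => \det (A x)) z 1.
Proof.
move=> h; rewrite /determinant; apply: derivable_bigsum => s.
apply: derivableM; first exact: derivable_cst.
by apply: derivable_bigprod => i.
Qed.

End Analytic.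

Lemma ext_last_low (T : Type) (n : nat) (f : 'I_n -> T) (x : T) (j : 'I_n) :
  ext_last f x (lift ord_max j) = f j.
Proof. by rewrite /ext_last liftK. Qed.

Lemma ext_last_max (T : Type) (n : nat) (f : 'I_n -> T) (x : T) : ext_last f x ord_max = x.
Proof. by rewrite /ext_last unlift_none. Qed.

(** * The holomorphic implicit function theorem for curves *)

Section Implicit.
Variables (R : realType) (C : complex_model R).

Lemma differentiable_row (V : normedModType C) (m : nat) (f : V -> 'rV[C]_m) (x : V) :
  (forall j, differentiable (fun y => f y 0 j) x) -> differentiable f x.
Proof.
move=> h.
have -> : f = \sum_(j < m) (fun y => f y 0 j *: delta_mx 0 j : 'rV[C]_m).
  by apply/funext => y; rewrite fct_sumE {1}[f y]row_sum_delta.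
by apply: differentiable_sum => j; apply: differentiableZl.
Qed.

Lemma nm_mulmx (p q : nat) (v : 'rV[C]_p) (B : 'M[C]_(p, q)) :
  nm (v *m B) <= p%:R * nm B * nm v.
Proof.
apply: nm_mx_le; first by rewrite !mulr_ge0 ?nm_ge0.
move=> i j; rewrite mxE (le_trans (nm_sum _ _ _))//.
rewrite (@le_trans _ _ (\sum_(k < p) nm B * nm v))//.
  by apply: ler_sum => k _; rewrite nmM mulrC ler_pM ?nm_ge0 ?nm_coord.
by rewrite sumr_const card_ord -mulrA mulr_natl.
Qed.

Lemma derive_real (m : nat) (F : 'rV[C]_m -> C) (x v : 'rV[R]_m) (r : R) : 0 < r ->
  (forall y, nm (y - vecC C x) < r -> (forall k, imC (y 0 k) = 0) -> imC (F y) = 0) ->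
  derivable F (vecC C x) (vecC C v) -> imC ('D_(vecC C v) F (vecC C x)) = 0.
Proof.
move=> r0 hF /derivableP/is_derive_nmP hd.
apply/eqP; rewrite -normr_eq0 eq_le normr_ge0 andbT; apply/ler_addgt0Pr => e e0; rewrite add0r.
have [d d0 {}hd] := hd e e0.
have K0 : 0 < nm (vecC C v) + 1 by rewrite ltr_wpDl ?nm_ge0.
pose t := Num.min (d / 2) (r / (nm (vecC C v) + 1)).
have t0 : 0 < t by rewrite lt_min !divr_gt0.
have td : t < d by rewrite gt_min; apply/orP; left; lra.
have tr : t * (nm (vecC C v) + 1) <= r by rewrite -ler_pdivlMr// ge_min lexx orbT.
have tn : nm (toC t : C) = t by rewrite nm_toC gtr0_norm.
have := hd (toC t); rewrite tn => /(_ td).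
have r1 : imC (F (vecC C x + toC t *: vecC C v)) = 0.
  apply: hF => [|k]; last by rewrite !mxE imD imM !re_toC !im_toC !(mulr0, mul0r) !addr0.
  by rewrite addrAC subrr add0r nmZ tn; lra.
have r2 : imC (F (vecC C x)) = 0.
  by apply: hF => [|k]; [rewrite subrr nm0|exact: vecC_real].
move=> h; have := le_trans (Im_le _) h.
rewrite !imB r1 r2 subr0 sub0r normrN imM_toC normrM (gtr0_norm t0) mulrC.
by rewrite ler_pM2r.
Qed.

(** Newton's method with the derivative frozen at a. Phi collects the F_j and the height <x - a, e>,
    and A is its derivative at a. Fixed points of x - Phi(x) A^-1 + s u, with u the last row of
    A^-1, are exactly the solutions of Phi(x) = (0, .., 0, s). Strict differentiability provides the
    contraction. *)
Lemma implicit_curve (n : nat) (F : 'I_n -> 'rV[C]_n.+1 -> C) (a e : 'rV[R]_n.+1)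
    (A : 'M[R]_n.+1) (r : R) : 0 < r ->
  (forall j x, nm (x - vecC C a) < r -> differentiable (F j) x) ->
  (forall j x, nm (x - vecC C a) < r -> (forall k, imC (x 0 k) = 0) -> imC (F j x) = 0) ->
  (forall j, F j (vecC C a) = 0) ->
  (forall i j, A i (lift ord_max j) = reC ('D_(delta_mx 0 i) (F j) (vecC C a))) ->
  (forall i, A i ord_max = e 0 i) -> A \in unitmx ->
  exists (g : C -> 'rV[C]_n.+1) (d rho : R), [/\ 0 < d, 0 < rho, rho <= r,
    forall s : C, nm s < d -> [/\ nm (g s - vecC C a) < rho, derivable g s 1,
      forall j, F j (g s) = 0,
      \sum_i (g s - vecC C a) 0 i * toC (e 0 i) = s &
      imC s = 0 -> forall k, imC (g s 0 k) = 0] &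
    forall x, nm (x - vecC C a) < rho -> (forall j, F j x = 0) ->
      nm (\sum_i (x - vecC C a) 0 i * toC (e 0 i)) < d ->
      x = g (\sum_i (x - vecC C a) 0 i * toC (e 0 i))].
Proof.
move=> r0 dF rF F0 hA he uA.
set x0 := vecC C a.
pose ht x := \sum_i (x - x0) 0 i * toC (e 0 i).
pose Phi x : 'rV[C]_n.+1 := \row_i ext_last (F ^~ x) (ht x) i.
pose A' : 'M[C]_n.+1 := map_mx toC A.
pose B : 'M[C]_n.+1 := map_mx toC (invmx A).
have AB : A' *m B = 1%:M by rewrite -map_mxM mulmxV// map_mx1.
have BA : B *m A' = 1%:M by rewrite -map_mxM mulVmx// map_mx1.
pose Psi x := x - Phi x *m B.
pose u : 'rV[C]_n.+1 := delta_mx 0 ord_max *m B.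
have x00 : nm (x0 - x0) < r by rewrite subrr nm0.
have Areal i j : 'D_(delta_mx 0 i) (F j) x0 = toC (A i (lift ord_max j)).
  have -> : delta_mx 0 i = vecC C (delta_mx 0 i) :> 'rV[C]_n.+1.
    by apply/rowP => k; rewrite !mxE rmorph_nat.
  apply: C_ext; rewrite ?re_toC ?im_toC.
    rewrite hA; congr (reC ('D__ _ _)).
    by apply/rowP => k; rewrite !mxE rmorph_nat.
  apply: (derive_real r0); first exact: rF.
  by apply: diff_derivable; exact: dF.
have dFlin j v : 'd (F j) x0 v = (v *m A') 0 (lift ord_max j).
  rewrite {1}[v]row_sum_delta linear_sum mxE; apply: eq_bigr => i _.
  by rewrite linearZ /= -deriveE ?Areal ?mxE//; exact: dF.
have htB x y : ht x - ht y = ((x - y) *m A') 0 ord_max.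
  rewrite /ht mxE -sumrB; apply: eq_bigr => i _.
  by rewrite -mulrBl !mxE he; congr (_ * _); rewrite opprB addrA subrK.
pose K := n.+1%:R * nm B.
have K0 : 0 <= K by rewrite mulr_ge0 ?nm_ge0.
(* K bounds the operator v -> v B, so K eps <= 1/2 is the contraction constant required by
   [picard]. *)
pose eps := (2 * (K + 1))^-1.
have eps0 : 0 < eps by rewrite invr_gt0 mulr_gt0// ltr_wpDl.
have /choice[dd hdd] (j : 'I_n) : exists d : R, 0 < d /\ forall x y, nm (x - x0) < d -> nm (y - x0) < d ->
    nm (F j x - F j y - 'd (F j) x0 (x - y)) <= eps * nm (x - y).
  by have [d d0 hd] := strict_differentiable r0 (dF j) eps0; exists d.
pose rho := \big[Num.min/r]_j dd j.
have rho0 : 0 < rho by apply: lt_bigmin => // j _; have [] := hdd j.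
have rhor : rho <= r by exact: bigmin_le_id.
have PhiB x y : nm (x - x0) < rho -> nm (y - x0) < rho ->
    nm (Phi x - Phi y - (x - y) *m A') <= eps * nm (x - y).
  move=> xr yr; apply: nm_mx_le; first by rewrite mulr_ge0 ?nm_ge0// ltW.
  move=> i j; rewrite (ord1 i) {i}; case: (unliftP ord_max j) => [k ->|->].
    have kr : rho <= dd k by exact: bigmin_le.
    have := (hdd k).2 x y (lt_le_trans xr kr) (lt_le_trans yr kr).
    by rewrite dFlin !mxE !ext_last_low.
  have -> : (Phi x - Phi y - (x - y) *m A') 0 ord_max = ht x - ht y - ((x - y) *m A') 0 ord_max.
    by rewrite !mxE !ext_last_max.
  by rewrite htB subrr nm0 mulr_ge0 ?nm_ge0// ltW.
have lip x y : nm (x - x0) < rho -> nm (y - x0) < rho -> nm (Psi x - Psi y) <= nm (x - y) / 2.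
  move=> xr yr.
  have -> : Psi x - Psi y = - ((Phi x - Phi y - (x - y) *m A') *m B).
    rewrite mulmxBl -[in RHS]mulmxA AB mulmx1 mulmxBl /Psi.
    move: (Phi x *m B) (Phi y *m B) => p q.
    by apply/rowP => k; rewrite !mxE; ring.
  rewrite nmN (le_trans (nm_mulmx _ _))// -/K (le_trans (ler_wpM2l K0 (PhiB _ _ xr yr)))//.
  rewrite mulrA [nm (x - y) / 2]mulrC ler_wpM2r ?nm_ge0// /eps ler_pdivrMr ?mulr_gt0 ?ltr_wpDl//.
  by lra.
have ht0 : ht x0 = 0 by rewrite /ht big1// => i _; rewrite subrr mxE mul0r.
have Phi0 : Phi x0 = 0.
  apply/rowP => j; rewrite !mxE; case: (unliftP ord_max j) => [k ->|->].
    by rewrite ext_last_low F0.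
  by rewrite ext_last_max.
have fix0 : Psi x0 = x0 by rewrite /Psi Phi0 mul0mx subr0.
have dht x : differentiable ht x.
  have -> : ht = \sum_i (fun x => (x - x0) 0 i * toC (e 0 i)).
    by apply/funext => y; rewrite fct_sumE.
  apply: differentiable_sum => i; apply: differentiableM; last exact: differentiable_cst.
  have -> : (fun y => (y - x0) 0 i) = (fun y : 'rV[C]_n.+1 => y 0 i - x0 0 i).
    by apply/funext => y; rewrite !mxE.
  by apply: differentiableB; [exact: differentiable_coord|exact: differentiable_cst].
have dPhi x : nm (x - x0) < rho -> differentiable Phi x.
  move=> xr; apply: differentiable_row => j.
  have -> : (fun y => Phi y 0 j) = fun y => ext_last (F ^~ y) (ht y) j.
    by apply/funext => y; rewrite mxE.
  case: (unliftP ord_max j) => [k ->|->].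
    under eq_fun do rewrite ext_last_low.
    by apply: dF; exact: lt_le_trans rhor.
  by under eq_fun do rewrite ext_last_max; exact: dht.
have dPsi x : nm (x - x0) < rho -> differentiable Psi x.
  move=> xr; apply: differentiable_row => j.
  have -> : (fun y => Psi y 0 j) = (fun y : 'rV[C]_n.+1 => y 0 j) - \sum_i (fun y => Phi y 0 i * B i j).
    by apply/funext => y; rewrite !mxE fctE fct_sumE.
  apply: differentiableB; first exact: differentiable_coord.
  apply: differentiable_sum => i; apply: differentiableM; last exact: differentiable_cst.
  apply: (@differentiable_comp _ _ _ _ Phi (fun y : 'rV[C]_n.+1 => y 0 i)); first exact: dPhi.
  exact: differentiable_coord.
have im_sum (I : finType) (f : I -> C) : (forall i, imC (f i) = 0) -> imC (\sum_i f i) = 0.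
  by move=> hf; rewrite (big_morph (@imC R C) (@imD R C) (im0 C)) big1.
have rPsi x : nm (x - x0) < rho -> (forall j, imC (x 0 j) = 0) -> forall j, imC (Psi x 0 j) = 0.
  move=> xr rx j; rewrite !mxE imB rx im_sum ?subr0// => i.
  rewrite !mxE imM im_toC mulr0 add0r.
  suff -> : imC (ext_last (F ^~ x) (ht x) i) = 0 by rewrite mul0r.
  case: (unliftP ord_max i) => [k ->|->].
    by rewrite ext_last_low; apply: rF => //; exact: lt_le_trans rhor.
  rewrite ext_last_max; apply: im_sum => k.
  by rewrite !mxE imM imB rx !im_toC subr0 mulr0 mul0r addr0.
have ru j : imC (u 0 j) = 0.
  rewrite mxE im_sum// => i; rewrite !mxE imM im_toC mulr0 add0r.
  by rewrite -(rmorph_nat (@toC R C)) im_toC mul0r.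
have [g [d d0 hg]] := picard rho0 dPsi lip fix0 (vecC_real C a) ru rPsi.
exists g, d, rho; split=> //.
- move=> s sd; have [gr gE dg rg] := hg s sd.
  have PhiE : Phi (g s) = s *: delta_mx 0 ord_max.
    have : Phi (g s) *m B = (s *: delta_mx 0 ord_max) *m B.
      by rewrite -scalemxAl -/u; apply: (addrI (g s - Phi (g s) *m B)); rewrite subrK.
    by move/(congr1 (mulmx^~ A')); rewrite /= -!mulmxA BA !mulmx1.
  split=> //.
    move=> j; have := congr1 (fun M : 'rV[C]_n.+1 => M 0 (lift ord_max j)) PhiE.
    by rewrite !mxE ext_last_low eq_sym (negbTE (neq_lift _ _)) andbF mulr0.
  have := congr1 (fun M : 'rV[C]_n.+1 => M 0 ord_max) PhiE.
  by rewrite !mxE ext_last_max !eqxx mulr1.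
- move=> x xr Fx; rewrite -/(ht x) => hd; have [gr gE _ _] := hg _ hd.
  have PhiE : Phi x = ht x *: delta_mx 0 ord_max.
    apply/rowP => j; rewrite !mxE; case: (unliftP ord_max j) => [k ->|->].
      by rewrite ext_last_low Fx eq_sym (negbTE (neq_lift _ _)) andbF mulr0.
    by rewrite ext_last_max !eqxx mulr1.
  have xE : x = Psi x + ht x *: u by rewrite /Psi PhiE -scalemxAl subrK.
  apply/eqP; rewrite -subr_eq0 -nm_eq0 eq_le nm_ge0 andbT.
  have := lip _ _ xr gr.
  have -> : Psi x - Psi (g (ht x)) = x - g (ht x).
    rewrite [RHS](_ : _ = Psi x + ht x *: u - (Psi (g (ht x)) + ht x *: u)); last by rewrite -xE -gE.
    move: (Psi x) (Psi (g _)) (ht x *: u) => p q v.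
    by rewrite opprD addrACA subrr addr0.
  by have := nm_ge0 (x - g (ht x)); lra.
Qed.

End Implicit.

(** * Maximal minors and unit normals *)

Section CrossProduct.
Variables (K : comNzRingType) (n : nat).
Implicit Types (V : 'M[K]_(n.+1, n)) (x : 'rV[K]_n.+1).

Definition add_col V x : 'M[K]_n.+1 := \matrix_(i, j) ext_last (V i) (x 0 i) j.

(** The generalized cross product of the columns of V; the 0 fills the column that the cofactors
    delete. *)
Definition cross V : 'rV[K]_n.+1 := \row_i cofactor (add_col V 0) i ord_max.

Lemma add_col_low V x i (j : 'I_n) : add_col V x i (lift ord_max j) = V i j.
Proof. by rewrite mxE ext_last_low. Qed.

Lemma add_col_max V x i : add_col V x i ord_max = x 0 i.
Proof. by rewrite mxE ext_last_max. Qed.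

Lemma det_add_col V x : \det (add_col V x) = \sum_i x 0 i * cross V 0 i.
Proof.
rewrite (expand_det_col _ ord_max); apply: eq_bigr => i _.
rewrite add_col_max mxE; congr (_ * (_ * \det _)).
by apply/matrixP => k l; rewrite !mxE !ext_last_low.
Qed.

Lemma cross_orthogonal V : cross V *m V = 0.
Proof.
apply/rowP => j; rewrite !mxE.
transitivity (\det (add_col V (\row_i V i j))).
  by rewrite det_add_col; apply: eq_bigr => i _; rewrite [in RHS]mxE mulrC.
rewrite -det_tr; apply: (@determinant_alternate _ _ _ (lift ord_max j) ord_max).
  by rewrite eq_sym neq_lift.
by move=> i; rewrite 2!mxE [in RHS]mxE ext_last_low add_col_max mxE.
Qed.

End CrossProduct.

Lemma cross_map (K K' : comNzRingType) (f : {rmorphism K -> K'}) (n : nat) (V : 'M[K]_(n.+1, n)) :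
  cross (map_mx f V) = map_mx f (cross V).
Proof.
apply/rowP => i; rewrite !mxE -cofactor_map_mx; congr (cofactor _ _ _).
apply/matrixP => k l; rewrite !mxE; case: (unliftP ord_max l) => [j ->|->].
  by rewrite !ext_last_low ?mxE.
by rewrite !ext_last_max ?mxE ?rmorph0.
Qed.

Section UnitNormal.
Variables (R : realType) (n : nat) (V : 'M[R]_(n.+1, n)).
Hypothesis rankV : \rank V = n.
Implicit Types (e x : 'rV[R]_n.+1).

Lemma sum_sqr_gt0 x : x != 0 -> 0 < \sum_i x 0 i ^+ 2.
Proof.
move=> x0; rewrite lt_neqAle sumr_ge0 => [|i _]; last exact: sqr_ge0.
rewrite andbT eq_sym; apply: contra x0 => /eqP h; apply/eqP/rowP => i; rewrite mxE.
have hh (k : 'I_n.+1) : true -> 0 <= x 0 k ^+ 2 by move=> _; exact: sqr_ge0.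
have /(_ i isT) := psumr_eq0P hh h.
by move/eqP; rewrite sqrf_eq0 => /eqP.
Qed.

(** Pair a linear relation between the columns of [V, e] with e: the columns of V disappear, and the
    coefficient of e vanishes because the sum of the e_i^2 is positive over the reals. The remaining
    coefficients vanish by the rank of V. *)
Lemma add_col_kernel_unit e : e != 0 -> e *m V = 0 -> add_col V e \in unitmx.
Proof.
move=> e0 eV; rewrite -unitmx_tr -row_free_unit -kermx_eq0; apply/eqP/row_matrixP => k.
rewrite row0; set y := row k _.
have yA : y *m (add_col V e)^T = 0 by apply/sub_kermxP; exact: row_sub.
clearbody y.
pose y' : 'rV_n := \row_j y 0 (lift ord_max j).
have yE i : \sum_j y' 0 j * V i j + y 0 ord_max * e 0 i = 0.
  have : (y *m (add_col V e)^T) 0 i = 0 by rewrite yA mxE.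
  rewrite mxE (bigD1_ord ord_max) //= addrC => h; rewrite -[RHS]h; congr (_ + _ * _).
    by apply: eq_bigr => j _; rewrite [y' 0 j]mxE [_^T _ _]mxE add_col_low.
  by rewrite [_^T _ _]mxE add_col_max.
have c0 : y 0 ord_max = 0.
  have : \sum_i e 0 i * (\sum_j y' 0 j * V i j + y 0 ord_max * e 0 i) = 0.
    by rewrite big1// => i _; rewrite yE mulr0.
  under eq_bigr do rewrite mulrDr; rewrite big_split /=.
  rewrite [X in X + _](_ : _ = \sum_j y' 0 j * (e *m V) 0 j); last first.
    under eq_bigr do rewrite mulr_sumr; rewrite exchange_big; apply: eq_bigr => j _.
    by rewrite [(e *m V) 0 j]mxE mulr_sumr; apply: eq_bigr => i _; ring.
  rewrite eV big1 => [|j _]; last by rewrite [X in _ * X]mxE mulr0.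
  rewrite add0r [X in X = 0](_ : _ = y 0 ord_max * \sum_i e 0 i ^+ 2); last first.
    by rewrite mulr_sumr; apply: eq_bigr => i _; ring.
  by move/eqP; rewrite mulf_eq0 (gt_eqF (sum_sqr_gt0 e0)) orbF => /eqP.
have y'0 : y' = 0.
  have freeV : row_free V^T by rewrite /row_free mxrank_tr rankV.
  apply: (row_free_inj freeV); rewrite mul0mx; apply/rowP => i; rewrite !mxE.
  rewrite -[RHS](yE i) c0 mul0r addr0; apply: eq_bigr => j _.
  by rewrite !mxE.
apply/rowP => j; rewrite [RHS]mxE; case: (unliftP ord_max j) => [l ->|->//].
by have := congr1 (fun M : 'rV[R]_n => M 0 l) y'0; rewrite !mxE.
Qed.

(** V has one more row than its rank, so some nonzero e is orthogonal to its columns, and <e, N> =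
    det [V, e] is nonzero. *)
Lemma cross_neq0 : cross V != 0.
Proof.
have : kermx V != 0.
  rewrite kermx_eq0 /row_free rankV; apply/eqP => h.
  exact: (n_Sn n h).
case/rowV0Pn => e /sub_kermxP eV e0.
have := add_col_kernel_unit e0 eV; rewrite unitmxE unitfE det_add_col.
by apply: contra => /eqP ->; rewrite big1// => i _; rewrite mxE mulr0.
Qed.

(** The difference of the two sides is orthogonal both to V and to N. If it were nonzero, its
    pairing with N would be a nonzero determinant. *)
Lemma kernel_cross x : x *m V = 0 ->
  x = ((\sum_i x 0 i * cross V 0 i) / (\sum_i cross V 0 i ^+ 2)) *: cross V.
Proof.
move=> xV; set l := _ / _; apply/eqP; rewrite -subr_eq0; apply/negPn/negP => h.
have := add_col_kernel_unit h; rewrite mulmxBl xV -scalemxAl cross_orthogonal scaler0 subrr.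
move=> /(_ erefl); rewrite unitmxE unitfE det_add_col => /eqP; apply.
have q0 : \sum_i cross V 0 i ^+ 2 != 0 by rewrite gt_eqF// sum_sqr_gt0// cross_neq0.
move: q0; rewrite /l; move: (cross V) => N q0.
under eq_bigr do rewrite !mxE mulrBl -mulrA -expr2.
by rewrite sumrB -mulr_sumr divfK// subrr.
Qed.

Lemma sqrt_cross_gt0 : 0 < Num.sqrt (\sum_i cross V 0 i ^+ 2).
Proof. by rewrite sqrtr_gt0 sum_sqr_gt0// cross_neq0. Qed.

(** A normal has the form l N. Unit length gives (l r)^2 = 1 with r = |N|, and the positive
    determinant l r^2 selects the sign of l. *)
Lemma unit_normalP e :
  [/\ \sum_i e 0 i ^+ 2 = 1, e *m V = 0 & 0 < \det (add_col V e)] <->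
  e = (Num.sqrt (\sum_i cross V 0 i ^+ 2))^-1 *: cross V.
Proof.
have q0 := sum_sqr_gt0 cross_neq0; have r0 := sqrt_cross_gt0.
have kc e' (eV : e' *m V = 0) := kernel_cross eV.
have orth := cross_orthogonal V; move: (det_add_col V) q0 r0 kc orth.
move: (cross V) => N detE; set q := \sum_i _ => q0; set r := Num.sqrt q => r0 kc orth.
have r2 : r ^+ 2 = q by rewrite sqr_sqrtr// ltW.
split=> [[e1 eV]|->].
  rewrite detE; have := kc e eV.
  set l := _ / _ => el; have lE : \sum_i e 0 i * N 0 i = l * q.
    by rewrite /l divfK// gt_eqF.
  clearbody l; rewrite lE pmulr_lgt0// => l0; rewrite el; congr (_ *: _).
  have : l ^+ 2 * q = 1.
    rewrite -e1 mulr_sumr; apply: eq_bigr => i _.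
    by rewrite [in RHS]el [in RHS]mxE exprMn.
  rewrite -r2 -exprMn => h.
  have : l * r = 1.
    by apply/eqP; rewrite -(@eqrXn2 _ 2) ?expr1n ?h// mulr_ge0// ltW.
  by move=> lr; have rn0 : r != 0 by [rewrite gt_eqF]; rewrite -[l](mulfK rn0) lr mul1r.
split.
- under eq_bigr do rewrite mxE exprMn; rewrite -mulr_sumr -/q -r2 -exprMn mulVf ?expr1n//.
  by rewrite gt_eqF.
- by rewrite -scalemxAl orth scaler0.
- rewrite detE [ltRHS](_ : _ = r^-1 * q) ?mulr_gt0 ?invr_gt0//.
  by rewrite mulr_sumr; apply: eq_bigr => i _; rewrite mxE; ring.
Qed.

End UnitNormal.

(** * Orbits and relations *)

Section RealDerivative.
Variables (R : realType) (C : complex_model R).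

Lemma derive1_real (F : C -> C) (x r : R) : 0 < r ->
  (forall u, `|u - x| < r -> imC (F (toC u)) = 0) ->
  derivable F (toC x) 1 -> imC ('D_1 F (toC x)) = 0.
Proof.
move=> r0 hF /derivableP/is_derive_nmP hd.
apply/eqP; rewrite -normr_eq0 eq_le normr_ge0 andbT; apply/ler_addgt0Pr => e e0; rewrite add0r.
have [d d0 {}hd] := hd e e0.
pose t := Num.min (d / 2) (r / 2).
have t0 : 0 < t by rewrite lt_min !divr_gt0.
have td : t < d by rewrite gt_min; apply/orP; left; lra.
have tr : t < r by rewrite gt_min; apply/orP; right; lra.
have tn : nm (toC t : C) = t by rewrite nm_toC gtr0_norm.
have := hd (toC t); rewrite tn => /(_ td); rewrite [toC t *: 1]mulr1 -toCD.
have r1 : imC (F (toC (x + t))) = 0 by apply: hF; rewrite addrAC subrr add0r gtr0_norm.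
have r2 : imC (F (toC x)) = 0 by apply: hF; rewrite subrr normr0.
move=> h; have := le_trans (Im_le _) h.
rewrite !imB r1 r2 subr0 sub0r normrN imM_toC normrM (gtr0_norm t0) mulrC.
by rewrite ler_pM2r.
Qed.

Lemma is_derive_vecR (m : nat) (g : C -> 'rV[C]_m.+1) (s : R) (a : 'rV[C]_m.+1) :
  is_derive (toC s) 1 g a -> is_derive s 1 (fun u => vecR (g (toC u))) (vecR a).
Proof.
move=> /is_derive_nmP h.
have fa : (fun t : R => t^-1 *: (((fun u => vecR (g (toC u))) \o shift s) (t *: (1 : R)) - vecR (g (toC s))))
    @ 0^' --> vecR a.
  apply/cvgrPdist_lt => e e0; have e20 : 0 < e / 2 by lra.
  have [d d0 hd] := h _ e20; apply/nbhs_normP; exists d => // t /=.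
  rewrite sub0r normrN => td t0.
  have tn : nm (toC t : C) = `|t| by rewrite nm_toC.
  have := hd (toC t); rewrite tn => /(_ td); rewrite [toC t *: 1]mulr1.
  rewrite [t *: 1]mulr1 [t + s]addrC toCD => hh.
  apply: (@le_lt_trans _ _ (e / 2)); last by lra.
  apply: norm_rV_le; first by lra.
  move=> j; have hj := le_trans (nm_coord _ 0 j) hh.
  have t0' : 0 < `|t| by rewrite normr_gt0.
  rewrite -(ler_pM2l t0') -normrM [leRHS]mulrC; apply: le_trans hj.
  apply: le_trans (Re_le _); rewrite !mxE.
  rewrite -normrN le_eqVlt; apply/orP; left; apply/eqP; congr (`|_|).
  by rewrite !(reB, reD) reM_toC; field.
by split; [apply/cvg_ex; exists (vecR a)|exact: (cvg_lim (@norm_hausdorff _ _) fa)].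
Qed.

Lemma derive1_comp_C (f g : C -> C) (x : C) :
  derivable f x 1 -> derivable g (f x) 1 ->
  'D_1 (g \o f) x = 'D_1 g (f x) * 'D_1 f x.
Proof.
move=> hf hg; have df := (derivable1_diffP _ _).1 hf; have dg := (derivable1_diffP _ _).1 hg.
have dgf : differentiable (g \o f) x by exact: differentiable_comp.
have E := congr1 (fun F : C -> C => F ('d f x 1)) (deriv1E hg).
have D1 : 'D_1 (g \o f) x = 'd (g \o f) x 1 by exact: deriveE.
have D2 : 'D_1 f x = 'd f x 1 by exact: deriveE.
have D3 : 'd (g \o f) x 1 = 'd g (f x) ('d f x 1).
  exact: (congr1 (fun F : C -> C => F 1) (diff_comp df dg)).
apply: (etrans D1 (etrans D3 (etrans E _))).
by rewrite D2 -derive1E; exact: mulrC.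
Qed.

End RealDerivative.

Section Family.
Variables (R : realType) (C : complex_model R) (n : nat).
Implicit Types (w : 'rV[C]_n.+1) (G : 'rV[C]_n.+1 -> C -> C).

(** The set on which the m-th iterate is controlled: [G] is evaluated at the iterates k < m, and the
    m-th one may leave U. *)
Definition orbit_in (W : set 'rV[C]_n.+1) (U : set C) G (m : nat) : set ('rV[C]_n.+1 * C) :=
  [set x | W x.1 /\ forall k, (k < m)%N -> U (iter k (G x.1) x.2)].

Definition relation G (p : 'rV[C]_n.+1 -> 'rV[C]_n.+1) (i : 'I_n.+1) (q : nat) (t : target n) w : C :=
  iter q.-1 (G w) (w 0 i) -
  match t with Mu m => p w 0 m | El l => iter l.-1 (G w) (w 0 i) end.

Section Orbit.
Variables (W : set 'rV[C]_n.+1) (U : set C) (G : 'rV[C]_n.+1 -> C -> C).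
Hypotheses (oW : open W) (oU : open U).
Hypothesis dG : forall x : 'rV[C]_n.+1 * C, (W `*` U) x ->
  differentiable (fun y : 'rV[C]_n.+1 * C => G y.1 y.2) x.

Lemma differentiable_fst_snd (x : 'rV[C]_n.+1 * C) :
  differentiable (fun y : 'rV[C]_n.+1 * C => y.1) x /\
  differentiable (fun y : 'rV[C]_n.+1 * C => y.2) x.
Proof.
have c1 : continuous (fst : ('rV[C]_n.+1 * C)%type -> 'rV[C]_n.+1) by move=> y; exact: cvg_fst.
have c2 : continuous (snd : ('rV[C]_n.+1 * C)%type -> C) by move=> y; exact: cvg_snd.
split.
  exact: (@linear_differentiable _ _ _ (fst : {linear ('rV[C]_n.+1 * C)%type -> 'rV[C]_n.+1}) x c1).
exact: (@linear_differentiable _ _ _ (snd : {linear ('rV[C]_n.+1 * C)%type -> C}) x c2).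
Qed.

(** Openness and differentiability go through one induction, since the domain of step m + 1 is open
    by continuity of the m-th iterate. *)
Lemma orbit_open_diff m : open (orbit_in W U G m) /\
  forall x, orbit_in W U G m x -> differentiable (fun y => iter m (G y.1) y.2) x.
Proof.
elim: m => [|m [ihO ihD]].
  split; last by move=> x _; have [] := differentiable_fst_snd x.
  have -> : orbit_in W U G 0 = (fun y => y.1) @^-1` W.
    by apply/seteqP; split=> x; [case|move=> Wx; split].
  apply: open_comp => // x _; exact: cvg_fst.
have sub x : orbit_in W U G m.+1 x -> orbit_in W U G m x /\ U (iter m (G x.1) x.2).
  by move=> [Wx h]; split; [split=> // k km; apply: h; exact: ltnW|exact: h].
split.
  rewrite openE => x hx; have [Om Um] := sub x hx.
  have h1 : nbhs x (orbit_in W U G m) by exact: open_nbhs_nbhs.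
  have h2 : nbhs x ((fun y => iter m (G y.1) y.2) @^-1` U).
    by apply: (differentiable_continuous (ihD x Om)); exact: open_nbhs_nbhs.
  rewrite /interior; apply: filterS2 h1 h2 => y [Wy hy] Uy; split=> // k.
  by rewrite ltnS leq_eqVlt => /orP[/eqP->//|]; exact: hy.
move=> x hx; have [Om Um] := sub x hx.
apply: (@differentiable_comp _ _ _ _ (fun y : 'rV[C]_n.+1 * C => (y.1, iter m (G y.1) y.2))
  (fun y : 'rV[C]_n.+1 * C => G y.1 y.2)).
  apply: differentiable_pair; first by have [] := differentiable_fst_snd x.
  exact: ihD.
by apply: dG; split=> //; have [] := Om.
Qed.

Lemma orbit_differentiable (i : 'I_n.+1) m w : orbit_in W U G m (w, w 0 i) ->
  differentiable (fun y => iter m (G y) (y 0 i)) w.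
Proof.
move=> h.
apply: (@differentiable_comp _ _ _ _ (fun y : 'rV[C]_n.+1 => (y, y 0 i))
  (fun y : 'rV[C]_n.+1 * C => iter m (G y.1) y.2)).
  by apply: differentiable_pair; [exact: ex_diff|exact: differentiable_coord].
by have [_] := orbit_open_diff m; exact.
Qed.

Lemma orbit_derivable m w z : orbit_in W U G m (w, z) -> derivable (iter m (G w)) z 1.
Proof.
move=> h; apply/derivable1_diffP.
apply: (@differentiable_comp _ _ _ _ (fun y : C => (w, y))
  (fun y : 'rV[C]_n.+1 * C => iter m (G y.1) y.2)).
  by apply: differentiable_pair; [exact: differentiable_cst|exact: ex_diff].
by have [_] := orbit_open_diff m; exact.
Qed.

(** As a directional derivative of a jointly holomorphic function, the spatial derivative falls
    under [derivable_dderive] when the parameter moves as well. *)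
Lemma orbit_derive1E m w z : orbit_in W U G m (w, z) ->
  derive1 (iter m (G w)) z = 'D_((0, 1) : 'rV[C]_n.+1 * C) (fun y => iter m (G y.1) y.2) (w, z).
Proof.
move=> h; rewrite derive1E.
have /derivableP/derive_lineE hd : derivable (iter m (G w)) z 1 by exact: orbit_derivable.
have : is_derive (w, z) ((0, 1) : 'rV[C]_n.+1 * C) (fun y => iter m (G y.1) y.2)
    ('D_1 (iter m (G w)) z).
  apply/derive_lineE; have -> : (fun h : C => iter m (G ((w, z) + h *: ((0, 1) : 'rV[C]_n.+1 * C)).1)
      ((w, z) + h *: ((0, 1) : 'rV[C]_n.+1 * C)).2) = fun h => iter m (G w) (z + h *: 1).
    by apply/funext => k /=; rewrite scaler0 addr0.
  exact: hd.
by case=> _ ->.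
Qed.

Lemma orbit_derive_curve m (i : 'I_n.+1) (g : C -> 'rV[C]_n.+1) (s : C) (r : R) : 0 < r ->
  (forall z : C, nm (z - s) < r -> derivable g z 1) ->
  (forall z : C, nm (z - s) < r -> orbit_in W U G m (g z, g z 0 i)) ->
  derivable (fun z => derive1 (iter m (G (g z))) (g z 0 i)) s 1.
Proof.
move=> r0 dg hg; have [oO dO] := orbit_open_diff m.
have dg' (z : C) : nm (z - s) < r -> derivable (fun x => (g x, g x 0 i)) z 1.
  move=> zr; apply/derivable1_diffP; apply: differentiable_pair.
    exact/derivable1_diffP/dg.
  by apply/derivable1_diffP; have /derivable_mx_coord := dg z zr; exact.
have hs : orbit_in W U G m (g s, g s 0 i) by apply: hg; rewrite subrr nm0.
have := derivable_dderive (v := ((0, 1) : 'rV[C]_n.+1 * C)) oO dO r0 dg' hs.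
apply: near_eq_derivable.
apply/nm_nbhsP; exists r; [exact: r0|move=> z zr].
exact: (esym (orbit_derive1E (hg z zr))).
Qed.

Lemma orbit_derive_neq0 m w z :
  (forall w z, W w -> U z -> derive1 (G w) z != 0) ->
  orbit_in W U G m (w, z) -> derive1 (iter m (G w)) z != 0.
Proof.
move=> DG0; elim: m => [|m ih] h.
  by rewrite derive1E (_ : iter 0 (G w) = id)// derive_id oner_neq0.
have hm : orbit_in W U G m (w, z) by case: h => Ww h; split=> // k km; apply: h; exact: ltnW.
have Um : U (iter m (G w) z) by case: h => _; exact.
have Ww : W w by case: h.
have d1 := orbit_derivable hm.
have d2 : derivable (G w) (iter m (G w) z) 1.
  by have := @orbit_derivable 1 w (iter m (G w) z); apply; split=> // k; rewrite ltnS leqn0 => /eqP->.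
rewrite derive1E (_ : iter m.+1 (G w) = G w \o iter m (G w))// derive1_comp_C//.
rewrite -!derive1E; apply: mulf_neq0; [exact: DG0|exact: ih].
Qed.

Lemma orbit_real m w z :
  (forall w z, W w -> U z -> (forall j, imC (w 0 j) = 0) -> imC z = 0 -> imC (G w z) = 0) ->
  (forall j, imC (w 0 j) = 0) -> imC z = 0 -> orbit_in W U G m (w, z) ->
  imC (iter m (G w) z) = 0.
Proof.
move=> Gr wr zr; elim: m => [//|m ih] [Ww h] /=.
apply: Gr => //; first exact: h.
by apply: ih; split=> // k km; apply: h; exact: ltnW.
Qed.

Lemma orbit_derive_real m w (x : R) :
  (forall w z, W w -> U z -> (forall j, imC (w 0 j) = 0) -> imC z = 0 -> imC (G w z) = 0) ->
  (forall j, imC (w 0 j) = 0) -> orbit_in W U G m (w, toC x) ->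
  imC (derive1 (iter m (G w)) (toC x)) = 0.
Proof.
move=> Gr wr h; rewrite derive1E.
have [oO _] := orbit_open_diff m.
have : nbhs (w, toC x) (orbit_in W U G m) by exact: open_nbhs_nbhs.
move/nm_nbhsP => [d d0 hd].
apply: (derive1_real d0); last exact: orbit_derivable.
move=> u ux; apply: orbit_real => //; first exact: im_toC.
apply: hd; rewrite (_ : _ - _ = (0, toC (u - x))); last first.
  by rewrite toCB -[LHS]/((w - w, toC u - toC x)) subrr.
rewrite -(toC_lt C) -normE prod_normE /= normr0 normE nm_toC.
by rewrite /Num.max; case: ifP => _; rewrite -?(toC0 C) toC_lt.
Qed.

Lemma relation_differentiable p (i : 'I_n.+1) (q : nat) (t : target n) w :
  (0 < q)%N -> valid_target q t -> differentiable p w -> orbit_in W U G q.-1 (w, w 0 i) ->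
  differentiable (relation G p i q t) w.
Proof.
move=> q0 tq dp h; apply: differentiableB; first exact: orbit_differentiable.
case: t tq => [m _|l /andP[l0 lq]].
  apply: (@differentiable_comp _ _ _ _ p (fun y : 'rV[C]_n.+1 => y 0 m)) => //.
  exact: differentiable_coord.
apply: orbit_differentiable; case: h => Ww h; split=> // k kl; apply: h.
by case: q q0 lq kl => [//|q] _ /=; case: l l0 => [//|l] _ /=; rewrite ltnS => lq /leq_trans; apply; exact: ltnW.
Qed.

End Orbit.
End Family.

(** * The curve of critical relations *)

Section Regular.
Variables (R : realType) (C : complex_model R) (n : nat).
Variables (W : set 'rV[C]_n.+1) (U : set C) (G : 'rV[C]_n.+1 -> C -> C).
Variables (p : 'rV[C]_n.+1 -> 'rV[C]_n.+1) (q : 'I_n -> nat) (t : 'I_n -> target n).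
Hypotheses (oW : open W) (oU : open U).
Hypothesis dp : forall w, W w -> differentiable p w.
Hypothesis dG : forall x : 'rV[C]_n.+1 * C, (W `*` U) x ->
  differentiable (fun y : 'rV[C]_n.+1 * C => G y.1 y.2) x.
Hypothesis DG0 : forall w z, W w -> U z -> derive1 (G w) z != 0.
Hypothesis q0 : forall j, (0 < q j)%N.
Hypothesis orbU : forall w j k, W w -> (k.+1 < q j)%N -> U (iter k (G w) (w 0 (low j))).
Hypothesis Gconj : forall w z, W w -> U z -> G (map_mx Num.conj w) z^* = (G w z)^*.
Hypothesis pconj : forall w j, W w -> p (map_mx Num.conj w) 0 j = (p w 0 j)^*.
Hypothesis tv : forall j, valid_target (q j) (t j).
Implicit Types (w : 'rV[C]_n.+1) (x e : 'rV[R]_n.+1).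

(** This and the following definitions, up to [pos_normal], restate [Rj], [Vmx], [Lset],
    [regular_points] and [positive_unit_normal] over the abstract model; at [Cx_model] they are
    convertible to the originals. *)
Definition rel_fun (j : 'I_n) := relation G p (low j) (q j) (t j).

Definition orb_der (j : 'I_n) w := derive1 (iter (q j).-1 (G w)) (w 0 (low j)).

Definition normal_mx w : 'M[C]_(n.+1, n) :=
  \matrix_(i < n.+1, j < n) ((orb_der j w)^-1 * 'D_(delta_mx 0 i) (rel_fun j) w).

Definition crit_set : set 'rV[C]_n.+1 :=
  [set w | W w /\ forall j : 'I_n,
    let orb k := iter k (G w) (w 0 (low j)) in
    let P0 := [set p w 0 m | m in [set: 'I_n.+1]] in
    match t j with
    | Mu m => orb (q j).-1 = p w 0 m /\ forall k, (k < (q j).-1)%N -> ~ P0 (orb k)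
    | El l => orb (q j).-1 = orb l.-1 /\ forall k, (k <= (q j).-1)%N -> ~ P0 (orb k)
    end].

Definition regular : set 'rV[R]_n.+1 :=
  [set x | crit_set (vecC C x) /\ \rank (normal_mx (vecC C x)) = n].

Definition pos_normal x e :=
  let V := normal_mx (vecC C x) in
  [/\ \sum_i e 0 i ^+ 2 = 1,
      forall y : 'cV[C]_n, \sum_i (V *m y) i 0 * vecC C e 0 i = 0 &
      0 < \det (\matrix_(i < n.+1, j < n.+1) ext_last (V i) (vecC C e 0 i) j)].

Lemma orbW j w : W w -> orbit_in W U G (q j).-1 (w, w 0 (low j)).
Proof.
move=> Ww; split=> // k kq; apply: orbU => //.
by move: kq (q0 j); case: (q j) => [//|m] /=; rewrite ltnS.
Qed.

Lemma rel_fun_differentiable j w : W w -> differentiable (rel_fun j) w.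
Proof. by move=> Ww; apply: (relation_differentiable oW oU dG) => //; [exact: dp|exact: orbW]. Qed.

Lemma orb_der_neq0 j w : W w -> orb_der j w != 0.
Proof. by move=> Ww; apply: (orbit_derive_neq0 oW oU dG) => //; exact: orbW. Qed.

Lemma conj_real_row w : (forall j, imC (w 0 j) = 0) -> map_mx Num.conj w = w.
Proof.
move=> h; apply/rowP => j; rewrite mxE; apply: C_ext; rewrite ?re_conj ?im_conj//.
by rewrite h oppr0.
Qed.

Lemma conj_real z : imC z = 0 -> z^* = z :> C.
Proof. by move=> h; apply: C_ext; rewrite ?re_conj ?im_conj// h oppr0. Qed.

Lemma real_conj (z : C) : z^* = z -> imC z = 0.
Proof. by move=> h; have := congr1 (@imC R C) h; rewrite im_conj; lra. Qed.

Lemma G_real w z : W w -> U z -> (forall j, imC (w 0 j) = 0) -> imC z = 0 -> imC (G w z) = 0.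
Proof.
by move=> Ww Uz wr zr; apply: real_conj; rewrite -Gconj// conj_real_row// conj_real.
Qed.

Lemma p_real w m : W w -> (forall j, imC (w 0 j) = 0) -> imC (p w 0 m) = 0.
Proof. by move=> Ww wr; apply: real_conj; rewrite -pconj// conj_real_row. Qed.

Lemma orbW_le j w k : W w -> (k <= (q j).-1)%N -> orbit_in W U G k (w, w 0 (low j)).
Proof. by move=> /(orbW j)[Ww h] kq; split=> // i ik; apply: h; exact: leq_trans kq. Qed.

Lemma El_le j l : t j = El _ l -> (l.-1 <= (q j).-1)%N.
Proof.
move=> tE; have := tv j; rewrite tE => /andP[l0 lq].
by move: l0 lq; case: l tE => // l _ _; case: (q j) => //= m /ltnW.
Qed.

Lemma rel_fun_real j w : W w -> (forall k, imC (w 0 k) = 0) -> imC (rel_fun j w) = 0.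
Proof.
move=> Ww wr; rewrite /rel_fun /relation imB.
rewrite (orbit_real G_real wr (wr _) (orbW j Ww)) sub0r.
case E: (t j) => [m|l]; first by rewrite p_real// oppr0.
by rewrite (orbit_real G_real wr (wr _) (orbW_le Ww (El_le E))) oppr0.
Qed.

Lemma orb_der_real j x : W (vecC C x) -> imC (orb_der j (vecC C x)) = 0.
Proof.
move=> Wx; rewrite /orb_der [X in derive1 _ X]mxE.
apply: (orbit_derive_real oW oU dG G_real (vecC_real C x)).
by have := orbW j Wx; rewrite [X in (_, X)]mxE.
Qed.

Definition real_mx x : 'M[R]_(n.+1, n) := map_mx (@reC R C) (normal_mx (vecC C x)).

(** Conjugation symmetry makes the relations and the orbit derivatives real at real points, and
    derivatives in the real directions are limits of real quotients. *)
Lemma normal_mx_real x : W (vecC C x) -> normal_mx (vecC C x) = map_mx toC (real_mx x).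
Proof.
move=> Wx; apply/matrixP => i j; rewrite [RHS]mxE [in RHS]mxE.
apply: C_ext; rewrite ?re_toC ?im_toC// mxE imM.
have [r r0 hr] : exists2 r : R, 0 < r & forall y, nm (y - vecC C x) < r -> W y.
  exact/nm_nbhsP/open_nbhs_nbhs.
have -> : imC ('D_(delta_mx 0 i) (rel_fun j) (vecC C x)) = 0.
  have -> : delta_mx 0 i = vecC C (delta_mx 0 i) :> 'rV[C]_n.+1.
    by apply/rowP => k; rewrite !mxE rmorph_nat.
  apply: (derive_real r0).
    by move=> y /hr Wy; exact: rel_fun_real.
  by apply: diff_derivable; exact: rel_fun_differentiable.
have -> : imC (orb_der j (vecC C x))^-1 = 0.
  have -> : orb_der j (vecC C x) = toC (reC (orb_der j (vecC C x))).
    by apply: C_ext; rewrite ?re_toC ?im_toC ?orb_der_real.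
  by rewrite -fmorphV im_toC.
by rewrite mulr0 mul0r addr0.
Qed.

Lemma rank_real_mx x : W (vecC C x) -> \rank (normal_mx (vecC C x)) = \rank (real_mx x).
Proof. by move=> /normal_mx_real ->; rewrite mxrank_map. Qed.

Lemma add_col_map x e : W (vecC C x) ->
  add_col (normal_mx (vecC C x)) (vecC C e) = map_mx toC (add_col (real_mx x) e).
Proof.
move=> Wx; rewrite normal_mx_real//; apply/matrixP => i j.
rewrite [RHS]mxE; case: (unliftP ord_max j) => [k ->|->].
  by rewrite !add_col_low mxE.
by rewrite !add_col_max mxE.
Qed.

Lemma pos_normalE x e : W (vecC C x) -> pos_normal x e <->
  [/\ \sum_i e 0 i ^+ 2 = 1, e *m real_mx x = 0 & 0 < \det (add_col (real_mx x) e)].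
Proof.
move=> Wx.
have detE : \det (\matrix_(i < n.+1, j < n.+1) ext_last (normal_mx (vecC C x) i) (vecC C e 0 i) j)
    = toC (\det (add_col (real_mx x) e)).
  rewrite -[LHS]/(\det (add_col (normal_mx (vecC C x)) (vecC C e))).
  by rewrite add_col_map// det_map_mx.
have orthE j : \sum_i normal_mx (vecC C x) i j * vecC C e 0 i = toC ((e *m real_mx x) 0 j).
  rewrite [X in toC X]mxE rmorph_sum; apply: eq_bigr => i _.
  by rewrite normal_mx_real// [map_mx _ _ i j]mxE [vecC C e 0 i]mxE -toCM mulrC.
have detP y : (0 < toC y :> C) = (0 < y) by rewrite -{1}(toC0 C) toC_lt.
rewrite /pos_normal /= detE detP; split=> -[h1 h2 h3]; split=> //.
  apply/rowP => j; apply: (@toC_inj R C); rewrite -orthE [X in toC X]mxE toC0.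
  apply: etrans (h2 (delta_mx j 0)).
  apply: eq_bigr => i _; congr (_ * _); rewrite [RHS]mxE (bigD1 j)//= big1 => [|k kj].
    by rewrite [delta_mx _ _ _ _]mxE !eqxx mulr1 addr0.
  by rewrite [delta_mx _ _ _ _]mxE (negbTE kj) mulr0.
move=> y.
transitivity (\sum_j y j 0 * \sum_i normal_mx (vecC C x) i j * vecC C e 0 i); last first.
  by rewrite big1// => j _; rewrite orthE h2 mxE toC0 mulr0.
under [RHS]eq_bigr do rewrite mulr_sumr.
rewrite exchange_big; apply: eq_bigr => i _; rewrite [in LHS]mxE mulr_suml.
by apply: eq_bigr => j _; ring.
Qed.

Lemma pos_normal_cross x e : regular x ->
  pos_normal x e <-> e = (Num.sqrt (\sum_i cross (real_mx x) 0 i ^+ 2))^-1 *: cross (real_mx x).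
Proof.
move=> [[Wx _] rx]; apply: iff_trans (pos_normalE e Wx) _.
by apply: unit_normalP; rewrite -rank_real_mx.
Qed.

Lemma diff_row (F : 'rV[C]_n.+1 -> C) w (v : 'rV[C]_n.+1) : differentiable F w ->
  'd F w v = \sum_i v 0 i * 'D_(delta_mx 0 i) F w.
Proof.
move=> dF; rewrite {1}[v]row_sum_delta linear_sum; apply: eq_bigr => i _.
by rewrite linearZ /= -deriveE.
Qed.

Lemma normal_mx_curve (g : C -> 'rV[C]_n.+1) (s : C) (r : R) i j : 0 < r ->
  (forall z : C, nm (z - s) < r -> derivable g z 1) ->
  (forall z : C, nm (z - s) < r -> W (g z)) ->
  derivable (fun z => normal_mx (g z) i j) s 1.
Proof.
move=> r0 dg Wg.
have Ws : W (g s) by apply: Wg; rewrite subrr nm0.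
have -> : (fun z => normal_mx (g z) i j) =
    (fun z => (orb_der j (g z))^-1) * (fun z => 'D_(delta_mx 0 i) (rel_fun j) (g z)).
  by apply/funext => z; rewrite mxE.
apply: derivableM.
  apply: derivableV; first exact: orb_der_neq0.
  by apply: (orbit_derive_curve oW oU dG r0 dg) => z /Wg; exact: orbW.
exact: (derivable_dderive oW (rel_fun_differentiable j) r0 dg Ws).
Qed.

Lemma det_normal_mx_curve (g : C -> 'rV[C]_n.+1) (s : C) (r : R) (v : 'rV[C]_n.+1) : 0 < r ->
  (forall z : C, nm (z - s) < r -> derivable g z 1) ->
  (forall z : C, nm (z - s) < r -> W (g z)) ->
  derivable (fun z => \det (add_col (normal_mx (g z)) v)) s 1.
Proof.
move=> r0 dg Wg; apply: derivable_det => i j; case: (unliftP ord_max j) => [k ->|->].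
  have -> : (fun z => add_col (normal_mx (g z)) v i (lift ord_max k)) = fun z => normal_mx (g z) i k.
    by apply/funext => z; rewrite add_col_low.
  exact: (@normal_mx_curve g s r i k r0 dg Wg).
have -> : (fun z => add_col (normal_mx (g z)) v i ord_max) = cst (v 0 i).
  by apply/funext => z; rewrite add_col_max.
exact: derivable_cst.
Qed.

Lemma velocity_normal (g : C -> 'rV[C]_n.+1) (s : C) (r : R) : 0 < r ->
  derivable g s 1 -> W (g s) ->
  (forall z : C, nm (z - s) < r -> forall j, rel_fun j (g z) = 0) ->
  'D_1 g s *m normal_mx (g s) = 0.
Proof.
move=> r0 dg Ws Rg; apply/rowP => j; rewrite !mxE.
under eq_bigr do rewrite [normal_mx _ _ _]mxE mulrCA.
rewrite -mulr_sumr -diff_row; last exact: rel_fun_differentiable.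
suff -> : 'd (rel_fun j) (g s) ('D_1 g s) = 0 by rewrite mulr0.
have dgd := (derivable1_diffP _ _).1 dg.
have dR := rel_fun_differentiable j Ws.
have D1 : 'D_1 (rel_fun j \o g) s = 'd (rel_fun j \o g) s 1.
  by apply: deriveE; exact: differentiable_comp.
have D2 : 'D_1 g s = 'd g s 1 by exact: deriveE.
have D3 : 'd (rel_fun j \o g) s 1 = 'd (rel_fun j) (g s) ('d g s 1).
  exact: (congr1 (fun F : C -> C => F 1) (diff_comp dgd dR)).
rewrite D2 -D3 -D1.
have -> : 'D_1 (rel_fun j \o g) s = 'D_1 (cst 0 : C -> C) s.
  by apply: near_eq_derive; apply/nm_nbhsP; exists r => // z /Rg h; exact: h.
exact: derive_cst.
Qed.

Lemma nbhs_forall (I : finType) (P : I -> C -> Prop) (z : C) :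
  (forall i, nbhs z (P i)) -> nbhs z (fun s => forall i, P i s).
Proof. by move=> h; exact: (@filter_forall _ _ P (nbhs z) (nbhs_filter z) h). Qed.

Lemma det_add_col_rank (V : 'M[R]_(n.+1, n)) e : \det (add_col V e) != 0 -> \rank V = n.
Proof.
move=> d0; have uV : (add_col V e)^T \in unitmx by rewrite unitmx_tr unitmxE unitfE.
suff : row_free V^T by rewrite /row_free mxrank_tr => /eqP.
apply: inj_row_free => y yV.
pose y' : 'rV[R]_n.+1 := \row_i ext_last (y 0) 0 i.
have : y' *m (add_col V e)^T = 0.
  apply/rowP => i; rewrite [LHS]mxE [RHS]mxE (bigD1_ord ord_max) //=.
  rewrite [y' 0 ord_max]mxE ext_last_max mul0r add0r.
  have : (y *m V^T) 0 i = 0 by rewrite yV mxE.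
  rewrite mxE; apply: etrans; apply: eq_bigr => j _.
  by rewrite [y' 0 _]mxE ext_last_low [_^T _ _]mxE add_col_low [V^T _ _]mxE.
move/(congr1 (mulmx^~ (invmx (add_col V e)^T))); rewrite mulmxK// mul0mx => y0.
apply/rowP => j; rewrite [RHS]mxE.
by have := congr1 (fun M : 'rV[R]_n.+1 => M 0 (lift ord_max j)) y0; rewrite !mxE ext_last_low.
Qed.

Lemma crit_set_rel w j : crit_set w -> rel_fun j w = 0.
Proof.
move=> [_ /(_ j)]; rewrite /rel_fun /relation.
by case: (t j) => [m|l] /= [-> _]; rewrite subrr.
Qed.

(** Besides the equations, which are assumed along g, membership consists of finitely many
    conditions of the form orbit point different from marked point, indexed by j, k and m; these
    persist by continuity. *)
Lemma crit_set_near (g : C -> 'rV[C]_n.+1) : derivable g 0 1 -> crit_set (g 0) ->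
  exists2 d : R, 0 < d & forall s : C, nm s < d -> W (g s) ->
    (forall j, rel_fun j (g s) = 0) -> crit_set (g s).
Proof.
move=> dg cg; have W0 : W (g 0) by case: cg.
have orbC j k : (k <= (q j).-1)%N ->
    {for (0 : C), continuous (fun s => iter k (G (g s)) (g s 0 (low j)))}.
  move=> kq; apply: derivable_continuous.
  apply: (@derivable_comp_diff _ _ _ _ (fun w => iter k (G w) (w 0 (low j)))) => //.
  apply: (orbit_differentiable oW oU dG); exact: orbW_le.
have pC m : {for (0 : C), continuous (fun s => p (g s) 0 m)}.
  apply: derivable_continuous.
  apply: (@derivable_comp_diff _ _ _ _ (fun w => p w 0 m)) => //.
  apply: (@differentiable_comp _ _ _ _ p (fun y : 'rV[C]_n.+1 => y 0 m)); first exact: dp.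
  exact: differentiable_coord.
have /nm_nbhsP[d d0 hd] : nbhs (0 : C) [set s | forall (j : 'I_n) (k : 'I_(q j)) (m : 'I_n.+1),
    iter k (G (g 0)) (g 0 0 (low j)) != p (g 0) 0 m ->
    iter k (G (g s)) (g s 0 (low j)) != p (g s) 0 m].
  apply: nbhs_forall => j; apply: nbhs_forall => k; apply: nbhs_forall => m.
  have kq : (k <= (q j).-1)%N by rewrite -ltnS prednK.
  have [E|NE] := eqVneq (iter k (G (g 0)) (g 0 0 (low j))) (p (g 0) 0 m).
    by apply/nm_nbhsP; exists 1.
  have c : {for (0 : C), continuous (fun s => iter k (G (g s)) (g s 0 (low j)) - p (g s) 0 m)}.
    exact: continuousB (orbC j k kq) (pC m).
  have e0 : 0 < nm (iter k (G (g 0)) (g 0 0 (low j)) - p (g 0) 0 m) by rewrite nm_gt0 subr_eq0.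
  have [d d0 hd] := (nm_contP _ _).1 c _ e0.
  apply/nm_nbhsP; exists d => // s sd _; rewrite -subr_eq0; apply/eqP => E.
  by have := hd s sd; rewrite /= E sub0r nmN ltxx.
exists d => // s sd Ws Rs; split=> // j.
have hs := hd s; rewrite subr0 in hs.
have avoid k : (k < q j)%N -> (~ [set p (g 0) 0 m | m in [set: 'I_n.+1]] (iter k (G (g 0)) (g 0 0 (low j)))) ->
    ~ [set p (g s) 0 m | m in [set: 'I_n.+1]] (iter k (G (g s)) (g s 0 (low j))).
  move=> kq h0 [m _ E]; have := hs sd j (Ordinal kq) m; rewrite /= E eqxx => /(_ _)/wrap[]//.
  by apply/eqP => E0; apply: h0; exists m.
have := Rs j; case: cg => _ /(_ j); rewrite /rel_fun /relation.
case: (t j) => [m|l] /= [_ av] /subr0_eq E; split=> // k kq; apply: avoid; try exact: av.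
  by rewrite (leq_trans kq)// leq_pred.
by rewrite -(prednK (q0 j)) ltnS.
Qed.

Definition height x e w : C := \sum_i (w - vecC C x) 0 i * toC (e 0 i).

(** A complex arc of common zeros parametrized by height, unique in the ball of radius rho. The
    positive determinant against the fixed vector e serves twice: it preserves the rank along the
    arc and it fixes the direction of the velocity. *)
Definition is_arc x e (g : C -> 'rV[C]_n.+1) (d rho : R) :=
  [/\ 0 < d, 0 < rho,
    forall s : C, nm s < d -> [/\ nm (g s - vecC C x) < rho, derivable g s 1, W (g s) &
      height x e (g s) = s],
    forall s : C, nm s < d -> [/\ forall j, rel_fun j (g s) = 0,
      0 < reC (\det (add_col (normal_mx (g s)) (vecC C e))) &
      imC s = 0 -> (forall j, imC (g s 0 j) = 0) /\ crit_set (g s)] &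
    forall w, nm (w - vecC C x) < rho -> (forall j, rel_fun j w = 0) ->
      nm (height x e w) < d -> w = g (height x e w)].

Lemma local_arc x e : regular x -> 0 < \det (add_col (real_mx x) e) ->
  exists g d rho, is_arc x e g d rho.
Proof.
move=> [cx rx] de; have Wx : W (vecC C x) by case: cx.
have [r r0 hr] : exists2 r : R, 0 < r & forall y, nm (y - vecC C x) < r -> W y.
  exact/nm_nbhsP/open_nbhs_nbhs.
pose a j := (orb_der j (vecC C x))^-1.
have ar j : imC (a j) = 0.
  have -> : a j = toC (reC (orb_der j (vecC C x)))^-1.
    by rewrite fmorphV; congr (_^-1); apply: C_ext; rewrite ?re_toC ?im_toC ?orb_der_real.
  exact: im_toC.
(* With the factor frozen at x, the gradient of [F j] at x is column j of V_x, and the zeros are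
   those of [rel_fun j]. *)
pose F j w := a j * rel_fun j w.
have [||||||g [d1 [rho [d10 rho0 rhor hg hu]]]] :=
    @implicit_curve R C n F x e (add_col (real_mx x) e) r r0.
- move=> j w /hr Ww; apply: differentiableM; first exact: differentiable_cst.
  exact: rel_fun_differentiable.
- by move=> j w /hr Ww wr; rewrite /F imM ar rel_fun_real// mulr0 mul0r addr0.
- by move=> j; rewrite /F crit_set_rel// mulr0.
- move=> i j; rewrite add_col_low mxE; congr reC; rewrite mxE.
  have dR : derivable (rel_fun j) (vecC C x) (delta_mx 0 i).
    by apply: diff_derivable; exact: rel_fun_differentiable.
  exact: (esym (deriveZ (a j) dR)).
- by move=> i; rewrite add_col_max.
- by rewrite unitmxE unitfE gt_eqF.
have Wg (s : C) : nm s < d1 -> W (g s).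
  by move=> sd; apply: hr; have [h _ _ _ _] := hg s sd; exact: lt_le_trans h rhor.
have Rg (s : C) : nm s < d1 -> forall j, rel_fun j (g s) = 0.
  move=> sd j; have [_ _ h _ _] := hg s sd; have := h j => /eqP.
  by rewrite mulf_eq0 invr_eq0 (negbTE (orb_der_neq0 j Wx)) => /eqP.
have g0 : g 0 = vecC C x.
  have h0 : \sum_i (0 : 'rV[C]_n.+1) 0 i * toC (e 0 i) = 0.
    by rewrite big1// => i _; rewrite mxE mul0r.
  have := hu (vecC C x); rewrite subrr nm0 h0 nm0 => /(_ rho0 _ d10) -> //.
  by move=> j; rewrite /F crit_set_rel// mulr0.
have n00 : nm (0 : C) < d1 by rewrite nm0.
have dg0 : derivable g 0 1 by have [] := hg 0 n00.
have cg0 : crit_set (g 0) by rewrite g0.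
have [d2 d20 hd2] := crit_set_near dg0 cg0.
have dsub (s : C) : nm (s - 0) < d1 -> nm s < d1 by rewrite subr0.
have dets : derivable (fun z => \det (add_col (normal_mx (g z)) (vecC C e))) 0 1.
  apply: (@det_normal_mx_curve g 0 d1 (vecC C e) d10) => z /dsub zd; first by have [] := hg z zd.
  exact: Wg.
have e0 : 0 < \det (add_col (real_mx x) e) by [].
have [d3 d30 hd3] := (nm_contP _ _).1 (derivable_continuous dets) _ e0.
exists g, (Num.min d1 (Num.min d2 d3)), rho; split.
- by rewrite !lt_min d10 d20 d30.
- exact: rho0.
- move=> s; rewrite !lt_min => /and3P[s1 s2 s3]; have [h1 h2 h3 h4 h5] := hg s s1.
  by split; [exact: h1|exact: h2|exact: Wg|exact: h4].
- move=> s; rewrite !lt_min => /and3P[s1 s2 s3]; have [h1 h2 h3 h4 h5] := hg s s1.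
  split; [exact: Rg| |].
    have := hd3 s; rewrite subr0 => /(_ s3); rewrite g0 add_col_map// det_map_mx => h.
    by have := le_lt_trans (Re_le _) h; rewrite reB re_toC ltr_norml => /andP[]; lra.
  by move=> sr; split; [exact: h5|apply: hd2 => //; [exact: Wg|exact: Rg]].
- move=> w wr Rw; rewrite !lt_min => /and3P[h1 h2 h3]; apply: hu => // j.
  by rewrite /F Rw mulr0.
Qed.

(** * The real arc and its velocity *)

Section Arc.
Variables (x e : 'rV[R]_n.+1) (g : C -> 'rV[C]_n.+1) (d rho : R).
Hypothesis harc : is_arc x e g d rho.

Definition arc (u : R) : 'rV[R]_n.+1 := vecR (g (toC u)).

Lemma toC_lt_d (u : R) : `|u| < d -> nm (toC u : C) < d.
Proof. by rewrite nm_toC. Qed.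

Lemma arc_vecC (u : R) : `|u| < d -> vecC C (arc u) = g (toC u).
Proof.
move=> /toC_lt_d ud; have [_ _ _ h _] := harc; have [_ _ h2] := h _ ud.
by rewrite vecRK//; exact: (h2 (im_toC _ _)).1.
Qed.

Lemma arc_det_gt0 (u : R) : `|u| < d -> 0 < \det (add_col (real_mx (arc u)) e).
Proof.
move=> ud; have [_ _ hW h _] := harc; have [_ h1 _] := h _ (toC_lt_d ud).
have [_ _ Wu _] := hW _ (toC_lt_d ud).
by rewrite -arc_vecC// add_col_map ?det_map_mx ?re_toC// in h1; rewrite arc_vecC.
Qed.

Lemma arc_regular (u : R) : `|u| < d -> regular (arc u).
Proof.
move=> ud; have [_ _ hW h _] := harc; have [_ _ /(_ (im_toC _ _))[_ cu]] := h _ (toC_lt_d ud).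
split; first by rewrite arc_vecC.
rewrite rank_real_mx; last by rewrite arc_vecC//; case: cu.
by apply: (@det_add_col_rank _ e); rewrite gt_eqF// arc_det_gt0.
Qed.

Lemma height_vecC (y : 'rV[R]_n.+1) :
  height x e (vecC C y) = toC (\sum_i (y - x) 0 i * e 0 i).
Proof.
rewrite /height rmorph_sum; apply: eq_bigr => i _; rewrite -vecCB [vecC C _ _ _]mxE /=.
by rewrite toCM.
Qed.

Lemma arc_height (u : R) : `|u| < d -> \sum_i (arc u - x) 0 i * e 0 i = u.
Proof.
move=> ud; have [_ _ h _ _] := harc; have [_ _ _ h4] := h _ (toC_lt_d ud).
by apply: (@toC_inj R C); rewrite -height_vecC arc_vecC.
Qed.

Lemma arc_unique (y : 'rV[R]_n.+1) : regular y -> `|y - x| < rho ->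
  `|\sum_i (y - x) 0 i * e 0 i| < d -> y = arc (\sum_i (y - x) 0 i * e 0 i).
Proof.
move=> [cy _] yr yd; have [_ _ _ _ hu] := harc.
have h1 : nm (vecC C y - vecC C x) < rho by rewrite -vecCB nm_vecC.
have := hu (vecC C y) h1 (fun j => crit_set_rel j cy).
by rewrite height_vecC nm_toC => /(_ yd) E; rewrite /arc -E vecCK.
Qed.

Lemma arc_near (u : R) : `|u| < d -> `|arc u - x| < rho.
Proof.
move=> ud; have [_ _ h _ _] := harc; have [h1 _ _ _] := h _ (toC_lt_d ud).
by rewrite -(nm_vecC C) vecCB arc_vecC.
Qed.

Definition velocity (u : R) : 'rV[R]_n.+1 := vecR ('D_1 g (toC u)).

Lemma arc_disc (u : R) : `|u| < d -> forall z : C, nm (z - toC u) < d - `|u| -> nm z < d.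
Proof.
by move=> ud z; have := nmD (z - toC u) (toC u); rewrite subrK nm_toC; lra.
Qed.

Lemma arc_is_derive (u : R) : `|u| < d -> is_derive u 1 arc (velocity u).
Proof.
move=> ud; have [_ _ h _ _] := harc; have [_ h2 _ _] := h _ (toC_lt_d ud).
exact/is_derive_vecR/derivableP.
Qed.

Lemma velocity_vecC (u : R) : `|u| < d -> vecC C (velocity u) = 'D_1 g (toC u).
Proof.
move=> ud; have [_ _ h h' _] := harc; have [_ h2 _ _] := h _ (toC_lt_d ud).
apply: vecRK => j.
have [dj <-] : is_derive (toC u) 1 (fun z => g z 0 j) ('D_1 g (toC u) 0 j).
  by have /derivableP/is_derive_mxP := h2; exact.
have ud0 : 0 < d - `|u| by rewrite subr_gt0.
apply: (derive1_real ud0) dj => v uv.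
have vd : `|v| < d by have := ler_normD (v - u) u; rewrite subrK; lra.
have [_ _ /(_ (im_toC _ _))[hr _]] := h' _ (toC_lt_d vd); exact: hr.
Qed.

Lemma velocity_orthogonal (u : R) : `|u| < d -> velocity u *m real_mx (arc u) = 0.
Proof.
move=> ud; have [_ _ h h' _] := harc; have [_ h2 h3 _] := h _ (toC_lt_d ud).
have ud0 : 0 < d - `|u| by rewrite subr_gt0.
have hz (z : C) : nm (z - toC u) < d - `|u| -> forall j, rel_fun j (g z) = 0.
  by move=> /(arc_disc ud) zd; have [] := h' z zd.
have := velocity_normal ud0 h2 h3 hz.
rewrite -velocity_vecC// -arc_vecC// normal_mx_real ?arc_vecC// => E.
apply/rowP => j; apply: (@toC_inj R C).
have := congr1 (fun M : 'rV[C]_n => M 0 j) E; rewrite -map_mxM [LHS]mxE => ->.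
by rewrite mxE [X in toC X]mxE toC0.
Qed.

(** The height of g s is s, so its derivative, the pairing of the velocity with e, is 1. *)
Lemma velocity_height (u : R) : `|u| < d -> \sum_i velocity u 0 i * e 0 i = 1.
Proof.
move=> ud; have [_ _ h _ _] := harc; have [_ h2 _ _] := h _ (toC_lt_d ud).
pose l (v : 'rV[C]_n.+1) := (v *m (vecC C e)^T) 0 0.
have lE v : l v = \sum_i v 0 i * toC (e 0 i).
  by rewrite /l mxE; apply: eq_bigr => i _; rewrite !mxE.
suff E : l ('D_1 g (toC u)) = 1.
  apply: (@toC_inj R C); rewrite toC1 -E -velocity_vecC// lE rmorph_sum.
  by apply: eq_bigr => i _; rewrite [vecC C _ _ _]mxE /= toCM.
pose K := n.+1%:R * nm (vecC C e)^T.
have K0 : 0 <= K by rewrite mulr_ge0 ?nm_ge0.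
have lK v : nm (l v) <= K * nm v by rewrite (le_trans (nm_coord _ _ _))// nm_mulmx.
have ud0 : 0 < d - `|u| by rewrite subr_gt0.
apply/eqP; rewrite eq_sym -subr_eq0 -nm_eq0 eq_le nm_ge0 andbT.
apply: (@le_of_linear _ _ K 1) => // eps eps0 _.
have /derivableP/is_derive_nmP/(_ _ eps0)[dd dd0 hdd] := h2.
pose k := Num.min dd (d - `|u|) / 2.
have k0 : 0 < k by rewrite divr_gt0// lt_min dd0.
have kn : nm (toC k : C) = k by rewrite nm_toC gtr0_norm.
have kdd : k < dd.
  have : Num.min dd (d - `|u|) <= dd by rewrite ge_min lexx.
  by rewrite /k; lra.
have kd : k < d - `|u|.
  have : Num.min dd (d - `|u|) <= d - `|u| by rewrite ge_min lexx orbT.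
  by rewrite /k; lra.
have := hdd (toC k); rewrite kn => /(_ kdd); rewrite [toC k *: 1]mulr1.
set D := 'D_1 g _; clearbody D; set v := _ - _ - _ => hv.
have nk : nm (toC u + toC k : C) < d.
  by rewrite (le_lt_trans (nmD _ _))// kn nm_toC; lra.
have [_ _ _ hk] := h _ nk; have [_ _ _ hu] := h _ (toC_lt_d ud).
have lv : l v = toC k * (1 - l D).
  have -> : l v = height x e (g (toC u + toC k)) - height x e (g (toC u)) - toC k * l D.
    rewrite !lE /height mulr_sumr -!sumrB; apply: eq_bigr => i _.
    by rewrite !mxE; ring.
  by rewrite hk hu; ring.
have := le_trans (lK v) (ler_wpM2l K0 hv); rewrite lv nmM kn.
by rewrite mulrA [_ * k]mulrC ler_pM2l.
Qed.

End Arc.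

(** * The maximal curve, its orientation and the analyticity of E *)

Section Curve.
Variable Ls : set 'rV[R]_n.+1.
Hypothesis Ls_max : maximal_connected regular Ls.

Lemma Ls_regular x : Ls x -> regular x.
Proof. by case: Ls_max => h _ _; exact: h. Qed.

Lemma regularW x : regular x -> W (vecC C x).
Proof. by case=> -[]. Qed.

Lemma real_mx_rank x : regular x -> \rank (real_mx x) = n.
Proof. by move=> rx; rewrite -rank_real_mx; [case: rx|exact: regularW]. Qed.

Lemma unique_pos_normal x : regular x -> exists! e, pos_normal x e.
Proof.
move=> rx; exists ((Num.sqrt (\sum_i cross (real_mx x) 0 i ^+ 2))^-1 *: cross (real_mx x)).
by split=> [|e' /(pos_normal_cross _ rx) ->//]; apply/pos_normal_cross.
Qed.

Lemma arc_start x e g d rho : is_arc x e g d rho -> regular x -> arc g 0 = x.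
Proof.
move=> ha rx; have [d0 rho0 _ _ _] := ha.
have E : \sum_i (x - x) 0 i * e 0 i = 0 by rewrite big1// => i _; rewrite subrr mxE mul0r.
by have := arc_unique ha rx; rewrite E subrr !normr0 => /(_ rho0 d0).
Qed.

Lemma arc_continuous x e g d rho u : is_arc x e g d rho -> `|u| < d ->
  {for u, continuous (arc g)}.
Proof.
move=> ha ud; apply: differentiable_continuous; apply/derivable1_diffP.
by have [] := arc_is_derive ha ud.
Qed.

Lemma arc_in_Ls x e g d rho : is_arc x e g d rho -> Ls x -> forall u, `|u| < d -> Ls (arc g u).
Proof.
move=> ha Lx u ud; have [d0 _ _ _ _] := ha; have [LR cL Lmax] := Ls_max.
have rx := Ls_regular Lx.
suff <- : Ls `|` arc g @` [set` `]- d, d[] = Ls.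
  by right; exists u => //=; rewrite in_itv /= -ltr_norml.
apply: Lmax; first exact: subsetUl.
  rewrite subUset; split=> // _ [v /= + <-]; rewrite in_itv /= -ltr_norml => vd.
  exact: arc_regular ha _ vd.
apply: connectedU => //.
  exists x; split=> //; exists 0; last exact: arc_start ha rx.
  by rewrite /= in_itv /= oppr_lt0 d0.
apply: connected_continuous_connected.
  by apply/connected_intervalP; exact: interval_is_interval.
apply: continuous_in_subspaceT => v; rewrite inE /= in_itv /= -ltr_norml.
exact: arc_continuous ha.
Qed.

Lemma height_continuous x e :
  continuous (fun y : 'rV[R]_n.+1 => \sum_i (y - x) 0 i * e 0 i).
Proof.
apply: continuous_big; first exact: add_continuous.
move=> i _ y; apply: (@continuousM _ _ (fun y : 'rV[R]_n.+1 => (y - x) 0 i) (cst (e 0 i)) y); last exact: cst_continuous.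
apply: (@continuous_comp _ _ _ (fun y : 'rV[R]_n.+1 => y - x) (fun y : 'rV[R]_n.+1 => y 0 i) y).
  by apply: continuousB; [exact: cvg_id|exact: cst_continuous].
exact: coord_continuous.
Qed.

Lemma arc_analytic_param x e g d rho : is_arc x e g d rho -> Ls x ->
  analytic_param Ls (- d) d (arc g).
Proof.
move=> ha Lx; have [d0 _ hg _ _] := ha.
have IE (s : R) : - d < s < d -> `|s| < d by rewrite -ltr_norml.
split.
- by move=> s /IE; exact: arc_in_Ls ha Lx s.
- move=> s /IE sd; split.
    have s0 : 0 < d - `|s| by rewrite subr_gt0.
    apply: (@analytic_of_derivable _ _ _ g s _ s0) => z /(arc_disc sd) zd.
    by have [] := hg z zd.
  have [_ E] := arc_is_derive ha sd; rewrite derive1E E; apply/eqP => v0.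
  have := velocity_height ha sd; rewrite v0 big1 => [/esym/eqP|i _]; first by rewrite oner_eq0.
  by rewrite mxE mul0r.
- move=> s s' /IE sd /IE s'd E.
  by have h1 := arc_height ha sd; have h2 := arc_height ha s'd; rewrite E in h1; rewrite -h1 h2.
- move=> J oJ JI; pose ht (y : 'rV[R]_n.+1) := \sum_i (y - x) 0 i * e 0 i.
  have cht : continuous ht := @height_continuous x e.
  (* The image of J consists of the points of [Ls] in the uniqueness ball whose height lies in J;
     [arc_unique] puts every such point on the arc. *)
  exists ([set y | `|y - x| < rho] `&` ht @^-1` J).
    apply: openI; last by apply: open_comp.
    rewrite -[X in open X]/((fun y => `|y - x|) @^-1` [set r | r < rho]).
    apply: open_comp; last exact: open_lt.
    move=> y _; apply: (@continuous_comp _ _ _ (fun y : 'rV[R]_n.+1 => y - x) (fun y => `|y|) y).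
      by apply: continuousB; [exact: cvg_id|exact: cst_continuous].
    exact: norm_continuous.
  apply/seteqP; split.
    move=> _ [s Js <-]; have sd := IE s (JI s Js).
    split; first exact: arc_in_Ls ha Lx s sd.
    have near_s := arc_near ha sd; have height_s := arc_height ha sd.
    by split; [exact: near_s|rewrite /= /ht height_s].
  move=> y [Ly [yr Jy]]; exists (ht y) => //; apply/esym.
  by apply: (arc_unique ha (Ls_regular Ly) yr); exact: IE _ (JI _ Jy).
Qed.

Lemma real_analytic_near (m : nat) (f h : R -> 'rV[R]_m.+1) (s r : R) : 0 < r ->
  (forall u, `|u - s| < r -> f u = h u) -> real_analytic_at f s -> real_analytic_at h s.
Proof.
move=> r0 fh [a [e [e0 he]]]; exists a, (Num.min e r); split; first by rewrite lt_min e0.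
by move=> u; rewrite lt_min => /andP[ue ur]; rewrite -fh//; exact: he.
Qed.

Variable E : 'rV[R]_n.+1 -> 'rV[R]_n.+1.
Hypothesis hE : forall x, Ls x -> pos_normal x (E x).

Lemma E_cross x : Ls x ->
  E x = (Num.sqrt (\sum_i cross (real_mx x) 0 i ^+ 2))^-1 *: cross (real_mx x).
Proof. by move=> Lx; apply/(pos_normal_cross _ (Ls_regular Lx)); exact: hE. Qed.

Lemma csqrt_real (S : C -> C) (y : R) : (forall z, S z ^+ 2 = z /\ 0 <= reC (S z)) ->
  0 <= y -> S (toC y) = toC (Num.sqrt y).
Proof.
move=> hS y0; have [h1 h2] := hS (toC y).
have : S (toC y) ^+ 2 == toC (Num.sqrt y) ^+ 2 by rewrite h1 -rmorphXn /= sqr_sqrtr.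
rewrite eqf_sqr => /orP[/eqP //|/eqP h]; move: h2; rewrite h reN re_toC oppr_ge0 => h2.
have -> : Num.sqrt y = 0 by apply/eqP; rewrite eq_le h2 sqrtr_ge0.
by rewrite toC0 oppr0.
Qed.

Lemma reC_gt0_near (z1 z2 : C) : nm (z2 - z1) < reC z1 -> 0 < reC z2.
Proof.
move=> h; have := le_lt_trans (Re_le _) h.
by rewrite reB ltr_norml ltrBrDr addNr => /andP[].
Qed.

(** Any analytic parametrization c extends to a holomorphic f, along which the minors N_i are
    holomorphic. Q, the sum of the N_i^2, is positive at the base point, so N / sqrt Q is
    holomorphic nearby; on the real axis it is E along c. *)
Lemma E_analytic : real_analytic_on_curve Ls E.
Proof.
move=> a b c [cL ca _ _] s hs.
have [cs _] := ca s hs; have [f [r [r0 df fE]]] := derivable_of_analytic C cs.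
have Lc := cL s hs; have rc := Ls_regular Lc.
have fs : f (toC s) = vecC C (c s) by apply: fE; rewrite subrr normr0.
have dfs : derivable f (toC s) 1 by apply: df; rewrite subrr nm0.
have Wfs : W (f (toC s)) by rewrite fs; exact: regularW.
have [S hS] := csqrt_exists C.
have /nm_nbhsP[r1 r10 hr1] : nbhs (toC s : C) (f @^-1` W).
  by apply: (derivable_continuous dfs); exact: open_nbhs_nbhs.
pose r2 := Num.min r r1.
have r20 : 0 < r2 by rewrite lt_min r0.
have sub2 (z : C) : nm (z - toC s) < r2 -> derivable f z 1 /\ W (f z).
  by rewrite lt_min => /andP[h1 h2]; split; [exact: df|exact: hr1].
have shrink (z : C) : nm (z - toC s) < r2 -> exists2 r3 : R, 0 < r3 &
    forall y : C, nm (y - z) < r3 -> nm (y - toC s) < r2.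
  move=> zs; exists (r2 - nm (z - toC s)); first by rewrite subr_gt0.
  by move=> y yz; have := nmB_tri y z (toC s); lra.
(* Writing the i-th minor as a determinant with a unit vector in the last column brings it under
   [det_normal_mx_curve]. *)
pose N i z := \det (add_col (normal_mx (f z)) (delta_mx 0 i)).
have NE i z : N i z = cross (normal_mx (f z)) 0 i.
  rewrite /N det_add_col (bigD1 i)//= big1 => [|k ki].
    by rewrite addr0 [delta_mx _ _ _ _]mxE !eqxx mul1r.
  by rewrite [delta_mx _ _ _ _]mxE (negbTE ki) andbF mul0r.
have dN i z : nm (z - toC s) < r2 -> derivable (N i) z 1.
  move=> /shrink[r3 r30 h3]; apply: (@det_normal_mx_curve f z r3 _ r30) => y /h3/sub2[] //.
pose Q z := \sum_i N i z ^+ 2.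
have dQ z : nm (z - toC s) < r2 -> derivable Q z 1.
  move=> zs; have -> : Q = \sum_i (N i * N i).
    by apply/funext => y; rewrite /Q fct_sumE; apply: eq_bigr => i _; rewrite expr2.
  apply: derivable_sum => i; apply: derivableM; exact: dN.
have NR u i : Ls (c u) -> f (toC u) = vecC C (c u) -> N i (toC u) = toC (cross (real_mx (c u)) 0 i).
  move=> Lu Eu; rewrite NE Eu normal_mx_real; last exact/regularW/Ls_regular.
  by rewrite cross_map mxE.
have QR u : Ls (c u) -> f (toC u) = vecC C (c u) ->
    Q (toC u) = toC (\sum_i cross (real_mx (c u)) 0 i ^+ 2).
  move=> Lu Eu; rewrite /Q rmorph_sum; apply: eq_bigr => i _.
  by rewrite NR// rmorphXn.
have Qs : 0 < reC (Q (toC s)).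
  by rewrite QR// re_toC sum_sqr_gt0// cross_neq0// real_mx_rank.
have dQs : derivable Q (toC s) 1 by apply: dQ; rewrite subrr nm0.
have [r3 r30 hr3] := (nm_contP _ _).1 (derivable_continuous dQs) _ Qs.
have Qpos (z : C) : nm (z - toC s) < r3 -> 0 < reC (Q z).
  by move=> /hr3; exact: reC_gt0_near.
pose F z : 'rV[C]_n.+1 := \row_i ((S (Q z))^-1 * N i z).
have dF z : nm (z - toC s) < Num.min r2 r3 -> derivable F z 1.
  rewrite lt_min => /andP[z2 z3]; apply/derivable_mx_coord => i j; rewrite (ord1 i).
  have -> : (fun y => F y 0 j) = (fun y => (S (Q y))^-1) * N j.
    by apply/funext => y; rewrite mxE.
  have Qz := Qpos z z3.
  have dS : derivable (S \o Q) z 1.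
    apply: derivable_comp_diff; first exact: dQ.
    by apply/derivable1_diffP; exact: csqrt_derivable.
  apply: derivableM; last exact: dN.
  apply: (@derivableV _ _ (S \o Q)) => //=.
  apply/eqP => S0; have [S2 _] := hS (Q z); move: Qz; rewrite -S2 S0.
  by rewrite expr0n re0 ltxx.
have ab : 0 < Num.min (s - a) (b - s) by case/andP: hs => h1 h2; rewrite lt_min !subr_gt0 h1.
have m0 : 0 < Num.min r (Num.min (s - a) (b - s)) by rewrite lt_min r0.
have m1 : 0 < Num.min r2 r3 by rewrite lt_min r20.
apply: (real_analytic_near m0) (analytic_of_derivable m1 dF) => u.
rewrite !lt_min => /and3P[ur ua ub] /=.
have Lu : Ls (c u).
  by apply: cL; move: ua ub; rewrite /= !ltr_norml => /andP[? ?] /andP[? ?]; apply/andP; lra.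
have Eu : f (toC u) = vecC C (c u) by exact: fE.
rewrite E_cross//; apply/rowP => i; rewrite [LHS]mxE [F _ _ _]mxE NR// QR// (csqrt_real hS).
  by rewrite -fmorphV -toCM re_toC [RHS]mxE.
by apply: sumr_ge0 => k _; exact: sqr_ge0.
Qed.

Lemma E_det x : Ls x -> 0 < \det (add_col (real_mx x) (E x)).
Proof.
by move=> Lx; have [_ _ h] := (pos_normalE (E x) (regularW (Ls_regular Lx))).1 (hE Lx).
Qed.

Lemma E_unit x : Ls x -> \sum_i E x 0 i ^+ 2 = 1.
Proof.
by move=> Lx; have [h _ _] := (pos_normalE (E x) (regularW (Ls_regular Lx))).1 (hE Lx).
Qed.

(** Being orthogonal to V, the velocity at y is r E_y. Pairing it with E_x gives r <E_x, E_y> = 1,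
    and the positive determinant along the arc says <E_x, E_y> > 0. *)
Lemma velocity_E x g d rho u : Ls x -> is_arc x (E x) g d rho -> `|u| < d ->
  exists2 r : R, 0 < r & velocity g u = r *: E (arc g u).
Proof.
move=> Lx ha ud; have Lu := arc_in_Ls ha Lx ud.
set y := arc g u in Lu *.
have ry := real_mx_rank (Ls_regular Lu).
have N0 := sqrt_cross_gt0 ry.
set nN := Num.sqrt _ in N0.
have vE := kernel_cross ry (velocity_orthogonal ha ud).
have EE := E_cross Lu; rewrite -/nN in EE.
have NE : cross (real_mx y) = nN *: E y by rewrite EE scalerA divff ?scale1r// gt_eqF.
move: vE; rewrite NE scalerA; set r := _ * nN => vE; exists r => //.
have h1 := velocity_height ha ud; rewrite vE in h1.
have h2 := arc_det_gt0 ha ud; rewrite det_add_col -/y NE in h2.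
have E1 : \sum_i (r *: E y) 0 i * E x 0 i = r * \sum_i E x 0 i * E y 0 i.
  by rewrite mulr_sumr; apply: eq_bigr => i _; rewrite mxE; ring.
have E2 : \sum_i E x 0 i * (nN *: E y) 0 i = nN * \sum_i E x 0 i * E y 0 i.
  by rewrite mulr_sumr; apply: eq_bigr => i _; rewrite mxE; ring.
rewrite E1 in h1; rewrite E2 pmulr_rgt0// in h2.
by rewrite -(pmulr_lgt0 r h2) h1 ltr01.
Qed.

Lemma curve_conclusion :
  [/\ real_analytic_curve Ls, forall x, Ls x -> tangent_vector Ls x (E x),
      real_analytic_on_curve Ls E & defines_orientation Ls E].
Proof.
have exarc x : Ls x -> exists g d rho, is_arc x (E x) g d rho.
  by move=> Lx; apply: local_arc; [exact: Ls_regular|exact: E_det].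
split; last 1 first.
- move=> x Lx; have [g [d [rho ha]]] := exarc x Lx; have [d0 _ _ _ _] := ha.
  exists (- d), d, (arc g); split; first exact: arc_analytic_param ha Lx.
    by exists 0; [rewrite oppr_lt0 d0|exact: arc_start ha (Ls_regular Lx)].
  move=> s; rewrite -ltr_norml => sd; have [r r0 rE] := velocity_E Lx ha sd.
  by exists r => //; rewrite derive1E -rE; have [_ ->] := arc_is_derive ha sd.
- move=> x Lx; have [g [d [rho ha]]] := exarc x Lx; have [d0 _ _ _ _] := ha.
  exists (- d), d, (arc g); split; first exact: arc_analytic_param ha Lx.
  by exists 0; [rewrite oppr_lt0 d0|exact: arc_start ha (Ls_regular Lx)].
- move=> x Lx; have [g [d [rho ha]]] := exarc x Lx; have [d0 _ _ _ _] := ha.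
  have n00 : `|0 : R| < d by rewrite normr0.
  have gx := arc_start ha (Ls_regular Lx).
  exists (arc g); split=> //.
    apply/nbhs_normP; exists d => // u /=; rewrite sub0r normrN.
    exact: arc_in_Ls ha Lx u.
  have [r r0 rE] := velocity_E Lx ha n00.
  (* At the base point the pairing with the unit vector E_x is 1, so the velocity is E_x itself and
     not only a positive multiple. *)
  have r1 : r = 1.
    have := velocity_height ha n00; rewrite rE gx => h.
    transitivity (r * \sum_i E x 0 i ^+ 2); first by rewrite E_unit ?mulr1.
    apply: etrans h; rewrite mulr_sumr; apply: eq_bigr => i _.
    by rewrite mxE -mulrA -expr2.
  by have := arc_is_derive ha n00; rewrite rE gx r1 scale1r.
- exact: E_analytic.
Qed.

End Curve.

(** * The additional critical relation and the sign of its derivative along E *)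

Section Additional.
Variables (x e : 'rV[R]_n.+1) (W1 : set 'rV[C]_n.+1) (U1 : set C).
Variables (G' : 'rV[C]_n.+1 -> C -> C) (g : C -> C) (P : set C) (qn : nat) (tn : target n).
Local Notation c := (vecC C x).
Local Notation P0 := [set p c 0 m | m in [set: 'I_n.+1]].
Local Notation cn := (c 0 ord_max).
Hypotheses (rx : regular x) (pe : pos_normal x e).
Hypotheses (oW1 : open W1) (W1c : W1 c) (oU1 : open U1) (UU1 : U `<=` U1).
Hypothesis G'E : forall w z, W1 w -> U z -> G' w z = G w z.
Hypothesis dG' : forall y : 'rV[C]_n.+1 * C, (W1 `*` U1) y ->
  differentiable (fun y : 'rV[C]_n.+1 * C => G' y.1 y.2) y.
Hypothesis gE : forall z, U1 z -> g z = G' c z.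
Hypothesis gp : forall j, g (p c 0 j) = c 0 j.
Hypotheses (P0P : P0 `<=` P) (gP : g @` P `<=` P) (PU : P `\` P0 `<=` U1).
Hypotheses (qn0 : (0 < qn)%N) (tnv : valid_target qn tn).
Hypothesis avoid : forall k, (k < qn.-1)%N -> ~ P0 (iter k g cn).

Definition relation_row (w : 'rV[C]_n.+1) : 'rV[C]_n.+1 :=
  \row_(i < n.+1) ext_last (fun j => rel_fun j w) (relation G' p ord_max qn tn w) i.

Lemma relation_row_low l : (fun w => relation_row w 0 (lift ord_max l)) = rel_fun l.
Proof. by apply/funext => w; rewrite mxE ext_last_low. Qed.

Lemma relation_row_max : (fun w => relation_row w 0 ord_max) = relation G' p ord_max qn tn.
Proof. by apply/funext => w; rewrite mxE ext_last_max. Qed.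

Definition transversality : Prop :=
  0 < \det ('J relation_row c) /
      \prod_(j < n.+1) derive1 (iter (ext_last q qn j).-1 g) (c 0 j).

Lemma iter_eq_on (T : Type) (h h' : T -> T) (A : set T) (m : nat) (z : T) :
  (forall y, A y -> h y = h' y) -> (forall k, (k < m)%N -> A (iter k h z)) ->
  forall k, (k <= m)%N -> iter k h' z = iter k h z.
Proof.
move=> hE Ah; elim=> // k ih km; rewrite !iterS ih ?(ltnW km)// hE//.
exact: Ah.
Qed.

Lemma marked_orbit k : P (iter k g cn).
Proof.
elim: k => [|k ih] /=; apply: gP; last by exists (iter k g cn).
by exists (p c 0 ord_max); [apply: P0P; exists ord_max|exact: gp].
Qed.

(** The orbit of c_nu = g(p_nu) stays in the invariant set P. Before time qn - 1 it avoids P0, hence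
    lies in U1, where g is the deformed map at c. *)
Lemma marked_orbit_in : orbit_in W1 U1 G' qn.-1 (c, cn).
Proof.
have UP k : (k < qn.-1)%N -> U1 (iter k g cn).
  by move=> kq; apply: PU; split; [exact: marked_orbit|exact: avoid].
split=> //= k kq.
by rewrite (iter_eq_on gE UP) ?(ltnW kq)//; exact: UP.
Qed.

Lemma additional_relation_differentiable : differentiable (relation G' p ord_max qn tn) c.
Proof.
apply: (relation_differentiable oW1 oU1 dG') => //; last exact: marked_orbit_in.
by apply: dp; exact: regularW.
Qed.

(** The transversality quotient differentiates iterates of g, whereas V_w uses those of G. Both maps
    agree on the open set U, which contains the relevant orbits of all points near c_j. *)
Lemma marked_orb_der j : derive1 (iter (q j).-1 g) (c 0 (low j)) = orb_der j c.
Proof.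
rewrite /orb_der !derive1E; apply: near_eq_derive.
have Wc := regularW rx.
have [oA _] := orbit_open_diff oW oU dG (q j).-1.
have cP : continuous (fun z : C => (c, z)).
  move=> z.
  have h1 : (fun _ : C => c) @ z --> c by apply: cst_continuous.
  have h2 : (fun u : C => u) @ z --> z by [].
  exact: (@cvg_pair _ _ _ (nbhs z) (nbhs c) (nbhs z) (nbhs_filter z) (nbhs_filter c)
    (nbhs_filter z) _ _ h1 h2).
have /nm_nbhsP[r r0 hr] : nbhs (c 0 (low j)) ((fun z : C => (c, z)) @^-1` orbit_in W U G (q j).-1).
  by apply: open_nbhs_nbhs; split; [apply: open_comp => // z _; exact: cP|exact: orbW].
apply/nm_nbhsP; exists r => // z /hr[_ /= Uz].
apply: (@iter_eq_on _ (G c) g U (q j).-1 z _ Uz) => // y Uy.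
by rewrite gE; [rewrite G'E|exact: UU1].
Qed.

Lemma relation_row_J i j : ('J relation_row c) i j =
  'D_(delta_mx 0 i) (fun w => relation_row w 0 j) c.
Proof.
have dF : differentiable relation_row c.
  apply: differentiable_row => k; case: (unliftP ord_max k) => [l ->|->].
    by rewrite relation_row_low; apply: rel_fun_differentiable; exact: regularW.
  by rewrite relation_row_max; exact: additional_relation_differentiable.
have := deriveEjacobian (delta_mx 0 i) dF; rewrite -rowE => E.
have -> : ('J relation_row c) i j = ('D_(delta_mx 0 i) relation_row c) 0 j.
  by rewrite E [RHS]mxE.
have /derivableP/is_derive_mxP/(_ 0 j)[_ ->] // : derivable relation_row c (delta_mx 0 i).
exact: diff_derivable.
Qed.

Lemma transversality_normal : transversality ->
  0 < (derive1 (iter qn.-1 g) cn)^-1 * 'D_(vecC C e) (relation G' p ord_max qn tn) c.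
Proof.
set Rn := relation G' p ord_max qn tn; set an := derive1 _ cn.
have dRn : differentiable Rn c := additional_relation_differentiable.
pose u : 'rV[C]_n.+1 := \row_i (an^-1 * 'D_(delta_mx 0 i) Rn c).
pose a : 'rV[C]_n.+1 := \row_j (derive1 (iter (ext_last q qn j).-1 g) (c 0 j))^-1.
(* Dividing each column of the Jacobian by its orbit derivative turns the transversality quotient
   into det [V_c, u]. *)
have JE : 'J relation_row c *m diag_mx a = add_col (normal_mx c) u.
  apply/matrixP => i j; rewrite mul_mx_diag [LHS]mxE relation_row_J [a 0 j]mxE mulrC.
  case: (unliftP ord_max j) => [l ->|->].
    by rewrite relation_row_low add_col_low [RHS]mxE ext_last_low marked_orb_der.
  by rewrite relation_row_max add_col_max [RHS]mxE ext_last_max.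
move=> tr; have : 0 < \det (add_col (normal_mx c) u).
  move: tr; rewrite /transversality -JE det_mulmx det_diag -prodfV.
  suff -> : \prod_i a 0 i = \prod_(j < n.+1) (derive1 (iter (ext_last q qn j).-1 g) (c 0 j))^-1 by [].
  by apply: eq_bigr => j _; rewrite mxE.
have Wc := regularW rx.
rewrite det_add_col normal_mx_real// cross_map => pos.
have [[_ _]] := rx; rewrite rank_real_mx// => /sqrt_cross_gt0 N0.
rewrite ((pos_normal_cross e rx).1 pe); set N := Num.sqrt _ in N0 *.
have -> : an^-1 * 'D_(vecC C (N^-1 *: cross (real_mx x))) Rn c =
    toC N^-1 * \sum_i u 0 i * (map_mx toC (cross (real_mx x))) 0 i.
  rewrite deriveE// diff_row// !mulr_sumr; apply: eq_bigr => i _.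
  by rewrite [vecC C _ 0 i]mxE [X in toC X]mxE toCM [map_mx _ _ 0 i]mxE [u 0 i]mxE; ring.
by rewrite mulr_gt0// -(toC0 C) toC_lt invr_gt0.
Qed.

End Additional.
End Regular.

Theorem theorem8p1 (R : realType) (n : nat) (M : partially_marked_family R n)
    (M_real : real_family M)
    (t : 'I_n -> target n) (t_valid : forall j, valid_target (pm_q M j) (t j))
    (Ls : set 'rV[R]_n.+1)
    (Ls_max : maximal_connected (regular_points M t) Ls) :
  (forall w, Ls w -> exists! e, positive_unit_normal M t w e) /\
  forall E : 'rV[R]_n.+1 -> 'rV[R]_n.+1,
    (forall w, Ls w -> positive_unit_normal M t w (E w)) ->
    [/\ real_analytic_curve Ls,
        forall w, Ls w -> tangent_vector Ls w (E w),
        real_analytic_on_curve Ls E &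
        defines_orientation Ls E] /\
    (forall c1 : 'rV[R]_n.+1, Ls c1 ->
      forall (W1 : set 'rV[Cx R]_n.+1) (U1 : set (Cx R))
        (G' : 'rV[Cx R]_n.+1 -> Cx R -> Cx R) (g : Cx R -> Cx R)
        (qn : nat) (tn : target n),
      let c := vecCx c1 in
      marked_map (marked_points (pm_p M) c) U1 g ->
      local_deformation M c g W1 U1 G' ->
      additional_relation M c g qn tn ->
      positively_oriented_transversality M t c g G' qn tn ->
      0 < (derive1 (iter qn.-1 g) (c 0 ord_max))^-1 *
          'D_(vecCx (E c1)) (critical_relation G' (pm_p M) ord_max qn tn) c).
Proof.
have [_ _ Gconj pconj] := M_real.
have uniq := @unique_pos_normal R (Cx_model R) n _ _ _ _ _ t (@pm_W_open R n M)
  (@pm_U_open R n M) (@pm_p_holo R n M) (@pm_G_holo R n M) (@pm_q_gt0 R n M)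
  (@pm_orbit R n M) Gconj pconj t_valid.
have [regular_Ls _ _] := Ls_max; split; first by move=> w /regular_Ls; exact: uniq.
move=> E hE.
split.
  exact: (@curve_conclusion R (Cx_model R) n _ _ _ _ _ t (@pm_W_open R n M)
  (@pm_U_open R n M) (@pm_p_holo R n M) (@pm_G_holo R n M) (@pm_DG_neq0 R n M) (@pm_q_gt0 R n M)
  (@pm_orbit R n M) Gconj pconj t_valid Ls Ls_max E hE).
move=> c1 Lc1 W1 U1 G' g qn tn c [_ [P [[_ P0P gP] [PU _ _]]]].
move=> [[oW1 W1c W1W oU1 UU1] [G'E dG' _ gE gp]] [qn0 tnv av].
(* Common to both alternatives: the points with k < qn - 1 are those at which [G'] is evaluated to
   reach the iterate qn - 1. *)
have avoid k : (k < qn.-1)%N -> ~ marked_points (pm_p M) c (iter k g (c 0 ord_max)).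
  by case: tn tnv av => [m|l] _ [_ av] kq; apply: av => //; exact: ltnW.

exact: (@transversality_normal R (Cx_model R) n _ _ _ _ _ t (@pm_W_open R n M)
  (@pm_U_open R n M) (@pm_p_holo R n M) (@pm_G_holo R n M) (@pm_q_gt0 R n M)
  (@pm_orbit R n M) Gconj pconj t_valid c1 (E c1) W1 U1 G' g P qn tn (regular_Ls _ Lc1)
  (hE _ Lc1) oW1 W1c oU1 UU1 G'E dG' gE gp P0P gP PU qn0 tnv avoid).
Qed.
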